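(* For every $N\ge3$ define $$\mu_N^{\mathrm{SF}}:=\frac1N\sum_{z\in\operatorname{spec}(-B_N/2)}\delta_z,$$ with eigenvalues counted with algebraic multiplicity. Then, as $N\to\infty$ through all integers, $\mu_N^{\mathrm{SF}}\Longrightarrow\mu_{\pi/2}$ weakly. Moreover, for every polynomial $P(z,\bar z)$, $$\frac1N\sum_{z\in\operatorname{spec}(-B_N/2)}P(z,\bar z)=\int_{\mathbb C}P(z,\bar z)\,d\mu_{\pi/2}(z)+\mathcal O_P(N^{-1}),$$ with eigenvalues counted with algebraic multiplicity.
   Context: Indices of $\mathbb C^N$ are in $\mathbb Z/N\mathbb Z$; $Se_j=e_{j+1}$ is the periodic shift. The Scottish flag matrix is $B_N=S-S^{-1}+2\operatorname{diag}(\sin(2\pi j/N))_{j\in\mathbb Z/N\mathbb Z}$. The measure $\mu_{\pi/2}$ on $\mathbb C$ is $$\mu_{\pi/2}=(R_{\pi/4})_{\#}\bigl(g(t)\,dt\bigr)+(R_{3\pi/4})_{\#}\bigl(g(t)\,dt\bigr),\qquad g(t)=\begin{cases}\frac1{\pi^2}\mathsf K\bigl(\sqrt{\tfrac12-\tfrac{t^2}{4}}\bigr),&|t|<\sqrt2,\\0,&|t|\ge\sqrt2,\end{cases}$$ where $R_\alpha:\mathbb R\to\mathbb C$, $R_\alpha(t)=e^{i\alpha}t$, $(\cdot)_{\#}$ denotes push-forward of measures, and $\mathsf K(k)=\int_0^{\pi/2}\frac{d\alpha}{\sqrt{1-k^2\sin^2\alpha}}$ ($0\le k<1$) is the complete elliptic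 integral of the first kind in the modulus convention. $\delta_z$ is the point mass at $z$. *)

(* Defs.v *)
From HB Require Import structures.
From mathcomp Require Import all_boot all_order all_algebra.
From mathcomp Require Import polyXY.
From mathcomp Require Import all_classical all_reals all_analysis.
From mathcomp Require Import measurable_realfun.
From mathcomp Require Import complex.

Set Implicit Arguments.
Unset Strict Implicit.
Unset Printing Implicit Defensive.

Import Order.TTheory GRing.Theory Num.Theory.
Import numFieldNormedType.Exports.

Local Open Scope classical_set_scope.
Local Open Scope ring_scope.
Local Open Scope complex_scope.

(* ℂ with its Borel σ-algebra. The topology of the field R[i] is carried by
   its regular alias R[i]^o. *)
Notation borelC R := (g_sigma_algebraType (@open (R[i]^o))).

Section Matrices.
Variables (R : realType) (N : nat).

(* The index set ℤ/Nℤ is 'I_N, with cyclic successor [ordS]. *)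
Definition shift_mx : 'M[R[i]]_N := \matrix_(i, j) (i == ordS j)%:R.

(* [invmx] returns its argument on singular matrices; this shows that
   [invmx shift_mx] is the genuine inverse. *)
Lemma shift_mx_unit : shift_mx \in unitmx.
Proof.
have /mulmx1_unit[] // : shift_mx *m shift_mx^T = 1%:M.
apply/matrixP => i j; rewrite !mxE.
rewrite (bigD1 (ord_pred i)) //= !mxE ord_predK eqxx mul1r eq_sym.
rewrite big1 ?addr0 // => k ki; rewrite !mxE.
suff -> : (i == ordS k) = false by rewrite mul0r.
by apply: contraNF ki => /eqP ->; rewrite ordSK.
Qed.

Definition scottish_flag_mx : 'M[R[i]]_N :=
  shift_mx - invmx shift_mx +
  2 *: diag_mx (\row_(j < N) (sin (2 * pi * j%:R / N%:R : R))%:C).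

End Matrices.

Section Spectrum.
Variables (R : realType) (N : nat).
Implicit Type A : 'M[R[i]]_N.

(* The roots of the characteristic polynomial, each repeated according to its
   multiplicity; their order in the sequence is arbitrary. *)
Definition spec A : seq R[i] := sval (closed_field_poly_normal (char_poly A)).

Lemma char_poly_spec A : char_poly A = \prod_(z <- spec A) ('X - z%:P).
Proof.
rewrite /spec; case: closed_field_poly_normal => s /= {1}->.
by rewrite (monicP (char_poly_monic A)) scale1r.
Qed.

End Spectrum.

Section EmpiricalMeasure.
Variable R : realType.

(* (1/N) Σ_{z ∈ s} δ_z *)
Definition mean_dirac (N : nat) (s : seq R[i]) :
    {measure set (borelC R) -> \bar R} :=
  mscale (N%:R^-1 : R)%:nng
    (msum (fun k => @dirac _ (borelC R) s`_k R) (size s)).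

Definition mu_SF (N : nat) : {measure set (borelC R) -> \bar R} :=
  mean_dirac N (spec (- 2^-1 *: scottish_flag_mx R N)).

End EmpiricalMeasure.

Section LimitMeasure.
Variable R : realType.
Local Notation leb := (@lebesgue_measure R).

(* Modulus convention: the argument k enters as k^2. *)
Definition elliptic_K (k : R) : R :=
  \int[leb]_(a in `[0, pi / 2]) (Num.sqrt (1 - k ^+ 2 * sin a ^+ 2))^-1.

Definition SF_density (t : R) : R :=
  if `|t| < Num.sqrt 2
  then (pi ^+ 2)^-1 * elliptic_K (Num.sqrt (2^-1 - t ^+ 2 / 4))
  else 0.

Lemma SF_density_ge0 t : 0 <= SF_density t.
Proof.
rewrite /SF_density; case: ifP => // _; apply: mulr_ge0.
  by rewrite invr_ge0 exprn_ge0 ?pi_ge0.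
by apply: Rintegral_ge0 => a _; rewrite invr_ge0 sqrtr_ge0.
Qed.

Let measurable_inv : measurable_fun setT (fun x : R => x^-1).
Proof.
rewrite -(setvU [set 0 : R]); apply/measurable_funU => //.
  exact/measurableC.
split; last exact: measurable_fun_set1.
apply: open_continuous_measurable_fun.
  by apply: closed_openC; exact: closed_eq.
by move=> x; rewrite inE /= => /eqP x0; exact: inv_continuous.
Qed.

Let measurable_sqrt : measurable_fun setT (@Num.sqrt R).
Proof. by apply: continuous_measurable_fun; exact: sqrt_continuous. Qed.

Let measurable_elliptic_K : measurable_fun setT elliptic_K.
Proof.
pose f (p : measurableTypeR R * measurableTypeR R) : \bar R :=
  (Num.sqrt (1 - p.1 ^+ 2 * sin p.2 ^+ 2))^-1%:E.
pose D : set (measurableTypeR R * measurableTypeR R) := [set: measurableTypeR R] `*` `[0, pi / 2].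
have mD : measurable D by exact: measurableX.
have mf : measurable_fun setT f.
  apply/measurable_EFinP; apply: (measurableT_comp measurable_inv).
  apply: (measurableT_comp measurable_sqrt).
  apply: measurable_funB => //; apply: measurable_funM.
    exact: measurable_funX.
  apply: measurable_funX; apply: measurableT_comp => //.
  by apply: continuous_measurable_fun; exact: continuous_sin.
have mfD : measurable_fun setT (f \_ D).
  by apply/(measurable_restrictT _ mD); exact: measurable_funTS.
have f0 p : (0 <= (f \_ D) p)%E.
  rewrite patchE; case: ifP => // _.
  by rewrite lee_fin invr_ge0 sqrtr_ge0.
have mF : measurable_fun setT (fubini_F leb (f \_ D)).
  exact: measurable_fun_fubini_tonelli_F.
rewrite /elliptic_K /Rintegral; apply: measurableT_comp => //.
rewrite (_ : (fun x => _) = fubini_F leb (f \_ D)) //.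
apply/funext => x; rewrite /fubini_F [LHS]integral_mkcond.
apply: eq_integral => y _; rewrite !patchE /f /D /=.
by congr (if _ then _ else _); rewrite in_setX /= in_setT.
Qed.

Lemma measurable_SF_density : measurable_fun setT SF_density.
Proof.
apply: measurable_fun_ifT => //=.
  by apply: measurable_fun_ltr => //; exact: measurableT_comp.
apply: measurable_funM => //; apply: measurableT_comp => //.
apply: measurableT_comp => //; apply: measurable_funB => //.
by apply: measurable_funM => //; exact: measurable_funX.
Qed.

(* g(t) dt *)
Definition SF_line_measure (A : set (measurableTypeR R)) : \bar R :=
  (\int[leb]_(t in A) (SF_density t)%:E)%E.

Let SF_line0 : SF_line_measure set0 = 0%E.
Proof. exact: integral_set0. Qed.

Let SF_line_ge0 A : (0 <= SF_line_measure A)%E.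
Proof. by apply: integral_ge0 => t _; rewrite lee_fin SF_density_ge0. Qed.

Let SF_line_sigma_additive : semi_sigma_additive SF_line_measure.
Proof.
apply: semi_sigma_additive_nng_induced.
  by apply/measurable_EFinP; exact: measurable_SF_density.
by move=> t; rewrite lee_fin SF_density_ge0.
Qed.

HB.instance Definition _ := isMeasure.Build _ _ _ SF_line_measure
  SF_line0 SF_line_ge0 SF_line_sigma_additive.

(* t |-> e^{i alpha} t *)
Definition ray (alpha : R) (t : measurableTypeR R) : borelC R :=
  (cos alpha +i* sin alpha) * (t : R)%:C.

Let continuous_ray (alpha : R) : continuous (ray alpha : R -> R[i]^o).
Proof.
move=> t0; apply/(@cvgrPdist_lt _ R[i]^o) => e e0.
have [re ee] : 0 < complex.Re e /\ e = (complex.Re e)%:C.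
  by case: e e0 => a b; rewrite ltcE /= => /andP[/eqP -> ?]; split.
have : \forall t \near t0, `|t0 - t| < complex.Re e.
  exact: (nbhsx_ballx (t0 : R) _ re).
apply: filterS => t; rewrite {2}ee -ltcR; apply: le_lt_trans.
rewrite /ray -mulrBr -rmorphB normrM normc_def /= cos2Dsin2 sqrtr1 mul1r.
by rewrite normc_def /= expr0n /= addr0 sqrtr_sqr.
Qed.

Lemma measurable_ray alpha : measurable_fun setT (ray alpha).
Proof.
apply: (@measurability _ _ (measurableTypeR R) (borelC R) _ _ (@open R[i]^o)).
  by [].
move=> _ [A oA <-]; rewrite setTI.
apply: open_measurable.
by move/continuousP: (@continuous_ray alpha); apply.
Qed.

Definition ray_measure (alpha : R) : set (borelC R) -> \bar R :=
  pushforward SF_line_measure (ray alpha).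

Let ray_measure0 alpha : ray_measure alpha set0 = 0%E.
Proof. by rewrite /ray_measure /pushforward preimage_set0 measure0. Qed.

Let ray_measure_ge0 alpha A : (0 <= ray_measure alpha A)%E.
Proof. exact: SF_line_ge0. Qed.

Let ray_measure_sigma_additive alpha : semi_sigma_additive (ray_measure alpha).
Proof.
by apply: measure_semi_sigma_additive; exact: measurable_ray.
Qed.

HB.instance Definition _ alpha := isMeasure.Build _ _ _ (ray_measure alpha)
  (ray_measure0 alpha) (@ray_measure_ge0 alpha)
  (@ray_measure_sigma_additive alpha).

Definition mu_pi2 : {measure set (borelC R) -> \bar R} :=
  measure_add (ray_measure (pi / 4)) (ray_measure (3 * pi / 4)).

End LimitMeasure.

Section Convergence.
Variable R : realType.
Implicit Types m : {measure set (borelC R) -> \bar R}.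

Definition weak_cvg (m_ : nat -> {measure set (borelC R) -> \bar R}) m :=
  forall f : R[i]^o -> R, continuous f -> (exists M, forall z, `|f z| <= M) ->
  (\int[m_ N]_z (f z)%:E)%E @[N --> \oo] --> (\int[m]_z (f z)%:E)%E.

(* Integral of a complex-valued function, by real and imaginary parts. *)
Definition Cintegral m (f : R[i] -> R[i]) : R[i] :=
  (\int[m]_z complex.Re (f z)) +i* (\int[m]_z complex.Im (f z)).

(* P(z, z̄): a polynomial in two variables with complex coefficients, evaluated
   at the first variable z and the second variable z̄. *)
Definition eval_conj (P : {poly {poly R[i]}}) (z : R[i]) : R[i] := P.[z, z^*%R].

End Convergence.

(* Main.v *)
(** Put [A := -B_N/2]. A Fresnel (discrete chirp) matrix conjugates [A] to a
    cyclic tridiagonal matrix whose two opposite hopping amplitudes on edge [j]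
    have product [(i/2) cos phi_j], where the angles [phi_j] are equidistributed
    on the circle. A diagonal gauge makes both amplitudes equal to one square root
    [s(phi_j)] of this product. The gauged matrix [M] is nearly normal:
    [tr ((M M^* )^2) - |tr M^4| = O(1/N)], which forces the strictly triangular
    part of its Schur form to have bounded Frobenius norm. Therefore the sum of
    [z^a conj(z)^b] over the spectrum equals [tr (M^a M^*^b) + O(1)]; as [s] has
    bounded variation, this trace is the number of closed hopping paths of length
    [a + b] times [sum_j s(phi_j)^a conj(s(phi_j))^b], up to [O(1)], and the last
    sum is a Riemann sum. On the side of the limit measure, the elliptic integral
    is rewritten as the integral of [(2 cos phi - t^2)^(-1/2)] over [phi], and
    Tonelli's theorem yields the same moments. Weak convergence follows, because
    the spectrum lies in the disc of radius 2, where Bernstein polynomials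
    approximate a continuous test function uniformly. *)

Require Import Defs.
From mathcomp Require Import all_boot all_order all_algebra.
From mathcomp Require Import polyXY sesquilinear spectral.
From mathcomp Require Import all_classical all_reals all_analysis.
From mathcomp Require Import measurable_realfun.
From mathcomp Require Import complex.
From mathcomp Require Import ring lra zify.

Set Implicit Arguments.
Unset Strict Implicit.
Unset Printing Implicit Defensive.

Import Order.TTheory GRing.Theory Num.Theory.
Import numFieldNormedType.Exports.

Local Open Scope classical_set_scope.
Local Open Scope ring_scope.

(** * Nearly normal matrices *)

Section NearNormal.
Local Open Scope sesquilinear_scope.
Variable C : numClosedFieldType.
Implicit Types n a b : nat.

(** The fourth power is the lowest that works. On the lines through [e^{i pi/4}] and [e^{3 i pi/4}],
    where the limiting spectrum lies, [z^2] is [i t^2] and [-i t^2], so the contributions to the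
    trace of [M^2] cancel; [z^4 = -t^4] on both lines, and nothing cancels. The comparison controls
    only the squares of the row masses, and passing to the masses costs a factor [N]: a difference
    [O(1/N)] is just enough. It is that small because neighbouring edges have almost equal products;
    where [cos phi] changes sign, both are [O(1/N)] and enter squared. Two obstacles shape the
    gauge. Around a cycle it need not close up, and at a zero of [cos phi] only one amplitude of the
    edge survives, which no gauge can balance. The reflection [phi -> -phi] reduces the first defect
    to a phase, left on the last edge; the surviving amplitude is scaled down to [O(1/N)]. Both
    changes are [O(1)] in the sum of the moduli of all entries, which the trace comparison
    tolerates. *)

Definition fro m n (X : 'M[C]_(m, n)) : C := \sum_i \sum_j `|X i j| ^+ 2.

Definition off n (X : 'M[C]_n) : C := \sum_i \sum_(j | j != i) `|X i j| ^+ 2.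

Lemma fro_tr m n (X : 'M[C]_(m, n)) : fro X = \tr (X *m X^t*).
Proof.
by apply: eq_bigr => i _; rewrite mxE; apply: eq_bigr => j _; rewrite !mxE normCK.
Qed.

Lemma fro_adj m n (X : 'M[C]_(m, n)) : fro (X^t*) = fro X.
Proof.
rewrite /fro exchange_big; apply: eq_bigr => i _; apply: eq_bigr => j _.
by rewrite !mxE norm_conjC.
Qed.

Lemma fro_unitaryr m n (X : 'M[C]_(m, n)) (U : 'M[C]_n) :
  U \is unitarymx -> fro (X *m U) = fro X.
Proof.
by move=> /unitarymxP UU; rewrite !fro_tr trmx_mul map_mxM mulmxA -(mulmxA X) UU mulmx1.
Qed.

Lemma adj_unitary n (U : 'M[C]_n) : U \is unitarymx -> U^t* \is unitarymx.
Proof. by rewrite trmxC_unitary. Qed.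

Lemma fro_unitaryl m n (U : 'M[C]_m) (X : 'M[C]_(m, n)) :
  U \is unitarymx -> fro (U *m X) = fro X.
Proof.
move=> uU; rewrite -fro_adj trmx_mul map_mxM fro_unitaryr ?fro_adj //.
exact: adj_unitary.
Qed.

Lemma fro_off n (X : 'M[C]_n) : fro X = \sum_i `|X i i| ^+ 2 + off X.
Proof. by rewrite /off -big_split; apply: eq_bigr => i _; rewrite (bigD1 i). Qed.

Lemma trig_mulmx n (X Y : 'M[C]_n) : is_trig_mx X -> is_trig_mx Y ->
  is_trig_mx (X *m Y) /\ forall i, (X *m Y) i i = X i i * Y i i.
Proof.
move=> /is_trig_mxP tX /is_trig_mxP tY; split.
  apply/is_trig_mxP => i j ij; rewrite mxE big1 // => k _.
  have [ik|ki] := ltnP i k; first by rewrite tX ?mul0r.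
  by rewrite tY ?mulr0 // (leq_ltn_trans ki).
move=> i; rewrite mxE (bigD1 i) //= big1 ?addr0 // => k ki.
have [ik|ki'] := ltnP i k; first by rewrite tX ?mul0r.
by rewrite tY ?mulr0 // ltn_neqAle ki' andbT.
Qed.

Lemma trig_exp n (X : 'M[C]_n) a : is_trig_mx X ->
  is_trig_mx (X ^+ a) /\ forall i, (X ^+ a) i i = X i i ^+ a.
Proof.
move=> tX; elim: a => [|a [tXa dXa]].
  split; first exact: scalar_mx_is_trig.
  by move=> i; rewrite !expr0 mxE eqxx.
have [t d] := trig_mulmx tXa tX; rewrite exprSr; split=> // i.
by rewrite [LHS]d dXa exprSr.
Qed.

Lemma normD_sqr_le (x y : C) : `|x + y| ^+ 2 <= 2 * `|x| ^+ 2 + 2 * `|y| ^+ 2.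
Proof.
have h : `|x + y| ^+ 2 <= (`|x| + `|y|) ^+ 2 by rewrite lerXn2r ?nnegrE ?addr_ge0 // ler_normD.
apply: (le_trans h); rewrite -subr_ge0.
have -> : 2 * `|x| ^+ 2 + 2 * `|y| ^+ 2 - (`|x| + `|y|) ^+ 2 = (`|x| - `|y|) ^+ 2 by ring.
by rewrite real_exprn_even_ge0 // rpredB // ger0_real.
Qed.

Lemma normM_le_half (x y : C) : `|x * y| <= 2^-1 * (`|x| ^+ 2 + `|y| ^+ 2).
Proof.
rewrite normrM -subr_ge0.
have -> : 2^-1 * (`|x| ^+ 2 + `|y| ^+ 2) - `|x| * `|y| = 2^-1 * (`|x| - `|y|) ^+ 2 by field.
by rewrite mulr_ge0 ?invr_ge0 // real_exprn_even_ge0 // rpredB // ger0_real.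
Qed.

Fixpoint off_const (k : C) a : C :=
  if a is a'.+1 then 2 * k ^+ a' + 2 * k * off_const k a' else 0.

Lemma off_const_ge0 k a : 0 <= k -> 0 <= off_const k a.
Proof.
by move=> k0; elim: a => //= a IH; rewrite addr_ge0 // ?mulr_ge0 // exprn_ge0.
Qed.

(** Split [T ^+ a] into its diagonal and the rest [Y]. After one more factor [T], the diagonal
    scales the off-diagonal entries of [T] by powers of [T i i], and [fro Y] grows at most [k]
    times. These are the two terms of [off_const], each doubled by [normD_sqr_le]; the size [n] does
    not enter. *)
Lemma off_exp_le n (T : 'M[C]_n) (k : C) a : is_trig_mx T -> 0 <= k ->
  (forall Y : 'M[C]_n, fro (Y *m T) <= k * fro Y) ->
  off (T ^+ a) <= off_const k a * off T.
Proof.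
move=> tT k0 hT.
(* Testing [hT] on a matrix unit bounds the mass of the whole row [i] of [T], in particular its
   diagonal entry. *)
have dT i : `|T i i| ^+ 2 <= k.
  have := hT (delta_mx i i).
  have -> : fro (delta_mx i i : 'M[C]_n) = 1.
    rewrite /fro (bigD1 i) //= (bigD1 i) //= !big1 ?addr0.
    - by rewrite mxE !eqxx normr1 expr1n.
    - by move=> j ji; apply: big1 => l _; rewrite mxE (negbTE ji) normr0 expr0n.
    - by move=> l li; rewrite mxE (negbTE li) andbF normr0 expr0n.
  rewrite mulr1; apply: le_trans.
  rewrite /fro (bigD1 i) //= (bigD1 i) //=.
  have -> : (delta_mx i i *m T) i i = T i i.
    rewrite mxE (bigD1 i) //= mxE !eqxx mul1r big1 ?addr0 // => l li.
    by rewrite mxE (negbTE li) andbF mul0r.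
  rewrite -addrA lerDl addr_ge0 //.
    by apply: sumr_ge0 => l _; rewrite exprn_ge0.
  by apply: sumr_ge0 => l _; apply: sumr_ge0 => m _; rewrite exprn_ge0.
elim: a => [|a IH] /=.
  rewrite mul0r /off big1 // => i _; rewrite big1 // => j ji.
  by rewrite expr0 mxE eq_sym (negbTE ji) normr0 expr0n.
pose Y : 'M[C]_n := \matrix_(i, j) if j == i then 0 else (T ^+ a) i j.
have froY : fro Y = off (T ^+ a).
  apply: eq_bigr => i _; rewrite (bigD1 i) //= mxE eqxx normr0 expr0n add0r.
  by apply: eq_bigr => j ji; rewrite mxE (negbTE ji).
have [_ da] := trig_exp a tT.
have entry i j : (T ^+ a.+1) i j = T i i ^+ a * T i j + (Y *m T) i j.
  rewrite exprSr [LHS]mxE (bigD1 i) //= da; congr (_ + _).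
  rewrite [RHS]mxE [RHS](bigD1 i) //= [Y i i]mxE eqxx mul0r add0r.
  by apply: eq_bigr => l li; rewrite mxE (negbTE li).
have le1 : off (T ^+ a.+1) <= \sum_i \sum_(j | j != i) (2 * k ^+ a * `|T i j| ^+ 2 + 2 * `|(Y *m T) i j| ^+ 2).
  apply: ler_sum => i _; apply: ler_sum => j ji; rewrite entry.
  apply: (le_trans (normD_sqr_le _ _)); rewrite lerD2r -mulrA ler_pM2l //.
  rewrite normrM exprMn ler_wpM2r ?exprn_ge0 // normrX exprAC.
  by rewrite lerXn2r ?nnegrE ?exprn_ge0.
apply: (le_trans le1); rewrite [leRHS]mulrDl.
under eq_bigr do rewrite big_split /=.
rewrite big_split /=; apply: lerD.
  by rewrite /off mulr_sumr; apply: ler_sum => i _; rewrite mulr_sumr.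
under eq_bigr do rewrite -mulr_sumr.
rewrite -mulr_sumr -!mulrA ler_pM2l // mulrA.
apply: (@le_trans _ _ (fro (Y *m T))).
  by rewrite fro_off lerDr; apply: sumr_ge0 => i _; rewrite exprn_ge0.
apply: (le_trans (hT Y)); rewrite froY -mulrA.
by apply: ler_wpM2l.
Qed.

(* Comparing [\tr ((M M^* )^2)] with [\tr (M ^+ 4)] controls the squares of the
   row masses off the diagonal of the Schur form. *)
Lemma off_trig_le n (T : 'M[C]_n) (d : C) : (0 < n)%N -> is_trig_mx T ->
  fro (T *m T^t*) - `|\tr (T ^+ 4)| <= d -> off T <= 2^-1 * (1 + n%:R * d).
Proof.
move=> n0 tT hd; pose r i := \sum_(j | j != i) `|T i j| ^+ 2.
have r0 i : 0 <= r i by apply: sumr_ge0 => j _; rewrite exprn_ge0.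
have [_ d4] := trig_exp 4 tT.
have rd : \sum_i r i ^+ 2 <= d.
  apply: le_trans hd; rewrite lerBrDr.
  (* By triangularity the trace of [T ^+ 4] is the sum of the [T i i ^+ 4], whereas the [i]-th
     diagonal entry of the Gram matrix is [|T i i|^2 + r i], whose square exceeds [|T i i|^4] by at
     least [r i ^+ 2]. *)
  apply: (@le_trans _ _ (\sum_i (r i ^+ 2 + `|T i i| ^+ 4))).
    rewrite big_split /= lerD2l; apply: (le_trans (ler_norm_sum _ _ _)).
    by apply: ler_sum => i _; rewrite d4 normrX.
  apply: ler_sum => i _; rewrite (bigD1 i) //=.
  have -> : (T *m T^t*) i i = `|T i i| ^+ 2 + r i.
    rewrite mxE (bigD1 i) //= !mxE -normCK; congr (_ + _).
    by apply: eq_bigr => j _; rewrite !mxE -normCK.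
  rewrite [`|_ + _|]ger0_norm ?addr_ge0 ?exprn_ge0 // -subr_ge0.
  set s := \sum_(_ | _) _.
  have -> : (`|T i i| ^+ 2 + r i) ^+ 2 + s - (r i ^+ 2 + `|T i i| ^+ 4)
    = 2 * (`|T i i| ^+ 2 * r i) + s by ring.
  rewrite addr_ge0 ?mulr_ge0 ?exprn_ge0 //.
  by apply: sumr_ge0 => j _; rewrite exprn_ge0.
have nn0 : n%:R != 0 :> C by rewrite pnatr_eq0 -lt0n.
have -> : 2^-1 * (1 + n%:R * d) = \sum_(i < n) 2^-1 * n%:R^-1 + 2^-1 * (n%:R * d).
  by rewrite sumr_const card_ord -mulr_natr; field.
(* Cauchy-Schwarz row by row: [r <= 1 / (2 n) + n r^2 / 2], since [(n r - 1)^2 >= 0]. *)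
apply: (@le_trans _ _ (\sum_(i < n) 2^-1 * n%:R^-1 + 2^-1 * (n%:R * \sum_i r i ^+ 2))).
  rewrite !mulr_sumr -big_split /=; apply: ler_sum => i _.
  rewrite -subr_ge0 -/(r i).
  have -> : 2^-1 / n%:R + 2^-1 * (n%:R * r i ^+ 2) - r i = (2 * n%:R)^-1 * (n%:R * r i - 1) ^+ 2.
    by field.
  apply: mulr_ge0; first by rewrite invr_ge0 mulr_ge0 ?ler0n.
  by rewrite real_exprn_even_ge0 // rpredB ?rpred1 // rpredM ?realn // ger0_real.
by rewrite lerD2l ler_pM2l ?invr_gt0 ?ltr0n // ler_wpM2l.
Qed.

Lemma adj_unitary_mul n (P : 'M[C]_n) : P \is unitarymx -> P^t* *m P = 1%:M.
Proof. by move=> uP; rewrite -invmx_unitary // mulVmx // unitarymx_unit. Qed.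

(** Traces and [fro] are invariant under the unitary Schur conjugation. In the trace for [T] the
    diagonal entries give the spectral sum exactly, and the off-diagonal ones are at most the mean
    of [off (T ^+ a)] and [off (T ^+ b)]. If [d] is [O(1/n)], the bound does not grow with [n]. *)
Lemma near_normal_moments n (M : 'M[C]_n) (k d : C) (s : seq C) :
  (0 < n)%N -> 0 <= k ->
  (forall Y : 'M[C]_n, fro (Y *m M) <= k * fro Y) ->
  fro (M *m M^t*) - `|\tr (M ^+ 4)| <= d ->
  char_poly M = \prod_(z <- s) ('X - z%:P) ->
  forall a b,
  `|\sum_(z <- s) z ^+ a * (z^* ) ^+ b - \tr (M ^+ a *m (M ^+ b)^t*)|
    <= 4^-1 * (off_const k a + off_const k b) * (1 + n%:R * d).
Proof.
move=> n0 k0 hM hd hs a b.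
have [P uP tT] := Schur M n0.
pose T := P *m M *m P^t*.
have {}tT : is_trig_mx T by move: tT; rewrite /similar_to conjumx ?unitarymx_unit // invmx_unitary.
have PP := adj_unitary_mul uP.
have expT c : T ^+ c = P *m M ^+ c *m P^t*.
  elim: c => [|c IH]; first by rewrite !expr0 mulmx1 (unitarymxP uP).
  rewrite !exprSr IH -[LHS]/(_ *m _) /T !mulmxA -(mulmxA (P *m _)) PP mulmx1.
  by rewrite -(mulmxA P).
have trT X : \tr (P *m X *m P^t*) = \tr X by rewrite mxtrace_mulC mulmxA PP mul1mx.
have adjT X : (P *m X *m P^t*)^t* = P *m X^t* *m P^t*.
  by rewrite !trmx_mul !map_mxM trmxCK mulmxA.
have mulT X Y : (P *m X *m P^t*) *m (P *m Y *m P^t*) = P *m (X *m Y) *m P^t*.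
  by rewrite !mulmxA -(mulmxA _ (P^t*) P) PP mulmx1.
have hT (Y : 'M[C]_n) : fro (Y *m T) <= k * fro Y.
  rewrite /T !mulmxA fro_unitaryr ?adj_unitary //.
  by rewrite -(fro_unitaryr Y uP).
have offT : off T <= 2^-1 * (1 + n%:R * d).
  apply: off_trig_le => //; apply: le_trans hd.
  by rewrite expT trT adjT mulT fro_unitaryr ?adj_unitary // fro_unitaryl.
(* Unique factorization of the characteristic polynomial: [s] lists the diagonal of [T] up to
   order. *)
have psT : perm_eq s [seq T i i | i : 'I_n].
  have : \prod_(z <- s) ('X - z%:P) = \prod_(z <- [seq T i i | i : 'I_n]) ('X - z%:P).
    rewrite -hs big_image /= -char_poly_trig //.
    have PP1 : map_mx polyC P *m map_mx polyC (P^t*) = 1%:M :> 'M[{poly C}]_n.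
      by rewrite -map_mxM (unitarymxP uP) map_mx1.
    apply/esym; rewrite /char_poly /char_poly_mx /T !map_mxM /=.
    have -> : 'X%:M - map_mx polyC P *m map_mx polyC M *m map_mx polyC (P^t*)
       = map_mx polyC P *m ('X%:M - map_mx polyC M) *m map_mx polyC (P^t*).
      rewrite mulmxBr mulmxBl; congr (_ - _).
      by rewrite scalar_mxC -mulmxA PP1 mulmx1.
    by rewrite !det_mulmx mulrAC -det_mulmx PP1 det1 mul1r.
  by move=> e; apply: prod_XsubC_eq.
clearbody T; rewrite (perm_big _ psT) /= big_image /=.
have [_ da] := trig_exp a tT; have [_ db] := trig_exp b tT.
have -> : \tr (M ^+ a *m (M ^+ b)^t*) = \tr (T ^+ a *m (T ^+ b)^t*).
  by rewrite !expT adjT mulT trT.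
have -> : \tr (T ^+ a *m (T ^+ b)^t*) =
  \sum_i T i i ^+ a * (T i i)^* ^+ b + \sum_i \sum_(j | j != i) (T ^+ a) i j * ((T ^+ b) i j)^*.
  rewrite -big_split; apply: eq_bigr => i _; rewrite mxE (bigD1 i) //=.
  rewrite !mxE da db rmorphXn; congr (_ + _).
  by apply: eq_bigr => j _; rewrite !mxE.
rewrite opprD addNKr normrN.
apply: (@le_trans _ _ (2^-1 * (off (T ^+ a) + off (T ^+ b)))).
  apply: (le_trans (ler_norm_sum _ _ _)); rewrite /off -big_split mulr_sumr.
  apply: ler_sum => i _; apply: (le_trans (ler_norm_sum _ _ _)).
  rewrite -big_split mulr_sumr; apply: ler_sum => j _.
  by apply: (le_trans (normM_le_half _ _)); rewrite norm_conjC.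
have h c : off (T ^+ c) <= off_const k c * (2^-1 * (1 + n%:R * d)).
  apply: (le_trans (off_exp_le c tT k0 hT)).
  by rewrite ler_wpM2l // off_const_ge0.
have -> : 4^-1 * (off_const k a + off_const k b) * (1 + n%:R * d)
  = 2^-1 * (off_const k a * (2^-1 * (1 + n%:R * d)) + off_const k b * (2^-1 * (1 + n%:R * d))).
  by field.
by rewrite ler_pM2l ?invr_gt0 // lerD.
Qed.

End NearNormal.

(** * Cyclic tridiagonal matrices *)

Section CyclicTridiagonal.
Local Open Scope sesquilinear_scope.
Variables (C : numClosedFieldType) (n : nat).
Implicit Types (al be s u : 'I_n -> C) (X Y : 'M[C]_n) (i j : 'I_n).

(** Edge [j] joins [j] and [ordS j]: [al j] sits in position [(ordS j, j)] and [be j] in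
    [(j, ordS j)]. For [n <= 2] the two may fall on one entry, where they add up. *)
Definition cyc al be : 'M[C]_n :=
  \matrix_(i, j) (al j *+ (i == ordS j) + be i *+ (j == ordS i)).

Lemma ordS_eqr i j : (i == ordS j) = (j == ord_pred i).
Proof. by apply/eqP/eqP => ->; rewrite ?ordSK ?ord_predK. Qed.

Lemma sum_ordS (F : 'I_n -> C) : \sum_i F (ordS i) = \sum_i F i.
Proof.
rewrite [RHS](reindex (@ordS n)) //.
by exists (@ord_pred n) => i _; rewrite ?ordSK ?ord_predK.
Qed.

Lemma sum_ord_pred (F : 'I_n -> C) : \sum_i F (ord_pred i) = \sum_i F i.
Proof. by rewrite -[LHS]sum_ordS; apply: eq_bigr => i _; rewrite ordSK. Qed.

Lemma sum_pick (F : 'I_n -> C) i : \sum_j F j *+ (j == i) = F i.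
Proof. by rewrite (bigD1 i) //= eqxx big1 ?addr0 // => j /negbTE ->. Qed.

Lemma cyc_mull al be X i j : (cyc al be *m X) i j =
  al (ord_pred i) * X (ord_pred i) j + be i * X (ordS i) j.
Proof.
rewrite mxE -(sum_pick (fun l => al l * X l j)) -(sum_pick (fun l => be i * X l j)).
rewrite -big_split; apply: eq_bigr => l _; rewrite !mxE ordS_eqr mulrDl.
by rewrite !mulrnAl.
Qed.

Lemma cyc_mulr al be X i j : (X *m cyc al be) i j =
  X i (ordS j) * al j + X i (ord_pred j) * be (ord_pred j).
Proof.
rewrite mxE -(sum_pick (fun l => X i l * al j)) -(sum_pick (fun l => X i l * be l)).
rewrite -big_split; apply: eq_bigr => l _; rewrite !mxE mulrDr (ordS_eqr j).
by rewrite !mulrnAr.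
Qed.

Lemma cyc_adj al be : (cyc al be)^t* = cyc (fun i => (be i)^*) (fun i => (al i)^*).
Proof.
by apply/matrixP => i j; rewrite !mxE rmorphD /= !rmorphMn addrC.
Qed.

Lemma fro_mul_cyc al be (m : C) X : (forall i, `|al i| ^+ 2 <= m) ->
  (forall i, `|be i| ^+ 2 <= m) -> fro (X *m cyc al be) <= 4 * m * fro X.
Proof.
move=> hal hbe.
apply: (@le_trans _ _ (\sum_i \sum_j (2 * m * `|X i (ordS j)| ^+ 2 + 2 * m * `|X i (ord_pred j)| ^+ 2))).
  apply: ler_sum => i _; apply: ler_sum => j _; rewrite cyc_mulr.
  apply: (le_trans (normD_sqr_le _ _)); rewrite !normrM !exprMn -!(mulrA 2).
  by apply: lerD; rewrite ler_pM2l // mulrC ler_wpM2r // exprn_ge0.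
rewrite /fro mulr_sumr; apply: ler_sum => i _.
rewrite big_split /= -!mulr_sumr (sum_ordS (fun j => `|X i j| ^+ 2)).
rewrite (sum_ord_pred (fun j => `|X i j| ^+ 2)) -mulrDl.
by have -> : 2 * m + 2 * m = 4 * m by ring.
Qed.

(** This norm dominates differences of traces and at most doubles when multiplied by a hopping
    matrix with amplitudes of modulus at most 1. Unlike an operator norm, it makes a large change on
    boundedly many edges harmless after division by [n]. *)
Definition l1 X : C := \sum_i \sum_j `|X i j|.

Lemma l1D X Y : l1 (X + Y) <= l1 X + l1 Y.
Proof.
rewrite /l1 -big_split; apply: ler_sum => i _; rewrite -big_split.
by apply: ler_sum => j _; rewrite mxE ler_normD.
Qed.

Lemma l1_cycl al be X : (forall i, `|al i| <= 1) -> (forall i, `|be i| <= 1) ->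
  l1 (cyc al be *m X) <= 2 * l1 X.
Proof.
move=> hal hbe; rewrite mulr_natl mulr2n.
rewrite -{1}[l1 X](sum_ord_pred (fun i => \sum_j `|X i j|)).
rewrite -[l1 X](sum_ordS (fun i => \sum_j `|X i j|)) -big_split.
apply: ler_sum => i _; rewrite -big_split; apply: ler_sum => j _.
rewrite cyc_mull; apply: (le_trans (ler_normD _ _)).
by rewrite !normrM lerD // ler_piMl.
Qed.

Lemma l1_cycr al be X : (forall i, `|al i| <= 1) -> (forall i, `|be i| <= 1) ->
  l1 (X *m cyc al be) <= 2 * l1 X.
Proof.
move=> hal hbe; rewrite mulr_natl mulr2n /l1 -big_split; apply: ler_sum => i _.
rewrite -{1}[\sum_j `|X i j|](sum_ordS (fun j => `|X i j|)).
rewrite -[\sum_j `|X i j|](sum_ord_pred (fun j => `|X i j|)).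
rewrite -big_split; apply: ler_sum => j _.
rewrite cyc_mulr; apply: (le_trans (ler_normD _ _)).
by rewrite !normrM lerD // ler_piMr.
Qed.

Lemma mxtrace_l1 X Y : `|\tr X - \tr Y| <= l1 (X - Y).
Proof.
rewrite -raddfB /=; apply: (le_trans (ler_norm_sum _ _ _)).
by apply: ler_sum => i _; rewrite (bigD1 i) //= lerDl sumr_ge0.
Qed.

Notation Z := (cyc (fun=> 1) (fun=> 1)).

Lemma pascal_sum k (G : nat -> C) :
  \sum_(l < k.+2) 'C(k.+1, l)%:R * G l =
  \sum_(l < k.+1) 'C(k, l)%:R * G l.+1 + \sum_(l < k.+1) 'C(k, l)%:R * G l.
Proof.
rewrite big_ord_recl /= bin0.
have -> : \sum_(l < k.+1) 'C(k, l)%:R * G l = \sum_(l < k.+2) 'C(k, l)%:R * G l.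
  by rewrite [RHS]big_ord_recr /= bin_small // mul0r addr0.
rewrite [X in _ = _ + X]big_ord_recl /= bin0 addrCA; congr (_ + _).
rewrite -big_split; apply: eq_bigr => l _ /=.
by rewrite /bump /= add1n binS natrD mulrDl addrC.
Qed.

(** A walk of length [k] is a choice of the [l] steps taken in one direction, and its endpoints
    satisfy [j + l = i + (k - l)] modulo [n]; shifting both endpoints avoids subtraction modulo [n].
    Conditioning on the first step is Pascal's rule. *)
Lemma hop_exp k i j : (Z ^+ k) i j =
  \sum_(l < k.+1) 'C(k, l)%:R *
     (iter l (@ordS n) j == iter (k - l) (@ordS n) i)%:R.
Proof.
elim: k i => [|k IH] i.
  by rewrite big_ord1 expr0 mxE /= mul1r eq_sym.
rewrite exprS [LHS]cyc_mull !mul1r !IH.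
rewrite (pascal_sum k (fun l => (iter l (@ordS n) j == iter (k.+1 - l) (@ordS n) i)%:R)).
congr (_ + _); apply: eq_bigr => l _; congr (_ * (nat_of_bool _)%:R).
  rewrite subSS -(inj_eq (can_inj (@ordSK n))) -!iterS [iter (k - l).+1 _ _]iterSr.
  by rewrite ord_predK.
by rewrite (@subSn l k (ltn_ord l)) iterSr.
Qed.

Lemma val_iter_ordS k i : iter k (@ordS n) i = ((i + k) %% n)%N :> nat.
Proof.
elim: k => [|k IH] /=; first by rewrite addn0 modn_small.
by rewrite IH addnS -addn1 modnDml addn1.
Qed.

Definition hop_count k : nat := if odd k then 0 else 'C(k, k./2).

(** A walk shorter than [n] cannot wind around the cycle, so it closes up only with as many steps in
    one direction as in the other. *)
Lemma hop_diag k i : (k < n)%N -> (Z ^+ k) i i = (hop_count k)%:R.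
Proof.
move=> kn; rewrite hop_exp.
have eqk l : (l < k.+1)%N ->
    (iter l (@ordS n) i == iter (k - l) (@ordS n) i) = (l.*2 == k).
  move=> lk; rewrite -val_eqE /= !val_iter_ordS eqn_modDl.
  rewrite !modn_small; [|by lia..]; lia.
rewrite /hop_count; case: ifPn => ok.
  rewrite big1 // => l _; rewrite eqk // (_ : _ == _ = false) ?mulr0 //.
  by apply/negbTE; apply: contraTneq ok => <-; rewrite odd_double.
have hk : (k./2 < k.+1)%N by lia.
rewrite (bigD1 (Ordinal hk)) //= eqk // big1 => [|l lk].
  by rewrite addr0 halfK (negbTE ok) subn0 eqxx mulr1.
rewrite eqk // (_ : _ == _ = false) ?mulr0 //; apply/negbTE.
apply: contraNneq lk => e; apply/eqP/val_inj => /=; lia.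
Qed.

(** The new factor doubles the old error. Moving it past [u] costs [3 V] (two amplitudes and the
    variation of [s]) plus [k V] twice (the variation of [u] on either side), and the free power
    behind it multiplies this by at most [2 ^+ k]. *)
Fixpoint hop_err k : C :=
  if k is k'.+1 then 2 * hop_err k' + 2 ^+ k' * (3 + 2 * k'%:R) else 0.

(* [X] agrees, up to an entrywise summable error, with [u] times the [k]-th
   power of the free hopping matrix. *)
Definition locally_free (V : C) k X u := [/\
  forall i, `|u i| <= 1,
  \sum_i `|u (ordS i) - u i| <= k%:R * V &
  l1 (X - diag_mx (\row_i u i) *m Z ^+ k) <= hop_err k * V].

Lemma locally_free1 (V : C) : 0 <= V -> locally_free V 0 1%:M (fun=> 1).
Proof.
move=> V0; split.
- by move=> i; rewrite normr1.
- by rewrite mul0r big1 // => i _; rewrite subrr normr0.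
- rewrite mul0r /l1 big1 // => i _; rewrite big1 // => j _.
  by rewrite expr0 mulmx1 !mxE subrr normr0.
Qed.

(** With [D] and [D'] the diagonal matrices of [u] and of [s * u], the new error is
    [cyc (X - D Z^k) + (cyc D - D' Z) Z^k]. The second bracket is nearly a commutator: its entries
    are small because amplitudes, [s] and [u] change little from one site to the next, in total at
    most by a multiple of [V]. *)
Lemma locally_free_cyc (V : C) al be s k X u :
  (forall i, `|al i| <= 1) -> (forall i, `|be i| <= 1) ->
  (forall i, `|s i| <= 1) ->
  \sum_i `|al i - s i| <= V -> \sum_i `|be i - s i| <= V ->
  \sum_i `|s (ordS i) - s i| <= V ->
  locally_free V k X u ->
  locally_free V k.+1 (cyc al be *m X) (fun i => s i * u i).
Proof.
move=> al1 be1 s1 alV beV sV [u1 uV XV].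
have prodB (x y x' y' : C) : `|y| <= 1 -> `|x'| <= 1 ->
    `|x * y - x' * y'| <= `|x - x'| + `|y - y'|.
  move=> y1 x1.
  have -> : x * y - x' * y' = (x - x') * y + x' * (y - y') by ring.
  apply: (le_trans (ler_normD _ _)); rewrite !normrM.
  by rewrite lerD ?ler_piMl ?ler_piMr.
split.
- by move=> i; rewrite normrM mulr_ile1.
- apply: (@le_trans _ _ (\sum_i (`|s (ordS i) - s i| + `|u (ordS i) - u i|))).
    by apply: ler_sum => i _; exact: prodB.
  by rewrite big_split /= -natr1 mulrDl mul1r addrC lerD.
- have -> : cyc al be *m X - diag_mx (\row_i (s i * u i)) *m Z ^+ k.+1 =
    cyc al be *m (X - diag_mx (\row_i u i) *m Z ^+ k) +
    (cyc al be *m diag_mx (\row_i u i) - diag_mx (\row_i (s i * u i)) *m Z) *m Z ^+ k.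
    by rewrite exprS -[_ * _]/(_ *m _) mulmxBr mulmxBl !mulmxA addrA subrK.
  apply: (le_trans (l1D _ _)); rewrite /= [leRHS]mulrDl; apply: lerD.
    by apply: (le_trans (l1_cycl _ al1 be1)); rewrite -mulrA ler_pM2l.
  set D := (X in l1 (X *m _)).
  have l1Z m (Y : 'M[C]_n) : l1 (Y *m Z ^+ m) <= 2 ^+ m * l1 Y.
    elim: m => [|m IH]; first by rewrite !expr0 mulmx1 mul1r.
    rewrite exprSr -[_ * _]/(_ *m _) mulmxA.
    apply: (le_trans (l1_cycr _ _ _)); try by move=> i; rewrite normr1.
    by rewrite exprS -mulrA ler_pM2l.
  apply: (le_trans (l1Z _ _)); rewrite -mulrA ler_pM2l ?exprn_gt0 //.
  have entry i j : D i j =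
      (al (ord_pred i) * u (ord_pred i) - s i * u i) *+ (j == ord_pred i) +
      (be i * u (ordS i) - s i * u i) *+ (j == ordS i).
    rewrite /D mxE [X in _ + X]mxE mul_mx_diag mul_diag_mx !mxE ordS_eqr !mulrnBl.
    have pick_eq (F : 'I_n -> C) l : F j *+ (j == l) = F l *+ (j == l).
      by case: eqP => [->|].
    rewrite mulrDl !mulrnAl (pick_eq (fun l => al l * u l)).
    rewrite (pick_eq (fun l => be i * u l)) mulrDr !mulrnAr !mulr1.
    by rewrite opprD addrACA.
  apply: (@le_trans _ _ (\sum_i (`|al (ord_pred i) * u (ord_pred i) - s i * u i| +
      `|be i * u (ordS i) - s i * u i|))).
    apply: ler_sum => i _.
    rewrite -[X in _ <= X + _](sum_pick (fun=> `|al (ord_pred i) * u (ord_pred i) - s i * u i|) (ord_pred i)).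
    rewrite -[X in _ <= _ + X](sum_pick (fun=> `|be i * u (ordS i) - s i * u i|) (ordS i)).
    rewrite -big_split; apply: ler_sum => j _; rewrite entry.
    by apply: (le_trans (ler_normD _ _)); rewrite !normrMn.
  apply: (@le_trans _ _ (\sum_i ((`|al (ord_pred i) - s (ord_pred i)| +
     `|s (ord_pred i) - s i| + `|u (ord_pred i) - u i|) +
     (`|be i - s i| + `|u (ordS i) - u i|)))).
    apply: ler_sum => i _; apply: lerD; last exact: prodB.
    apply: (le_trans (prodB _ _ _ _ _ _)) => //; rewrite lerD2r.
    exact: ler_distD.
  rewrite !big_split /= (sum_ord_pred (fun i => `|al i - s i|)).
  have pred_var (f : 'I_n -> C) :
      \sum_i `|f (ord_pred i) - f i| = \sum_i `|f (ordS i) - f i|.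
    by rewrite -[LHS]sum_ordS; apply: eq_bigr => i _; rewrite ordSK distrC.
  rewrite !pred_var.
  have -> : (3 + 2 * k%:R) * V = V + V + k%:R * V + (V + k%:R * V) by ring.
  by rewrite !lerD.
Qed.

Lemma eq_locally_free (V : C) k X u v : u =1 v ->
  locally_free V k X u -> locally_free V k X v.
Proof.
move=> uv [h1 h2 h3]; split.
- by move=> i; rewrite -uv.
- by under eq_bigr do rewrite -!uv.
- by rewrite (_ : \row_i v i = \row_i u i) //; apply/rowP => i; rewrite !mxE uv.
Qed.

Lemma locally_free_trace (V : C) k X u : (k < n)%N -> locally_free V k X u ->
  `|\tr X - (hop_count k)%:R * \sum_i u i| <= hop_err k * V.
Proof.
move=> kn [_ _]; apply: le_trans.
have -> : (hop_count k)%:R * \sum_i u i = \tr (diag_mx (\row_i u i) *m Z ^+ k).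
  rewrite mulr_sumr; apply: eq_bigr => i _.
  by rewrite mul_diag_mx !mxE hop_diag // mulrC.
exact: mxtrace_l1.
Qed.

(** The adjoint is again cyclic tridiagonal, with amplitudes close to the conjugate of [s]. So
    [locally_free_cyc] is iterated [b] times with this conjugate, then [a] times with [s];
    [a + b < n] excludes winding walks. *)
Lemma cyc_moment (V : C) al be s a b : (a + b < n)%N ->
  (forall i, `|al i| <= 1) -> (forall i, `|be i| <= 1) ->
  (forall i, `|s i| <= 1) -> 0 <= V ->
  \sum_i `|al i - s i| <= V -> \sum_i `|be i - s i| <= V ->
  \sum_i `|s (ordS i) - s i| <= V ->
  `|\tr (cyc al be ^+ a *m (cyc al be ^+ b)^t*) -
     (hop_count (a + b))%:R * \sum_i s i ^+ a * (s i)^* ^+ b|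
    <= hop_err (a + b) * V.
Proof.
move=> abn al1 be1 s1 V0 alV beV sV.
have conjB (x y : C) : `|x^* - y^*| = `|x - y| by rewrite -rmorphB norm_conjC.
apply: locally_free_trace => //.
have powb : locally_free V b ((cyc al be ^+ b)^t*) (fun i => (s i)^* ^+ b).
  elim: b {abn} => [|b IH].
    rewrite expr0 (_ : _^t* = 1%:M) ?tr_scalar_mx ?map_scalar_mx ?rmorph1 //.
    exact: locally_free1.
  have -> : (cyc al be ^+ b.+1)^t* =
      cyc (fun i => (be i)^*) (fun i => (al i)^*) *m (cyc al be ^+ b)^t*.
    by rewrite exprSr trmx_mul map_mxM cyc_adj.
  have [] := @locally_free_cyc V (fun i => (be i)^*) (fun i => (al i)^*) (fun i => (s i)^*) b _ _ _ _ _ _ _ _ IH.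
  all: try by move=> i; rewrite norm_conjC.
  all: try by under eq_bigr do rewrite conjB.
  move=> h1 h2 h3; apply: eq_locally_free (And3 h1 h2 h3) => i.
  by rewrite exprS.
elim: a {abn} => [|a IH].
  by rewrite expr0 mul1mx add0n; apply: eq_locally_free powb => i; rewrite mul1r.
rewrite exprS -[_ * _ ^+ a]/(_ *m _) -mulmxA.
apply: eq_locally_free (locally_free_cyc al1 be1 s1 alV beV sV IH) => i.
by rewrite exprS mulrA.
Qed.

Lemma cyc_sq al be i j : (cyc al be ^+ 2) i j =
  (al (ord_pred i) * al (ord_pred (ord_pred i))) *+ (j == ord_pred (ord_pred i)) +
  (al (ord_pred i) * be (ord_pred i) + al i * be i) *+ (j == i) +
  (be i * be (ordS i)) *+ (j == ordS (ordS i)).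
Proof.
rewrite expr2 [LHS]cyc_mull !mxE !(ordS_eqr _ j).
have pick_eq (F : 'I_n -> C) l : F j *+ (j == l) = F l *+ (j == l).
  by case: eqP => [->|].
rewrite !(pick_eq al) ord_predK ordSK !mulrDr !mulrnAr -!addrA; congr (_ + _).
by rewrite mulrnDl (mulrC (be i) (al i)) addrA.
Qed.

Lemma iter_ordS_neq i k : (0 < k < n)%N ->
  (iter k (@ordS n) i == i) = false.
Proof.
move=> kn; rewrite -val_eqE /= val_iter_ordS -{2}(modn_small (ltn_ord i)).
by rewrite -{2}(addn0 i) eqn_modDl mod0n modn_small; lia.
Qed.

(** The trace of the square of [cyc_sq]. The condition [4 < n] keeps [i] apart from the sites at
    distance 2 and 4, so no walk of length 4 winds around the cycle. *)
Lemma cyc_trace4 al be : (4 < n)%N -> \tr (cyc al be ^+ 4) =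
  \sum_i ((al (ord_pred i) * be (ord_pred i) + al i * be i) ^+ 2 +
   2 * ((al i * be i) * (al (ordS i) * be (ordS i)))).
Proof.
move=> n4; rewrite (exprM _ 2 2) (expr2 (_ ^+ 2)).
transitivity (\sum_i ((al (ord_pred i) * be (ord_pred i) + al i * be i) ^+ 2 +
  ((al (ord_pred (ord_pred i)) * be (ord_pred (ord_pred i))) * (al (ord_pred i) * be (ord_pred i))
  + (al i * be i) * (al (ordS i) * be (ordS i))))); last first.
  rewrite !big_split /=; congr (_ + _).
  pose f i := (al i * be i) * (al (ordS i) * be (ordS i)).
  rewrite -mulr_sumr mulr_natl mulr2n -/(\sum_i f i); congr (_ + _).
  rewrite -(sum_ord_pred f) -(sum_ord_pred (fun i => f (ord_pred i))).
  by apply: eq_bigr => i _; rewrite /f ord_predK.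
apply: eq_bigr => i _; rewrite mxE.
set F := fun j => (cyc al be ^+ 2) j i.
transitivity (al (ord_pred i) * al (ord_pred (ord_pred i)) * F (ord_pred (ord_pred i))
  + (al (ord_pred i) * be (ord_pred i) + al i * be i) * F i
  + be i * be (ordS i) * F (ordS (ordS i))).
  rewrite -(sum_pick (fun l => al (ord_pred i) * al (ord_pred (ord_pred i)) * F l)).
  rewrite -(sum_pick (fun l => (al (ord_pred i) * be (ord_pred i) + al i * be i) * F l)).
  rewrite -(sum_pick (fun l => be i * be (ordS i) * F l)).
  rewrite -!big_split; apply: eq_bigr => j _; rewrite cyc_sq.
  by rewrite !mulrDl !mulrnAl !mulrDl.
rewrite /F !cyc_sq !eqxx !ord_predK !eqxx !ordSK !eqxx.
have S2 := @iter_ordS_neq _ 2; have S4 := @iter_ordS_neq _ 4.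
have e1 : (i == ord_pred (ord_pred i)) = false.
  rewrite -(inj_eq (can_inj (@ordSK n))) ord_predK -(inj_eq (can_inj (@ordSK n))) ord_predK.
  by apply: S2; lia.
have e2 : (i == ordS (ordS i)) = false by rewrite eq_sym; apply: S2; lia.
have e3 : (i == ord_pred (ord_pred (ord_pred (ord_pred i)))) = false.
  do 4! rewrite -(inj_eq (can_inj (@ordSK n))) ord_predK.
  by apply: S4; lia.
have e4 : (i == ordS (ordS (ordS (ordS i)))) = false by rewrite eq_sym; apply: S4; lia.
rewrite e1 e2 e3 e4 /= !mulr0n !mulr1n !add0r !addr0.
ring.
Qed.

Lemma cyc_gram al be i j : (cyc al be *m (cyc al be)^t*) i j =
  (al (ord_pred i) * (be (ord_pred (ord_pred i)))^*) *+ (j == ord_pred (ord_pred i)) +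
  (`|al (ord_pred i)| ^+ 2 + `|be i| ^+ 2) *+ (j == i) +
  (be i * (al (ordS i))^*) *+ (j == ordS (ordS i)).
Proof.
rewrite cyc_adj cyc_mull !mxE !(ordS_eqr _ j) !normCK /=.
have pick_eq (f : 'I_n -> C) l : (f j)^* *+ (j == l) = (f l)^* *+ (j == l).
  by case: eqP => [->|].
rewrite !(pick_eq be) ord_predK ordSK.
rewrite !mulrDr !mulrnAr -!addrA; congr (_ + _).
by rewrite mulrnDl addrA.
Qed.

Lemma cyc_fro_gram al be : (4 < n)%N -> fro (cyc al be *m (cyc al be)^t*) =
  \sum_i ((`|al (ord_pred i)| ^+ 2 + `|be i| ^+ 2) ^+ 2 +
   2 * (`|be i| ^+ 2 * `|al (ordS i)| ^+ 2)).
Proof.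
move=> n4.
transitivity (\sum_i ((`|al (ord_pred i)| ^+ 2 + `|be i| ^+ 2) ^+ 2 +
  ((`|be (ord_pred (ord_pred i))| ^+ 2 * `|al (ord_pred i)| ^+ 2)
  + (`|be i| ^+ 2 * `|al (ordS i)| ^+ 2)))); last first.
  rewrite !big_split /=; congr (_ + _).
  pose f i := `|be i| ^+ 2 * `|al (ordS i)| ^+ 2.
  rewrite -mulr_sumr mulr_natl mulr2n -/(\sum_i f i); congr (_ + _).
  rewrite -(sum_ord_pred f) -(sum_ord_pred (fun i => f (ord_pred i))).
  by apply: eq_bigr => i _; rewrite /f ord_predK.
apply: eq_bigr => i _.
have S2 := @iter_ordS_neq _ 2; have S4 := @iter_ordS_neq _ 4.
have e1 : (i == ord_pred (ord_pred i)) = false.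
  rewrite -(inj_eq (can_inj (@ordSK n))) ord_predK -(inj_eq (can_inj (@ordSK n))) ord_predK.
  by apply: S2; lia.
have e2 : (i == ordS (ordS i)) = false by rewrite eq_sym; apply: S2; lia.
have e3 : (ordS (ordS i) == ord_pred (ord_pred i)) = false.
  do 2! rewrite -(inj_eq (can_inj (@ordSK n))) ord_predK.
  by apply: S4; lia.
rewrite (bigD1 i) //= (bigD1 (ord_pred (ord_pred i))) ?(eq_sym _ i) ?e1 //=.
rewrite (bigD1 (ordS (ordS i))) ?(eq_sym _ i) ?e2 ?e3 //= big1 => [|j].
  rewrite !cyc_gram !eqxx e1 e2 e3 (eq_sym _ i) e1 (eq_sym _ (ordS _)) e3 (eq_sym _ i) e2.
  rewrite !mulr0n !mulr1n !add0r !addr0 !normrM !norm_conjC !exprMn.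
  rewrite [`|_ + _|]ger0_norm ?addr_ge0 ?exprn_ge0 //.
  by rewrite (mulrC (`|al _| ^+ 2)).
move=> /andP[/andP[j1 j2] j3].
by rewrite cyc_gram (negbTE j1) (negbTE j2) (negbTE j3) !mulr0n !addr0 normr0 expr0n.
Qed.

End CyclicTridiagonal.

(** * Moments of the limiting density *)

Section OpenSubstitution.
Variable R : realType.
Notation mu := (@lebesgue_measure R).
Variables (a b : R) (F dF G : R -> R).
Hypothesis ab : a < b.
Hypothesis cF : {within `[a, b], continuous F}.
Hypothesis derF : {in `]a, b[, forall x : R, is_derive x (1 : R) F (dF x)}.
Hypothesis dF0 : {in `]a, b[, forall x, 0 < dF x}.
Hypothesis cdF : {in `]a, b[, continuous dF}.
Hypothesis cG : {in `]F a, F b[, continuous G}.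
Hypothesis G0 : {in `]F a, F b[, forall x, 0 <= G x}.

Let F' x : x \in `]a, b[ -> (derive1 F) x = dF x.
Proof. by move=> xab; rewrite derive1E; have := derF xab => h; rewrite derive_val. Qed.

Let dvF x : x \in `]a, b[ -> derivable F x 1.
Proof. by move=> xab; have := derF xab => h; exact: ex_derive. Qed.

Let incF : {in `[a, b] &, {homo F : x y / x < y}}.
Proof.
have h1 x : x \in `]a, b[ -> 0 < derive1 F x by move=> xab; rewrite F' // dF0.
exact: gtr0_derive1_lt_cc dvF h1 cF.
Qed.

Let Foo x : x \in `]a, b[ -> F x \in `]F a, F b[.
Proof.
rewrite !in_itv /= => /andP[ax xb].
by rewrite !incF ?in_itv /= ?lexx ?(ltW ax) ?(ltW xb) ?(ltW ab).
Qed.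

(** The offset 3 makes [eps n] at most a third of the length, so the inner interval is nondegenerate
    for every [n]. *)
Let eps (n : nat) := (b - a) / (n.+3)%:R.

Let eps0 n : 0 < eps n.
Proof. by rewrite /eps divr_gt0 // subr_gt0. Qed.

Let epsS m n : (m <= n)%N -> eps n <= eps m.
Proof.
by move=> mn; rewrite /eps ler_pM2l ?subr_gt0 // lef_pV2 ?posrE // ler_nat !ltnS.
Qed.

Let eps_half n : a + eps n < b - eps n.
Proof.
have : eps n <= (b - a) / 3.
  by rewrite /eps ler_pM2l ?subr_gt0 // lef_pV2 ?posrE // ler_nat.
have : 0 < b - a by rewrite subr_gt0.
lra.
Qed.

Let A n := a + eps n.
Let B n := b - eps n.

Let inAB n x : x \in `[A n, B n] -> x \in `]a, b[.
Proof. by rewrite !in_itv /= /A /B; have := eps0 n; lra. Qed.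

Let in_ab x : x \in `]a, b[ -> x \in `[a, b].
Proof. by rewrite !in_itv /=; lra. Qed.

Let exAB x : x \in `]a, b[ -> exists n, x \in `[A n, B n].
Proof.
rewrite in_itv /= => /andP[ax xb].
pose m := Num.min (x - a) (b - x).
have m0 : 0 < m by rewrite lt_min !subr_gt0 ax.
pose n := Num.truncn ((b - a) / m).
exists n; have en : eps n <= m.
  rewrite /eps ler_pdivrMr // mulrC -ler_pdivrMr //.
  have := truncnS_gt ((b - a) / m).
  rewrite -/n => /ltW h; apply: (le_trans h).
  by rewrite ler_nat; lia.
have : m <= x - a by rewrite ge_min lexx.
have : m <= b - x by rewrite ge_min lexx orbT.
by rewrite in_itv /= /A /B; lra.
Qed.

Let cup1 : \bigcup_n `[A n, B n]%classic = `]a, b[%classic.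
Proof.
apply/seteqP; split => x /=.
  by move=> [n _] /= h; exact: (inAB h).
by move=> /exAB[n h]; exists n.
Qed.

Let Ain n : A n \in `]a, b[.
Proof. by apply: (@inAB n); rewrite in_itv /= lexx /= ltW ?eps_half. Qed.

Let Bin n : B n \in `]a, b[.
Proof. by apply: (@inAB n); rewrite in_itv /= lexx andbT ltW ?eps_half. Qed.

Let mono x y : x \in `[a, b] -> y \in `[a, b] -> x <= y -> F x <= F y.
Proof.
move=> xab yab; rewrite le_eqVlt => /predU1P[->//|xy].
by apply: ltW; exact: incF.
Qed.

Let inFAB n y : y \in `[F (A n), F (B n)] -> y \in `]F a, F b[.
Proof.
have := Foo (Ain n); have := Foo (Bin n); rewrite !in_itv /= => /andP[_ h1] /andP[h2 _] /andP[h3 h4].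
by rewrite (lt_le_trans h2 h3) (le_lt_trans h4 h1).
Qed.

Let cup2 : \bigcup_n `[F (A n), F (B n)]%classic = `]F a, F b[%classic.
Proof.
apply/seteqP; split => y /=.
  by move=> [n _] /= h; exact: (inFAB h).
rewrite in_itv /= => /andP[ay yb].
have Fab : F a < F b by exact: lt_trans yb.
have [|x xab Fx] := @IVT R F a b y (ltW ab) cF.
  by rewrite (min_idPl (ltW Fab)) (max_idPr (ltW Fab)) (ltW ay) (ltW yb).
have xoo : x \in `]a, b[.
  move: xab; rewrite !in_itv /= !le_eqVlt => /andP[/orP[/eqP e|->] /orP[/eqP e'|->]] //.
  - by move: ay; rewrite -Fx e ltxx.
  - by move: ay; rewrite -Fx e ltxx.
  - by move: yb; rewrite -Fx e' ltxx.
have [n] := exAB xoo; rewrite in_itv /= => /andP[h1 h2].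
exists n => //=; rewrite in_itv /= -Fx !mono //; exact: in_ab.
Qed.

Let seqA m n : (m <= n)%N -> A n <= A m /\ B m <= B n.
Proof. by move=> mn; have := epsS mn; rewrite /A /B; lra. Qed.

Let mG : measurable_fun `]F a, F b[ G.
Proof.
apply: open_continuous_measurable_fun; first exact: interval_open.
by move=> x; rewrite inE /=; exact: cG.
Qed.

Let cGFdF : {in `]a, b[, continuous (fun x => G (F x) * dF x)}.
Proof.
move=> x xab; apply: continuousM; last exact: cdF.
apply: continuous_comp; last by apply: cG; exact: Foo.
by apply/differentiable_continuous/derivable1_diffP/dvF.
Qed.

Let mGFdF : measurable_fun `]a, b[ (fun x => G (F x) * dF x).
Proof.
apply: open_continuous_measurable_fun; first exact: interval_open.
by move=> x; rewrite inE /=; exact: cGFdF.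
Qed.

(** The integrands needed below blow up at an end of the interval. Substitution therefore takes
    place on the compact intervals [[A n, B n]], and monotone convergence exhausts both sides. *)
Lemma ge0_substitution_oo :
  (\int[mu]_(y in `]F a, F b[) (G y)%:E = \int[mu]_(x in `]a, b[) (G (F x) * dF x)%:E)%E.
Proof.
rewrite -cup1 -cup2.
have c2 : (\int[mu]_(y in `[F (A n), F (B n)]) (G y)%:E @[n --> \oo] -->
    \int[mu]_(y in \bigcup_n `[F (A n), F (B n)]%classic) (G y)%:E)%E.
  apply: ge0_nondecreasing_set_cvg_integral => //.
  - move=> m n mn; rewrite subsetEset => y /=; rewrite !in_itv /= => /andP[h1 h2].
    have [h3 h4] := seqA mn.
    rewrite (le_trans _ h1) ?(le_trans h2) //; apply: mono => //; apply: in_ab => //.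
  - move=> n; apply/measurable_EFinP; apply: measurable_funS mG => //.
    by move=> y /=; exact: inFAB.
  - by move=> n y /= /inFAB yF; rewrite lee_fin G0.
have c1 : (\int[mu]_(x in `[A n, B n]) (G (F x) * dF x)%:E @[n --> \oo] -->
    \int[mu]_(x in \bigcup_n `[A n, B n]%classic) (G (F x) * dF x)%:E)%E.
  apply: ge0_nondecreasing_set_cvg_integral => //.
  - move=> m n mn; rewrite subsetEset => y /=; rewrite !in_itv /= => /andP[h1 h2].
    have [h3 h4] := seqA mn.
    by rewrite (le_trans h3) // (le_trans h2).
  - move=> n; apply/measurable_EFinP; apply: measurable_funS mGFdF => //.
    by move=> y /=; exact: inAB.
  - move=> n y /= /inAB yF; rewrite lee_fin mulr_ge0 ?G0 ?Foo // ltW // dF0 //.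
rewrite -(cvg_lim (@ereal_hausdorff R) c1) -(cvg_lim (@ereal_hausdorff R) c2).
apply: congr_lim; apply/funext => n.
have AB : A n < B n by exact: eps_half.
have oo x : x \in `]A n, B n[ -> x \in `]a, b[.
  by rewrite in_itv /= => /andP[h1 h2]; apply: (@inAB n); rewrite in_itv /= !ltW.
have F'near x : x \in `]a, b[ -> {near x, (derive1 F) =1 dF}.
  move=> xab; near=> y; apply: F'; near: y; exact: near_in_itvoo.
have cF' x : x \in `]a, b[ -> (derive1 F) y @[y --> x] --> dF x.
  move=> xab; apply: cvg_trans (cdF xab); apply: near_eq_cvg.
  by near=> y; apply/esym; near: y; exact: F'near.
rewrite (@integration_by_substitution_increasing _ F G (A n) (B n)).
- apply: eq_integral => x; rewrite inE /= => xAB.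
  by rewrite /GRing.mul /= F' //; exact: inAB xAB.
- exact: ltW.
- by move=> x y xAB yAB; apply: incF; apply: in_ab; [exact: inAB xAB|exact: inAB yAB].
- by move=> x xAB; rewrite /continuous_at F' ?oo //; apply: cF'; exact: oo.
- by apply/cvg_ex; exists (dF (A n)); apply: cvg_at_right_filter; exact: cF'.
- by apply/cvg_ex; exists (dF (B n)); apply: cvg_at_left_filter; exact: cF'.
- split.
  + by move=> x xAB; apply: dvF; exact: oo.
  + by apply: cvg_at_right_filter; apply/differentiable_continuous/derivable1_diffP/dvF.
  + by apply: cvg_at_left_filter; apply/differentiable_continuous/derivable1_diffP/dvF.
- apply: continuous_in_subspaceT => y; rewrite inE /= => yAB.
  by apply: cG; exact: inFAB yAB.
Unshelve. all: by end_near. Qed.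

End OpenSubstitution.

(** * Wallis integrals *)

Section Kernel.
Variable R : realType.
Notation mu := (@lebesgue_measure R).

Lemma central_bin_step q :
  (q.+1%:R * 'C(q.+1.*2, q.+1)%:R = 2 * q.*2.+1%:R * 'C(q.*2, q)%:R :> R).
Proof.
rewrite -natrM -[2]/(2%:R) -!natrM; congr (_%:R).
have h1 := @bin_fact q.*2 q; have h2 := @bin_fact q.+1.*2 q.+1.
have e1 : (q.*2 - q = q)%N by lia.
have e2 : (q.+1.*2 - q.+1 = q.+1)%N by lia.
have := h1 ltac:(lia); have := h2 ltac:(lia); rewrite e1 e2 doubleS !factS => {}h2 {}h1.
have f0 := fact_gt0 q.
apply/eqP; rewrite -(eqn_pmul2r (_ : 0 < q.+1 * (q`! * q`!))%N) ?muln_gt0 ?f0 //; apply/eqP.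
move: h2; rewrite -h1; nia.
Qed.

(** The reduction formula that integration by parts gives for even powers of the sine, written as an
    explicit primitive. *)
Fixpoint sin_prim (q : nat) (x : R) : R :=
  if q is p.+1 then
    (p.*2.+1%:R * sin_prim p x - cos x * sin x ^+ p.*2.+1) / p.+1.*2%:R
  else x.

Lemma is_derive_sin_prim q (x : R) :
  is_derive x (1 : R) (sin_prim q) (sin x ^+ q.*2).
Proof.
elim: q => [|q IH] /=; first by rewrite expr0; exact: is_derive_id.
pose c : R := q.*2.+1%:R.
have dX := @is_deriveX R R sin q.*2.+1 x 1 (cos x) (is_derive_sin x).
have dM := is_deriveM (is_derive_cos x) dX.
have dS := is_deriveZ c IH.
have dB := is_deriveB dS dM.
have := is_deriveZ (q.+1.*2%:R)^-1 dB.
have -> : ((q.+1.*2%:R)^-1 \*: (c \*: sin_prim q - cos * sin ^+ q.*2.+1)) =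
   (fun x : R => (c * sin_prim q x - cos x * sin x ^+ q.*2.+1) / q.+1.*2%:R).
  by apply/funext => y; rewrite !fctE [RHS]mulrC.
move=> h; apply: is_derive_eq h _.
have scE (u : R) (v : R^o) : u *: v = u * v by [].
rewrite !scE /= -/c.
have := cos2sin2 x; set S := sin x; set K := cos x => hK.
rewrite !fctE doubleS !exprS -/S /c.
have -> : K * (q.*2.+1%:R * S ^+ q.*2 * K) = q.*2.+1%:R * S ^+ q.*2 * (1 - S ^+ 2).
  by rewrite -hK; ring.
have -> : q.*2.+2%:R = q.*2.+1%:R + 1 :> R by rewrite natr1.
by field; rewrite nat1r natr1 pnatr_eq0.
Qed.

(** At a zero of the cosine the boundary term of the reduction formula vanishes, and what remains is
    the recurrence of ['C(q.*2, q) / 4 ^+ q]. *)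
Lemma sin_prim_pihalf q (x : R) : cos x = 0 ->
  sin_prim q x = x * 'C(q.*2, q)%:R / 4 ^+ q.
Proof.
move=> cx; elim: q => [|q IH] /=; first by rewrite bin0 expr0 mulr1 divr1.
rewrite IH cx mul0r subr0 exprS.
have h := central_bin_step q.
have q0 : q.+1%:R != 0 :> R by rewrite pnatr_eq0.
have -> : 'C(q.+1.*2, q.+1)%:R = 2 * q.*2.+1%:R * 'C(q.*2, q)%:R / q.+1%:R :> R.
  by rewrite -h [q.+1%:R * _]mulrC mulfK.
have -> : q.*2.+2%:R = 2 * q.+1%:R :> R by rewrite -natrM mul2n doubleS.
by field; rewrite !nat1r q0 !expf_neq0 ?pnatr_eq0.
Qed.

Lemma integral_sin_even q :
  (\int[mu]_(x in `](- (pi / 2))%R, (pi / 2)%R[) (sin x ^+ q.*2)%:E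
    = (pi * 'C(q.*2, q)%:R / 4 ^+ q)%:E)%E.
Proof.
have p0 := pi_gt0 R.
have cs : continuous (fun x : R => sin x ^+ q.*2).
  move=> x; apply: (@continuous_comp _ _ _ sin (fun y => y ^+ q.*2)).
    exact: continuous_sin.
  exact: exprn_continuous.
rewrite -(@integral_itv_bndoo _ (- (pi / 2)) (pi / 2) _ true false); last first.
  by apply/measurable_EFinP; apply: measurable_funTS; exact: continuous_measurable_fun.
rewrite (@continuous_FTC2 _ _ (sin_prim q)).
- rewrite -EFinB !sin_prim_pihalf ?cosN ?cos_pihalf //; congr (_%:E).
  by field; rewrite expf_neq0.
- lra.
- exact: continuous_subspaceT.
- have dv x : derivable (sin_prim q) x 1.
    by have h := is_derive_sin_prim q x; exact: ex_derive.
  split => //.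
  + by apply: cvg_at_right_filter; apply/differentiable_continuous/derivable1_diffP.
  + by apply: cvg_at_left_filter; apply/differentiable_continuous/derivable1_diffP.
- by move=> x _; rewrite derive1E; have h := is_derive_sin_prim q x; rewrite derive_val.
Qed.

End Kernel.

(** * The elliptic integral as an integral over the angle *)

Section Pendulum.
Variable R : realType.
Notation mu := (@lebesgue_measure R).
Implicit Types t phi x y : R.

(* [Num.sqrt] vanishes on negative numbers and [0^-1 = 0], so the kernel is
   supported in the region [t ^+ 2 < 2 * cos phi]. *)
Definition kernel phi t : R := (Num.sqrt (2 * cos phi - t ^+ 2))^-1.

Lemma kernel_ge0 phi t : 0 <= kernel phi t.
Proof. by rewrite /kernel invr_ge0 sqrtr_ge0. Qed.

Lemma kernel_eq0 phi t : 2 * cos phi <= t ^+ 2 -> kernel phi t = 0.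
Proof. by move=> h; rewrite /kernel ler0_sqrtr ?invr0 // subr_le0. Qed.

Lemma continuous_sqrt_inv x : 0 < x -> {for x, continuous (fun y : R => (Num.sqrt y)^-1)}.
Proof.
move=> x0; apply: (@continuousV _ _ (@Num.sqrt R)).
  by rewrite sqrtr_eq0 -ltNge.
exact: sqrt_continuous.
Qed.

Lemma cos_half x : cos x = 1 - 2 * sin (x / 2) ^+ 2.
Proof.
rewrite {1}(splitr x) -mulr2n cos_mulr2n cos2sin2 mulrnBl mulr_natl.
by rewrite -[1 *+ 2]/(1 + 1 : R); ring.
Qed.

(** Substitute [t = c sin x] with [c^2 = 2 cos phi]: the square root becomes [c cos x], which
    cancels the Jacobian and leaves a Wallis integral. *)
Lemma kernel_integral_t q phi : 0 < phi < pi / 2 ->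
  (\int[mu]_t (t ^+ q.*2 * kernel phi t)%:E =
   ((2 * cos phi) ^+ q * (pi * 'C(q.*2, q)%:R / 4 ^+ q))%:E)%E.
Proof.
move=> /andP[ph0 ph1]; have p0 := pi_gt0 R.
have c0 : 0 < cos phi by apply: cos_gt0_pihalf; lra.
pose c := Num.sqrt (2 * cos phi).
have cc : c ^+ 2 = 2 * cos phi by rewrite /c sqr_sqrtr // mulr_ge0 // ltW.
have c_gt0 : 0 < c by rewrite /c sqrtr_gt0 mulr_gt0.
pose F x := c * sin x.
have Fa : F (- (pi / 2)) = - c by rewrite /F sinN sin_pihalf mulrN1.
have Fb : F (pi / 2) = c by rewrite /F sin_pihalf mulr1.
have supp t : t \in `]F (- (pi / 2)), F (pi / 2)[ = (t ^+ 2 < 2 * cos phi).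
  by rewrite Fa Fb in_itv /= -ltr_norml -cc -(real_normK (num_real t)) ltr_pXn2r // nnegrE // ltW.
transitivity (\int[mu]_(t in `](F (- (pi / 2))%R), (F (pi / 2)%R)[) (t ^+ q.*2 * kernel phi t)%:E)%E.
  rewrite [RHS]integral_mkcond; apply: eq_integral => t _; rewrite patchE.
  case: ifPn => //; rewrite notin_setE /= supp => /negP; rewrite -leNgt => h.
  by rewrite kernel_eq0 // mulr0.
rewrite (@ge0_substitution_oo _ _ _ _ (fun x => c * cos x)).
- transitivity (\int[mu]_(x in `](- (pi / 2) : R)%R, (pi / 2 : R)%R[) ((c ^+ q.*2)%:E * (sin x ^+ q.*2)%:E))%E.
    apply: eq_integral => x; rewrite inE /= in_itv /= => /andP[x1 x2].
    have cx : 0 < cos x by apply: cos_gt0_pihalf; lra.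
    rewrite -EFinM /kernel /F -cc; congr (_%:E).
    have -> : c ^+ 2 - (c * sin x) ^+ 2 = (c * cos x) ^+ 2.
      by rewrite !exprMn cos2sin2; ring.
    rewrite sqrtr_sqr ger0_norm ?mulr_ge0 ?ltW // exprMn.
    by rewrite mulfVK // mulf_neq0 // gt_eqF.
  rewrite ge0_integralZl_EFin //.
  + by rewrite integral_sin_even -EFinM -mul2n exprM cc.
  + by move=> x _; rewrite lee_fin -muln2 exprM sqr_ge0.
  + apply/measurable_EFinP; apply: measurable_funTS; apply: measurable_funX.
    by apply: continuous_measurable_fun; exact: continuous_sin.
  + by rewrite exprn_ge0 // ltW.
- lra.
- apply: continuous_subspaceT => x; apply: (@continuousM _ _ (fun=> c) sin).
    exact: cst_continuous.
  exact: continuous_sin.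
- move=> x _; have h := is_derive_sin x.
  exact: (is_deriveZ c h).
- move=> x; rewrite in_itv /= => /andP[x1 x2].
  by rewrite mulr_gt0 // cos_gt0_pihalf // x1.
- move=> x _; apply: (@continuousM _ _ (fun=> c) cos); first exact: cst_continuous.
  exact: continuous_cos.
- move=> t; rewrite supp => ht; apply: (@continuousM _ _ (fun t : R => t ^+ q.*2) (kernel phi)).
    exact: exprn_continuous.
  apply: (@continuous_comp _ _ _ (fun t : R => 2 * cos phi - t ^+ 2) (fun y : R => (Num.sqrt y)^-1)).
    by apply: continuousB; [exact: cst_continuous|exact: exprn_continuous].
  by apply: continuous_sqrt_inv; rewrite subr_gt0.
- by move=> t _; rewrite mulr_ge0 ?kernel_ge0 // -muln2 exprM sqr_ge0.
Qed.

(** The classical pendulum substitution [sin (phi / 2) = k sin x] with [k^2 = 1/2 - t^2/4]: since [2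
    cos phi - t^2 = 4 (k^2 - sin^2 (phi / 2)) = (2 k cos x)^2], the kernel turns into the integrand
    of [elliptic_K k]. *)
Lemma kernel_integral_phi t :
  (\int[mu]_(phi in `]0%R, (pi / 2)%R[) (kernel phi t)%:E =
   (if `|t| < Num.sqrt 2 then elliptic_K (Num.sqrt (2^-1 - t ^+ 2 / 4)) else 0)%:E)%E.
Proof.
have p0 := pi_gt0 R.
have t2E : (`|t| < Num.sqrt 2) = (t ^+ 2 < 2).
  by rewrite -(@ltr_pXn2r _ 2) ?nnegrE // sqr_sqrtr // real_normK ?num_real.
rewrite t2E; case: ifPn => [t2|]; last first.
  rewrite -leNgt => t2; rewrite -[RHS](@integral0 _ _ _ mu `]0, (pi / 2)[%classic).
  apply: eq_integral => phi _; rewrite kernel_eq0 //.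
  by apply: le_trans t2; have := cos_le1 phi; lra.
set k := Num.sqrt _.
have kk : k ^+ 2 = 2^-1 - t ^+ 2 / 4 by rewrite sqr_sqrtr //; lra.
have k_gt0 : 0 < k by rewrite sqrtr_gt0; lra.
have k1 : k < 1.
  rewrite -(@ltr_pXn2r _ 2) ?nnegrE ?ltW // kk expr1n; have := sqr_ge0 t; lra.
have ks x : -1 < k * sin x < 1.
  by have := sin_max x; rewrite ler_norml => /andP[h1 h2]; apply/andP; split; nra.
have ks' x : -1 <= k * sin x <= 1 by have := ks x => /andP[h1 h2]; rewrite !ltW.
pose F x := 2 * asin (k * sin x).
pose dF x := 2 * ((Num.sqrt (1 - (k * sin x) ^+ 2))^-1 * (k * cos x)).
have den x : 0 < 1 - (k * sin x) ^+ 2 by have /andP[h1 h2] := ks x; nra.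
have sinF x : sin (F x / 2) = k * sin x.
  by rewrite /F mulrC mulKf // asinK // in_itv /= ks'.
have F0 : F 0 = 0.
  by rewrite /F sin0 mulr0 -{1}(sin0 R) sinK ?mulr0 // in_itv /=; lra.
have Fp : F (pi / 2) = 2 * asin k by rewrite /F sin_pihalf mulr1.
have asin_k : 0 < asin k /\ asin k <= pi / 2.
  split; last by apply: asin_lepi2; lra.
  have kin : k \in `[(-1), 1] by rewrite in_itv /=; lra.
  rewrite ltNge; apply/negP => h.
  have : sin (asin k) <= 0.
    rewrite -oppr_ge0 -sinN; apply: sin_ge0_pi.
    have := @asin_geNpi2 R k ltac:(lra); lra.
  by rewrite asinK // leNgt k_gt0.
(* [F (pi / 2) = 2 asin k] is the turning point: beyond it the argument of the square root is no
   longer positive. *)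
have supp phi : 0 < phi <= pi -> (phi < F (pi / 2)) = (t ^+ 2 < 2 * cos phi).
  move=> hp; have -> : (phi < F (pi / 2)) = (phi / 2 < asin k).
    by rewrite Fp ltr_pdivrMr // mulrC.
  have -> : (phi / 2 < asin k) = (sin (phi / 2) < sin (asin k)).
    by rewrite ltr_sin // in_itv /=; lra.
  have s0 : 0 <= sin (phi / 2) by apply: sin_ge0_pi; lra.
  rewrite asinK; last by rewrite in_itv /=; lra.
  by rewrite -(@ltr_pXn2r _ 2) ?nnegrE ?(ltW k_gt0) // kk (cos_half phi); apply/idP/idP; lra.
transitivity (\int[mu]_(phi in `](F 0%R), (F (pi / 2)%R)[) (kernel phi t)%:E)%E.
  rewrite integral_mkcond [RHS]integral_mkcond; apply: eq_integral => phi _.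
  rewrite !patchE F0; case: ifPn => h1; case: ifPn => h2 //.
    rewrite kernel_eq0 //; move: h1 h2; rewrite inE notin_setE /= !in_itv /= => /andP[h1 h2].
    by move/negP; rewrite h1 /= supp ?h1 -?leNgt //=; lra.
  rewrite kernel_eq0 //; move: h2 h1; rewrite inE notin_setE /= !in_itv /= => /andP[h1 h2].
  move/negP; rewrite h1 /= -leNgt => h3; rewrite Fp in h2.
  have : cos phi <= 0.
    rewrite -cos_pihalf; move: h3; rewrite le_eqVlt => /predU1P[->//|h3].
    by rewrite ltW // ltr_cos // in_itv /=; lra.
  have := sqr_ge0 t; lra.
have dasin x : is_derive x (1 : R) F (dF x).
  have h1 := is_deriveZ k (is_derive_sin x).
  have h2 := @is_derive1_asin R (k * sin x) (ks x).
  have h3 := @is_derive1_comp R asin (fun x => k * sin x) x _ _ h2 h1.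
  exact: (is_deriveZ (2 : R) h3).
have cks : continuous (fun x => k * sin x).
  by move=> x; apply: (@continuousM _ _ (fun=> k) sin); [exact: cst_continuous|exact: continuous_sin].
have cden x : {for x, continuous (fun x => 1 - (k * sin x) ^+ 2)}.
  apply: continuousB; first exact: cst_continuous.
  by apply: (@continuous_comp _ _ _ (fun x => k * sin x) (fun y => y ^+ 2)); [exact: cks|exact: exprn_continuous].
have cinv : continuous (fun x => (Num.sqrt (1 - (k * sin x) ^+ 2))^-1).
  move=> x; apply: (@continuous_comp _ _ _ (fun x => 1 - (k * sin x) ^+ 2) (fun y : R => (Num.sqrt y)^-1)).
    exact: cden.
  exact: continuous_sqrt_inv.
rewrite (@ge0_substitution_oo _ _ _ _ dF).
- transitivity (\int[mu]_(x in `]0%R, (pi / 2)%R[) ((Num.sqrt (1 - k ^+ 2 * sin x ^+ 2))^-1)%:E)%E.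
    apply: eq_integral => x; rewrite inE /= in_itv /= => /andP[x1 x2].
    have cx : 0 < cos x by apply: cos_gt0_pihalf; lra.
    congr (_%:E); rewrite /kernel /dF cos_half sinF.
    have -> : 2 * (1 - 2 * (k * sin x) ^+ 2) - t ^+ 2 = (2 * (k * cos x)) ^+ 2.
      have -> : t ^+ 2 = 2 - 4 * k ^+ 2 by rewrite kk; field.
      by rewrite !exprMn cos2sin2; ring.
    rewrite sqrtr_sqr ger0_norm ?mulr_ge0 ?ltW // !exprMn.
    have s0 : Num.sqrt (1 - k ^+ 2 * sin x ^+ 2) != 0.
      by rewrite sqrtr_eq0 -ltNge -exprMn.
    by field; rewrite s0 !gt_eqF.
  rewrite /elliptic_K /Rintegral.
  have eqf : (fun a => ((Num.sqrt (1 - k ^+ 2 * sin a ^+ 2))^-1)%:E) =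
      (fun x => ((Num.sqrt (1 - (k * sin x) ^+ 2))^-1)%:E).
    by apply/funext => x; rewrite exprMn.
  rewrite eqf fineK; last first.
    apply: integrable_fin_num => //; apply: continuous_compact_integrable.
      exact: segment_compact.
    exact: continuous_subspaceT.
  rewrite [RHS](@integral_itv_bndoo _ 0 (pi / 2) _ true false) //.
  by apply/measurable_EFinP; apply: measurable_funTS; exact: continuous_measurable_fun.
- lra.
- apply: continuous_subspaceT => x; apply/differentiable_continuous/derivable1_diffP.
  by have h := dasin x; exact: ex_derive.
- by move=> x _; exact: dasin.
- move=> x; rewrite in_itv /= => /andP[x1 x2].
  have cx : 0 < cos x by apply: cos_gt0_pihalf; lra.
  by rewrite /dF !mulr_gt0 // invr_gt0 sqrtr_gt0.
- move=> x _; apply: (@continuousM _ _ (fun=> 2)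
    (fun x => (Num.sqrt (1 - (k * sin x) ^+ 2))^-1 * (k * cos x))).
    exact: cst_continuous.
  apply: (@continuousM _ _ (fun x => (Num.sqrt (1 - (k * sin x) ^+ 2))^-1) (fun x => k * cos x)).
    exact: cinv.
  by apply: (@continuousM _ _ (fun=> k) cos); [exact: cst_continuous|exact: continuous_cos].
- move=> phi; rewrite F0 in_itv /= => /andP[h1 h2].
  have hpi : phi <= pi by move: h2; rewrite Fp; lra.
  apply: (@continuous_comp _ _ _ (fun phi : R => 2 * cos phi - t ^+ 2) (fun y : R => (Num.sqrt y)^-1)).
    apply: continuousB; last exact: cst_continuous.
    by apply: (@continuousM _ _ (fun=> 2) cos); [exact: cst_continuous|exact: continuous_cos].
  by apply: continuous_sqrt_inv; rewrite subr_gt0 -supp // h1.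
- by move=> phi _; exact: kernel_ge0.
Qed.

End Pendulum.

Section Moments.
Variable R : realType.
Notation mu := (@lebesgue_measure R).
Notation T := (measurableTypeR R).

Lemma expr_double_ge0 (x : R) q : 0 <= x ^+ q.*2.
Proof. by rewrite -muln2 exprM sqr_ge0. Qed.

Lemma measurable_invr : measurable_fun [set: R] (fun x : R => x^-1).
Proof.
rewrite -(setvU [set 0 : R]); apply/measurable_funU => //; first exact: measurableC.
split; last exact: measurable_fun_set1.
apply: open_continuous_measurable_fun; first by apply: closed_openC; exact: closed_eq.
by move=> x; rewrite inE /= => /eqP x0; exact: inv_continuous.
Qed.

Definition cos_moment q : R := \int[mu]_(x in `[0, pi / 2]) (cos x ^+ q).

Lemma continuous_cosX q : continuous (fun x : R => cos x ^+ q).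
Proof.
move=> x; apply: (@continuous_comp _ _ _ cos (fun y : R => y ^+ q)).
  exact: continuous_cos.
exact: exprn_continuous.
Qed.

Lemma cos_momentE q :
  (\int[mu]_(x in `]0%R, (pi / 2)%R[) (cos x ^+ q)%:E = (cos_moment q)%:E)%E.
Proof.
rewrite /cos_moment /Rintegral fineK; last first.
  apply: integrable_fin_num => //; apply: continuous_compact_integrable.
    exact: segment_compact.
  exact/continuous_subspaceT/continuous_cosX.
rewrite [RHS](@integral_itv_bndoo _ 0 (pi / 2) _ true false) //.
by apply/measurable_EFinP; apply: measurable_funTS; apply: continuous_measurable_fun; exact: continuous_cosX.
Qed.

Definition SF_moment q : R := 'C(q.*2, q)%:R / 2 ^+ q * cos_moment q / pi.

(** The indicator of the range of [phi] lets both variables run over the whole line, as in Tonelli's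
    theorem; the factor [pi ^+ 2] is the normalization of the density. *)
Let f q (p : T * T) : \bar R :=
  ((p.1 ^+ q.*2 / pi ^+ 2 * kernel p.2 p.1) * \1_(`]0, (pi / 2)[%classic : set R) p.2)%:E.

Let f_ge0 q p : (0 <= f q p)%E.
Proof.
by rewrite lee_fin !mulr_ge0 ?expr_double_ge0 ?kernel_ge0 ?invr_ge0 ?sqr_ge0.
Qed.

Let mf q : measurable_fun setT (f q).
Proof.
apply/measurable_EFinP; apply: measurable_funM; last first.
  by apply: measurableT_comp => //; exact: measurable_indic.
apply: measurable_funM.
  by apply: measurable_funM => //; apply: measurable_funX.
rewrite /kernel; apply: (measurableT_comp measurable_invr).
apply: measurableT_comp; first by apply: continuous_measurable_fun; exact: sqrt_continuous.
apply: measurable_funB; last exact: measurable_funX.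
apply: measurable_funM => //; apply: measurableT_comp => //.
by apply: continuous_measurable_fun; exact: continuous_cos.
Qed.

Lemma integral_SF_density q :
  (\int[mu]_t (t ^+ q.*2 * SF_density t)%:E = (SF_moment q)%:E)%E.
Proof.
have p0 := pi_gt0 R.
have mker t : measurable_fun [set: R] (fun phi : R => kernel phi t).
  rewrite /kernel; apply: (measurableT_comp measurable_invr).
  apply: measurableT_comp; first by apply: continuous_measurable_fun; exact: sqrt_continuous.
  apply: measurable_funB => //; apply: measurable_funM => //.
  by apply: continuous_measurable_fun; exact: continuous_cos.
transitivity (\int[mu]_t \int[mu]_phi f q (t, phi))%E.
  apply: eq_integral => t _.
  transitivity (\int[mu]_(phi in `]0%R, (pi / 2)%R[) ((t ^+ q.*2 / pi ^+ 2)%:E * (kernel phi t)%:E))%E.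
    rewrite ge0_integralZl_EFin //.
    - rewrite kernel_integral_phi -EFinM /SF_density; congr (_%:E).
      by case: ifP => _; ring.
    - by move=> phi _; rewrite lee_fin kernel_ge0.
    - by apply/measurable_EFinP; apply: measurable_funTS; exact: mker.
    - by rewrite mulr_ge0 ?expr_double_ge0 ?invr_ge0 ?sqr_ge0.
  rewrite [LHS]integral_mkcond; apply: eq_integral => phi _.
  rewrite patchE /f /= indicE; case: ifPn => h; rewrite ?mulr1 ?mulr0 ?EFinM //.
rewrite (@fubini_tonelli _ _ _ _ _ mu mu (f q)) //.
transitivity (\int[mu]_(phi in `]0%R, (pi / 2)%R[)
   ((2 ^+ q * (pi * 'C(q.*2, q)%:R / 4 ^+ q) / pi ^+ 2)%:E * (cos phi ^+ q)%:E))%E.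
  rewrite [RHS]integral_mkcond; apply: eq_integral => phi _.
  rewrite patchE; case: ifPn => h; last first.
    rewrite -[RHS](@integral0 _ _ _ mu setT); apply: eq_integral => t _.
    by rewrite /f /= indicE (negbTE h) mulr0.
  transitivity (\int[mu]_t ((pi ^+ 2)^-1%:E * (t ^+ q.*2 * kernel phi t)%:E))%E.
    apply: eq_integral => t _; rewrite /f /= indicE h mulr1 -EFinM; congr (_%:E).
    by ring.
  rewrite ge0_integralZl_EFin //.
  - rewrite kernel_integral_t; last by move: h; rewrite inE /= in_itv.
    by rewrite -!EFinM exprMn; congr (_%:E); ring.
  - by move=> t _; rewrite lee_fin mulr_ge0 ?kernel_ge0 ?expr_double_ge0.
  - apply/measurable_EFinP; apply: measurable_funM; first exact: measurable_funX.
    rewrite /kernel; apply: (measurableT_comp measurable_invr).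
    apply: measurableT_comp; first by apply: continuous_measurable_fun; exact: sqrt_continuous.
    by apply: measurable_funB => //; exact: measurable_funX.
  - by rewrite invr_ge0 exprn_ge0 ?pi_ge0.
rewrite ge0_integralZl_EFin //.
- rewrite cos_momentE -EFinM /SF_moment; congr (_%:E).
  have -> : 4 ^+ q = 2 ^+ q * 2 ^+ q :> R by rewrite -exprMn -natrM.
  have : 2 ^+ q != 0 :> R by rewrite expf_neq0.
  have : pi != 0 :> R by rewrite gt_eqF.
  move: (pi : R) (2 ^+ q) => P E P0 E0.
  by field; rewrite P0 E0.
- move=> x; rewrite /= in_itv /= => /andP[x1 x2].
  by rewrite lee_fin exprn_ge0 // cos_ge0_pihalf //; lra.
- by apply/measurable_EFinP; apply: measurable_funTS; apply: continuous_measurable_fun; exact: continuous_cosX.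
- by rewrite !mulr_ge0 ?invr_ge0 ?mulr_ge0 ?invr_ge0 ?exprn_ge0 ?pi_ge0.
Qed.

End Moments.

(** * Integration against a measure given by a density *)

Section Density.
Local Open Scope ereal_scope.
Context d (T : measurableType d) (R : realType).
Variables (mu nu : {measure set T -> \bar R}) (g : T -> R).
Hypothesis g0 : forall x, (0 <= g x)%R.
Hypothesis mg : measurable_fun setT g.
Hypothesis nuE : forall A, measurable A -> nu A = \int[mu]_(x in A) (g x)%:E.

Import HBNNSimple.

(** Monotone convergence on both sides reduces the identity to simple functions, where it is [nuE]
    on each level set. *)
Lemma ge0_integral_density (f : T -> \bar R) : measurable_fun setT f ->
  (forall x, 0 <= f x) -> \int[nu]_x f x = \int[mu]_x (f x * (g x)%:E).
Proof.
move=> mf f0; pose h := nnsfun_approx measurableT mf.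
have mgE : measurable_fun setT (EFin \o g) by exact/measurable_EFinP.
have -> : \int[nu]_x f x = lim (\int[nu]_x (h n x)%:E @[n --> \oo]).
  have fE x : f x = lim ((EFin \o h n) x @[n --> \oo]).
    by apply/esym/cvg_lim => //; exact: cvg_nnsfun_approx.
  under eq_integral => x _ do rewrite fE.
  apply: monotone_convergence => //.
  - by move=> n; apply/measurable_EFinP.
  - by move=> n x _; rewrite lee_fin.
  - by move=> x _ a b ab; rewrite lee_fin; exact/lefP/nd_nnsfun_approx.
have -> : \int[mu]_x (f x * (g x)%:E) = lim (\int[mu]_x ((h n x)%:E * (g x)%:E) @[n --> \oo]).
  have fgE x : f x * (g x)%:E = lim (((h n x)%:E * (g x)%:E) @[n --> \oo]).
    apply/esym/cvg_lim => //; apply: cvgeZr => //.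
    exact: (cvg_nnsfun_approx measurableT mf).
  under eq_integral => x _ do rewrite fgE.
  apply: monotone_convergence => //.
  - by move=> n; apply: emeasurable_funM => //; exact/measurable_EFinP.
  - by move=> n x _; rewrite mule_ge0 // lee_fin.
  - by move=> x _ a b ab; rewrite lee_wpmul2r ?lee_fin //; exact/lefP/nd_nnsfun_approx.
apply: congr_lim; apply/funext => n.
transitivity (\int[nu]_x (\sum_(y \in range (h n)) (y * \1_(h n @^-1` [set y]) x)%:E)).
  by apply: eq_integral => t _; rewrite fimfunE -fsumEFin.
have indich r : measurable_fun setT (fun x => (r * \1_(h n @^-1` [set r]) x)%:E).
  by apply/measurable_EFinP; exact: measurable_funM.
rewrite ge0_integral_fsum //; last by move=> m y _; exact: nnfun_muleindic_ge0.
transitivity (\int[mu]_x (\sum_(y \in range (h n)) ((y * \1_(h n @^-1` [set y]) x)%:E * (g x)%:E))); last first.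
  apply: eq_integral => x _.
  rewrite -ge0_mule_fsuml => [|y]; last exact: nnfun_muleindic_ge0.
  by rewrite fsumEFin // -(fimfunE _ x).
rewrite ge0_integral_fsum //; last 2 first.
  - by move=> y; apply: emeasurable_funM.
  - move=> m y _; apply: mule_ge0; last by rewrite lee_fin.
    exact: nnfun_muleindic_ge0.
apply: eq_fsbigr => r; rewrite inE => -[t _ rE].
have r0 : (0 <= r)%R by rewrite -rE.
under eq_integral do rewrite EFinM.
rewrite ge0_integralZl_EFin //; last by apply/measurable_EFinP.
under [RHS]eq_integral do rewrite EFinM -muleA.
rewrite ge0_integralZl_EFin //; last 2 first.
  - by move=> x _; rewrite mule_ge0 // lee_fin.
  - by apply: emeasurable_funM => //; exact/measurable_EFinP.
congr (_ * _).
rewrite integral_indic // setIT nuE // [LHS]integral_mkcond.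
by apply: eq_integral => x _; rewrite epatch_indic muleC.
Qed.

End Density.

Section LineMeasure.
Variable R : realType.
Notation mu := (@lebesgue_measure R).
Notation nu := (@SF_line_measure R).
Notation T := (measurableTypeR R).

Lemma SF_ge0_integral (f : T -> \bar R) : measurable_fun setT f ->
  (forall x, 0 <= f x)%E -> (\int[nu]_x f x = \int[mu]_x (f x * (SF_density x)%:E))%E.
Proof.
move=> mf f0; apply: ge0_integral_density => //.
  exact: SF_density_ge0.
exact: measurable_SF_density.
Qed.

(** Each of the two lines carries mass 1/2, so the limit measure is a probability measure. *)
Lemma SF_moment0 : SF_moment R 0 = 2^-1.
Proof.
have -> : SF_moment R 0 = cos_moment R 0 / pi.
  by rewrite /SF_moment bin0 expr0 divr1 mul1r.
have -> : cos_moment R 0 = pi / 2.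
  have := lebesgue_measure_itv `[0, pi / 2 : R]; rewrite /= lte_fin divr_gt0 ?pi_gt0 // sube0 => hm.
  rewrite /cos_moment.
  transitivity (\int[mu]_(x in `[0, pi / 2]) (1 : R)).
    by apply: eq_Rintegral => x _; rewrite expr0.
  by rewrite Rintegral_cst //= hm /= mul1r.
by rewrite mulrAC mulfV ?mul1r // gt_eqF // pi_gt0.
Qed.

Lemma SF_even_integral q : (\int[nu]_t (t ^+ q.*2)%:E = (SF_moment R q)%:E)%E.
Proof.
rewrite SF_ge0_integral.
- by rewrite -integral_SF_density; apply: eq_integral => t _; rewrite EFinM.
- by apply/measurable_EFinP; exact: measurable_funX.
- by move=> t; rewrite lee_fin expr_double_ge0.
Qed.

(** The density vanishes for [|t| >= Num.sqrt 2] and has mass 1/2. A bound on that interval is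
    therefore enough, and polynomials qualify. *)
Lemma SF_bounded (h : T -> R) (M : R) : measurable_fun setT h ->
  (forall t : R, `|t| < Num.sqrt 2 -> `|h t| <= M) ->
  nu.-integrable setT (EFin \o h) /\ `|\int[nu]_t h t| <= M / 2.
Proof.
move=> mh hM.
have M0 : 0 <= M by apply: le_trans (hM 0 _) => //; rewrite normr0 sqrtr_gt0.
have le1 : (\int[nu]_t `|(h t)%:E| <= (M / 2)%:E)%E.
  rewrite SF_ge0_integral; last 2 first.
  - by apply: measurableT_comp => //; exact/measurable_EFinP.
  - by move=> t.
  apply: (@le_trans _ _ (\int[mu]_t (M%:E * (SF_density t)%:E))%E).
    apply: ge0_le_integral => //.
    - by move=> t _; rewrite mule_ge0 // lee_fin SF_density_ge0.
    - apply: emeasurable_funM; first by apply: measurableT_comp => //; exact/measurable_EFinP.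
      by apply/measurable_EFinP; exact: measurable_SF_density.
    - by apply: emeasurable_funM => //; apply/measurable_EFinP; exact: measurable_SF_density.
    - move=> t _; rewrite /= -!EFinM lee_fin.
      have [/hM ht|h2] := boolP (`|t| < Num.sqrt 2).
        by rewrite ler_wpM2r // SF_density_ge0.
      by rewrite /SF_density (negbTE h2) !mulr0.
  rewrite ge0_integralZl_EFin //.
  - have := integral_SF_density R 0; rewrite SF_moment0.
    have -> : (\int[mu]_t (t ^+ 0.*2 * SF_density t)%:E = \int[mu]_t (SF_density t)%:E)%E.
      by apply: eq_integral => t _; rewrite expr0 mul1r.
    by move=> ->; rewrite -EFinM.
  - by move=> t _; rewrite lee_fin SF_density_ge0.
  - by apply/measurable_EFinP; exact: measurable_SF_density.
have int_h : nu.-integrable setT (EFin \o h).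
  apply/integrableP; split; first exact/measurable_EFinP.
  by apply: (le_lt_trans le1); rewrite ltry.
split=> //.
apply: le_trans; first exact: le_normr_Rintegral.
rewrite -lee_fin /Rintegral fineK; last first.
  rewrite ge0_fin_numE; last by apply: integral_ge0.
  by apply: (le_lt_trans le1); rewrite ltry.
exact: le1.
Qed.

Lemma SF_even_Rintegral q : \int[nu]_t (t ^+ q.*2) = SF_moment R q.
Proof. by rewrite /Rintegral SF_even_integral. Qed.

Lemma SF_densityN t : SF_density (- t) = SF_density t :> R.
Proof. by rewrite /SF_density normrN sqrrN. Qed.

Lemma SF_integralN (f : T -> \bar R) : measurable_fun setT f ->
  (forall x, 0 <= f x)%E -> (\int[nu]_x f (- x)%R = \int[nu]_x f x)%E.
Proof.
move=> mf f0; have mN : measurable_fun setT (-%R : T -> T).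
  exact: oppr_measurable.
rewrite [LHS]SF_ge0_integral //; last exact: measurableT_comp.
rewrite SF_ge0_integral //.
pose F x := (f x * (SF_density x)%:E)%E.
have mF : measurable_fun setT F.
  apply: emeasurable_funM => //; apply/measurable_EFinP; exact: measurable_SF_density.
transitivity (\int[mu]_(x in (-%R : T -> T) @^-1` setT) F (- x)%R)%E.
  by rewrite preimage_setT; apply: eq_integral => x _; rewrite /F SF_densityN.
rewrite -(@ge0_integral_pushforward _ _ T T R (-%R : T -> T) mN mu setT F) //.
  by apply: eq_measure_integral => A mA _; exact: lebesgue_measureN.
by move=> y _; rewrite mule_ge0 ?lee_fin ?SF_density_ge0.
Qed.

Lemma SF_odd_Rintegral q : \int[nu]_t (t ^+ q.*2.+1) = 0.
Proof.
rewrite /Rintegral integralE.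
set f := (fun t : T => (t ^+ q.*2.+1)%:E).
have mf : measurable_fun setT f by apply/measurable_EFinP; exact: measurable_funX.
have -> : (\int[nu]_t f^\- t = \int[nu]_t f^\+ t)%E.
  rewrite -[RHS]SF_integralN //; last exact: measurable_funepos.
  apply: eq_integral => t _; rewrite funenegE funeposE /f !exprS.
  by rewrite -mul2n !exprM sqrrN mulNr EFinN.
(* In the infinite cases the difference is infinite, and [fine] sends it to 0. *)
case: (\int[nu]_t f^\+ t)%E => [r| |] //=.
by rewrite subrr.
Qed.

End LineMeasure.

(** * Gauging the Scottish flag matrix to a nearly normal one *)

Local Open Scope sesquilinear_scope.
Local Open Scope complex_scope.

Section Departure.
Variables (R : realType) (n : nat).
Implicit Types (al be s : 'I_n -> R[i]) (p : 'I_n -> R).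

Lemma normc_sq (z : R[i]) : `|z| ^+ 2 = (complex.Re z ^+ 2 + complex.Im z ^+ 2)%:C.
Proof. by rewrite add_Re2_Im2. Qed.

(** By [sqr_i] each term of the trace of the fourth power is minus a real expression in [p], and the
    Gram sum is the same expression with both squared moduli in place of [p]. Were these equal to
    [|p|], the two would differ only at sign changes of [p], where neighbouring values are at most
    [L] apart: this gives [2 L^2]. The excess [e] of the squared moduli contributes [8 e] through
    the square and [4 e] through the product. *)
Lemma cyc_departure al be p (e L : R) : (4 < n)%N ->
  (forall i, al i * be i = 'i%C * (p i)%:C) ->
  (forall i, `|al i| ^+ 2 <= (`|p i| + e)%:C) ->
  (forall i, `|be i| ^+ 2 <= (`|p i| + e)%:C) ->
  (forall i, `|p i| <= 2^-1) -> 0 <= e <= 1 ->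
  (forall i, `|p (ordS i) - p i| <= L) ->
  fro (cyc al be *m (cyc al be)^t*) - `|\tr (cyc al be ^+ 4)|
    <= (n%:R * (2 * L ^+ 2 + 12 * e))%:C.
Proof.
move=> n4 albe hal hbe p2 /andP[e0 e1] hL.
have two : (2 : R)%:C = 2 by rewrite rmorph_nat.
have realE (x y z : R) : ((x + y) ^+ 2 + 2 * (y * z))%:C = (x%:C + y%:C) ^+ 2 + 2 * (y%:C * z%:C) :> R[i].
  by rewrite -two -rmorphD -rmorphXn -!rmorphM -rmorphD.
rewrite cyc_fro_gram // cyc_trace4 //.
have -> : \sum_i ((al (ord_pred i) * be (ord_pred i) + al i * be i) ^+ 2 +
   2 * ((al i * be i) * (al (ordS i) * be (ordS i)))) =
   - (\sum_i ((p (ord_pred i) + p i) ^+ 2 + 2 * (p i * p (ordS i))))%:C.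
  rewrite rmorph_sum -sumrN; apply: eq_bigr => i _; rewrite /= !albe.
  have ii := sqr_i R; rewrite realE.
  rewrite -mulrDr exprMn ii mulrACA -expr2 ii.
  by ring.
rewrite normrN normc_def /= expr0n addr0 sqrtr_sqr.
pose A i : R := complex.Re (al i) ^+ 2 + complex.Im (al i) ^+ 2.
pose B i : R := complex.Re (be i) ^+ 2 + complex.Im (be i) ^+ 2.
have -> : \sum_i ((`|al (ord_pred i)| ^+ 2 + `|be i| ^+ 2) ^+ 2 +
   2 * (`|be i| ^+ 2 * `|al (ordS i)| ^+ 2)) =
   (\sum_i ((A (ord_pred i) + B i) ^+ 2 + 2 * (B i * A (ordS i))))%:C.
  rewrite rmorph_sum; apply: eq_bigr => i _; rewrite /= !normc_sq.
  by rewrite realE.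
have A0 i : 0 <= A i by rewrite addr_ge0 ?sqr_ge0.
have B0 i : 0 <= B i by rewrite addr_ge0 ?sqr_ge0.
have {hal} hA i : A i <= `|p i| + e by have := hal i; rewrite normc_sq lecR.
have {hbe} hB i : B i <= `|p i| + e by have := hbe i; rewrite normc_sq lecR.
rewrite -rmorphB lecR; apply: (le_trans (lerB (lexx _) (ler_norm _))).
have -> : n%:R * (2 * L ^+ 2 + 12 * e) = \sum_(i < n) (2 * L ^+ 2 + 12 * e).
  by rewrite sumr_const card_ord mulr_natl.
rewrite -sumrB.
apply: ler_sum => i _.
have /ler_normlP [l1 l2] := hL i.
have /ler_normlP [] := hL (ord_pred i); rewrite ord_predK => l3 l4.
have := hA (ord_pred i); have := hB i; have := hA (ordS i).
have := p2 i; have := p2 (ordS i); have := p2 (ord_pred i).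
have := A0 (ord_pred i); have := B0 i; have := A0 (ordS i).
move: (A (ord_pred i)) (B i) (A (ordS i)) l1 l2 l3 l4.
move: (p i) (p (ordS i)) (p (ord_pred i)) => x y z a b c l1 l2 l3 l4 c0 b0 a0.
have x0 := normr_ge0 x; have y0 := normr_ge0 y; have z0 := normr_ge0 z.
move=> z2 y2 x2 hc hb ha.
have s1 : (a + b) ^+ 2 <= (`|z| + `|x|) ^+ 2 + 8 * e by nra.
have s2 : b * c <= `|x| * `|y| + 2 * e by nra.
(* For equal signs the left side is 0; for opposite signs [|z| + |x| = |x - z|]. *)
have s3 : (`|z| + `|x|) ^+ 2 - (z + x) ^+ 2 <= (x - z) ^+ 2.
  have h1 := sqr_ge0 (z + x); have h2 := sqr_ge0 (x - z).
  clear -h1 h2.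
  case: (ger0P z) => hz; case: (ger0P x) => hx; nra.
have s4 : 2 * (`|x| * `|y|) - 2 * (x * y) <= (y - x) ^+ 2.
  have h1 := sqr_ge0 (x + y); have h2 := sqr_ge0 (y - x).
  clear -h1 h2.
  case: (ger0P y) => hy; case: (ger0P x) => hx; nra.
have s5 : (x - z) ^+ 2 <= L ^+ 2 by nra.
have s6 : (y - x) ^+ 2 <= L ^+ 2 by nra.
lra.
Qed.

End Departure.

Section Cis.
Variable R : realType.
Implicit Types x y t : R.

Definition cis t : R[i] := cos t +i* sin t.

Lemma conj_conjc (z : R[i]) : Num.conj z = conjc z.
Proof. by []. Qed.

Lemma cisD x y : cis (x + y) = cis x * cis y.
Proof. by apply/eqP; rewrite eq_complex /= cosD sinD !eqxx /= addrC mulrC (mulrC (sin x)). Qed.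

Lemma cis0 : cis 0 = 1.
Proof. by rewrite /cis cos0 sin0. Qed.

Lemma cisN x : cis (- x) = (cis x)^*%R.
Proof. by rewrite conj_conjc /cis cosN sinN. Qed.

Lemma norm_cis x : `|cis x| = 1.
Proof. by rewrite normc_def /= cos2Dsin2 sqrtr1. Qed.

Lemma cis_natmul x k : cis (x *+ k) = cis x ^+ k.
Proof. by elim: k => [|k IH]; rewrite ?cis0 // mulrS cisD IH exprS. Qed.

Lemma cis2pi : cis (2 * pi) = 1.
Proof. by rewrite mulr_natl /cis cos2pi sin2pi. Qed.

Lemma cis_period x y (m : int) : y = x + 2 * pi * m%:~R -> cis y = cis x.
Proof.
move=> ->; rewrite cisD.
have cis_nat k : cis (2 * pi * k%:R) = 1 by rewrite mulr_natr cis_natmul cis2pi expr1n.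
case: m => k; first by rewrite cis_nat mulr1.
rewrite NegzE mulrNz mulrN cisN.
by rewrite -pmulrn cis_nat rmorph1 mulr1.
Qed.

Lemma cis_neq1 t : 0 < `|t| < 2 * pi -> cis t != 1.
Proof.
move=> ht; apply/negP => /eqP /(congr1 (@complex.Re R)) /= c1.
have hh : 0 < sin (`|t| / 2).
  apply: sin_gt0_pi; lra.
have : cos t = 1 - sin (`|t| / 2) ^+ 2 *+ 2.
  rewrite -cos_norm {1}(splitr `|t|) -mulr2n cos_mulr2n cos2sin2.
  by rewrite mulrnBl; ring.
rewrite c1 => h; have : sin (`|t| / 2) ^+ 2 = 0 by lra.
by move/eqP; rewrite sqrf_eq0 => /eqP h0; rewrite h0 ltxx in hh.
Qed.

Lemma cis_pihalf : cis (pi / 2) = 'i%C.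
Proof. by rewrite /cis cos_pihalf sin_pihalf. Qed.

End Cis.

(** * The Fresnel basis, in which the flag matrix has no diagonal *)

Section Fresnel.
Variables (R : realType) (n : nat).
Hypothesis n0 : (0 < n)%N.
Local Notation N := (n%:R : R).

Let N0 : N != 0. Proof. by rewrite pnatr_eq0 -lt0n. Qed.

(** The linear phase compensates the sign [(-1)^N] that the quadratic chirp acquires under
    [x -> x + N], so the entries are periodic in the indices for even and for odd [N]. *)
Definition fresnel (x y : R) : R[i] := cis (pi * (x + y) - pi * (x - y) ^+ 2 / N).

Lemma fresnelC x y : fresnel x y = fresnel y x.
Proof. by rewrite /fresnel (addrC x) -sqrrN opprB. Qed.

Lemma fresnel_period x y (m : int) : x - y = m%:~R -> fresnel (x + N) y = fresnel x y.
Proof.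
move=> hm; apply: (@cis_period _ _ _ (- m)).
have -> : x = y + m%:~R by rewrite -hm addrC subrK.
by rewrite mulrNz; field.
Qed.

Definition fresnel_mx : 'M[R[i]]_n := \matrix_(i, j) fresnel i%:R j%:R.

Lemma ordS_case (i : 'I_n) :
  ((ordS i)%:R = i%:R + 1 :> R) \/ ((ordS i)%:R + N = i%:R + 1 :> R).
Proof.
rewrite /=; have := ltn_ord i; rewrite leq_eqVlt => /orP[/eqP e|h].
  by right; rewrite e modnn add0r -{}[in LHS]e -natr1.
by left; rewrite modn_small // -natr1.
Qed.

Lemma ord_pred_case (i : 'I_n) :
  ((ord_pred i)%:R = i%:R - 1 :> R) \/ ((ord_pred i)%:R = i%:R - 1 + N :> R).
Proof.
by have := ordS_case (ord_pred i); rewrite ord_predK => -[h|h]; [left|right]; lra.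
Qed.

Lemma fresnel_ordS (i j : 'I_n) : fresnel (ordS i)%:R j%:R = fresnel (i%:R + 1) j%:R.
Proof.
have [->//|h] := ordS_case i; rewrite -h.
by rewrite (@fresnel_period _ _ ((ordS i)%:Z - j%:Z)) // rmorphB.
Qed.

Lemma fresnel_ord_pred (i j : 'I_n) :
  fresnel (ord_pred i)%:R j%:R = fresnel (i%:R - 1) j%:R.
Proof.
have [->//|->] := ord_pred_case i.
by rewrite (@fresnel_period _ _ (i%:Z - 1 - j%:Z)) // !rmorphB.
Qed.

(* With [T := diag (cis (2 * pi * j / n))], column [x] of [fresnel_mx] is an
   eigenvector of [S^-1 T] with eigenvalue [cis (angle x)]. *)
Definition angle (x : R) : R := pi * (2 * x + 1 - N) / N.

Lemma cis_angle_ord_pred (j : 'I_n) : cis (angle (ord_pred j)%:R) = cis (angle (j%:R - 1)).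
Proof.
have [->//|->] := ord_pred_case j.
by apply: (@cis_period _ _ _ 1); rewrite /angle; field.
Qed.

Definition hop_up (x : R) : R[i] := 2^-1 * ('i%C * cis (angle x) - 1).
Definition hop_down (x : R) : R[i] := 2^-1 * (1 - 'i%C * (cis (angle x))^*%R).

Lemma shift_cyc : shift_mx R n = cyc (fun=> 1) (fun=> 0).
Proof. by apply/matrixP => i j; rewrite !mxE mul0rn addr0. Qed.

Lemma invmx_shift : invmx (shift_mx R n) = cyc (fun=> 0) (fun=> 1).
Proof.
have : shift_mx R n *m cyc (fun=> 0) (fun=> 1) = 1%:M.
  apply/matrixP => i j; rewrite shift_cyc cyc_mull !mul0r addr0 mul1r !mxE.
  by rewrite mul0rn add0r ord_predK eq_sym.
move=> h; rewrite -[RHS]mul1mx -(mulVmx (shift_mx_unit R n)) -mulmxA h.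
by rewrite mulmx1.
Qed.

(** On a chirp, shifting [x] by one amounts to shifting the column index [y] by one; so does
    multiplication by [cis (2 pi x / N)] or its conjugate, up to the phase [cis (angle y)] or the
    conjugate of [cis (angle (y - 1))]. Hence the sine potential also turns into hopping, and the
    coefficients collected at [y + 1] and [y - 1] are [hop_up] and [hop_down]. *)
Lemma flag_fresnel : (- 2^-1 *: scottish_flag_mx R n) *m fresnel_mx =
  fresnel_mx *m cyc (fun j => hop_up j%:R) (fun j => hop_down j%:R).
Proof.
apply/matrixP => i j; rewrite cyc_mulr -scalemxAl [LHS]mxE.
set x : R := i%:R; set y : R := j%:R; set t : R := 2 * pi * x / N.
have -> : (scottish_flag_mx R n *m fresnel_mx) i j =
    fresnel (x - 1) y - fresnel (x + 1) y + 2 * (sin t)%:C * fresnel x y.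
  rewrite /scottish_flag_mx mulmxDl mulmxBl invmx_shift shift_cyc.
  rewrite mxE -scalemxAl mul_diag_mx [in LHS]mxE cyc_mull [X in _ + X + _ = _]mxE cyc_mull.
  by rewrite !mul0r !mul1r addr0 add0r !mxE fresnel_ordS fresnel_ord_pred mulrA.
rewrite !mxE !(fresnelC x) fresnel_ordS fresnel_ord_pred !(fresnelC _ x) -/y.
have -> : hop_down (ord_pred j)%:R = hop_down (y - 1).
  by rewrite /hop_down cis_angle_ord_pred.
have e1 : fresnel (x - 1) y = fresnel x (y + 1).
  by apply: (@cis_period _ _ _ (-1)); rewrite mulrNz mulr1z; field.
have e2 : fresnel (x + 1) y = fresnel x (y - 1).
  by apply: (@cis_period _ _ _ 1); rewrite mulr1z; field.
have e3 : cis (angle y) * fresnel x (y + 1) = cis t * fresnel x y.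
  by rewrite -!cisD; congr cis; rewrite /angle /t; field.
have e4 : (cis (angle (y - 1)))^*%R * fresnel x (y - 1) = (cis t)^*%R * fresnel x y.
  by rewrite -!cisN -!cisD; congr cis; rewrite /angle /t; field.
have e5 : (sin t)%:C = 2^-1 * 'i%C * ((cis t)^*%R - cis t).
  have ii := sqr_i R.
  have -> : cis t = (cos t)%:C + 'i%C * (sin t)%:C by rewrite [LHS]complexE.
  rewrite rmorphD rmorphM /= !conj_conjc !conjc_real.
  have -> : conjc 'i%C = - 'i%C :> R[i] by apply/eqP; rewrite eq_complex /= oppr0 !eqxx.
  have -> : 2^-1 * 'i%C * ((cos t)%:C + - 'i%C * (sin t)%:C - ((cos t)%:C + 'i%C * (sin t)%:C))
     = - ('i%C ^+ 2) * (sin t)%:C by field.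
  by rewrite ii opprK mul1r.
rewrite e1 e2 e5 /hop_up /hop_down.
have -> : fresnel x (y + 1) * (2^-1 * ('i%C * cis (angle y) - 1)) +
  fresnel x (y - 1) * (2^-1 * (1 - 'i%C * (cis (angle (y - 1)))^*%R)) =
  2^-1 * 'i%C * (cis (angle y) * fresnel x (y + 1)) - 2^-1 * fresnel x (y + 1) +
  (2^-1 * fresnel x (y - 1) - 2^-1 * 'i%C * ((cis (angle (y - 1)))^*%R * fresnel x (y - 1))).
  by ring.
by rewrite e3 e4; field.
Qed.

(** In the inner product of two columns the terms quadratic in the row index cancel. A geometric sum
    over an [n]-th root of unity remains, which vanishes for distinct columns. *)
Lemma fresnel_unit : fresnel_mx \in unitmx.
Proof.
have h : fresnel_mx^t* *m fresnel_mx = (n%:R : R[i])%:M.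
  apply/matrixP => j k; rewrite !mxE.
  pose w : R := 2 * pi * (k%:R - j%:R) / N.
  pose c : R := pi * (k%:R - j%:R) - pi * (k%:R ^+ 2 - j%:R ^+ 2) / N.
  transitivity (\sum_(i < n) cis c * cis w ^+ i).
    apply: eq_bigr => i _; rewrite !mxE -cisN -cisD -cis_natmul -cisD.
    by congr cis; rewrite /c /w -mulr_natr; field.
  rewrite -mulr_sumr; have [e|jk] := eqVneq j k.
    rewrite /c /w e !subrr !mulr0 !mul0r subrr cis0 mul1r mulr1n.
    by under eq_bigr do rewrite expr1n; rewrite sumr_const card_ord.
  have wN : cis w ^+ n = 1.
    rewrite -cis_natmul -(cis0 R); apply: (@cis_period _ _ _ (k%:Z - j%:Z)).
    by rewrite rmorphB /= /w -mulr_natr; field.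
  have w1 : cis w != 1.
    have k_lt : k%:R < N by rewrite ltr_nat.
    have j_lt : j%:R < N by rewrite ltr_nat.
    have k_ge := ler0n R k; have j_ge := ler0n R j.
    have d0 : `|k%:R - j%:R : R| > 0.
      by rewrite normr_gt0 subr_eq0 eqr_nat eq_sym.
    have dN : `|k%:R - j%:R : R| < N by rewrite ltr_norml; apply/andP; split; lra.
    have N_gt0 : 0 < N by rewrite ltr0n.
    have pi0 := pi_gt0 R.
    apply: cis_neq1; rewrite /w !normrM normfV (gtr0_norm N_gt0) (gtr0_norm pi0).
    rewrite ger0_norm //; apply/andP; split.
      by rewrite divr_gt0 // !mulr_gt0.
    by rewrite ltr_pdivrMr // ltr_pM2l ?mulr_gt0.
  have : (cis w - 1) * (\sum_(i < n) cis w ^+ i) = 0.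
    by rewrite -subrX1 wN subrr.
  move/eqP; rewrite mulf_eq0 subr_eq0 (negbTE w1) /= => /eqP ->.
  by rewrite mulr0 mulr0n.
have nC : (n%:R : R[i]) != 0 by rewrite pnatr_eq0 -lt0n.
have /mulmx1_unit [] // : (n%:R^-1 *: fresnel_mx^t*) *m fresnel_mx = 1%:M.
by rewrite -scalemxAl h scale_scalar_mx mulVf.
Qed.

End Fresnel.

(** * A square root of the product of the two hopping amplitudes *)

Section Symbol.
Variable R : realType.
Implicit Types t : R.

(* [Num.sqrt] vanishes on negative numbers, so these are the square roots of
   the positive and negative parts of [cos t / 2]. *)
Definition arc_pos t : R := Num.sqrt (cos t / 2).
Definition arc_neg t : R := Num.sqrt (- cos t / 2).

(** The branch has argument [pi / 4] where the cosine is positive and [3 pi / 4] where it is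
    negative, which are the directions of the two lines of the limit measure; it passes through 0 in
    between. One root per angle suffices although the measure charges both halves of each line:
    closed walks have even length, so odd moments vanish anyway. *)
Definition symbol t : R[i] :=
  cis (pi / 4) * (arc_pos t)%:C + cis (3 * pi / 4) * (arc_neg t)%:C.

Lemma arc_pos_neg t : arc_pos t * arc_neg t = 0.
Proof.
rewrite /arc_pos /arc_neg; have [h|h] := lerP 0 (cos t).
  by rewrite (@ler0_sqrtr _ (- cos t / 2)) ?mulr0 //; lra.
by rewrite (@ler0_sqrtr _ (cos t / 2)) ?mul0r //; lra.
Qed.

Lemma arc_sqB t : arc_pos t ^+ 2 - arc_neg t ^+ 2 = cos t / 2.
Proof.
rewrite /arc_pos /arc_neg; have [h|h] := lerP 0 (cos t).
  by rewrite (@ler0_sqrtr _ (- cos t / 2)) ?expr0n ?subr0 ?sqr_sqrtr //; lra.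
by rewrite (@ler0_sqrtr _ (cos t / 2)) ?expr0n ?sub0r ?sqr_sqrtr //; lra.
Qed.

Lemma cis_piquarter_sq : cis (pi / 4) ^+ 2 = 'i%C :> R[i].
Proof. by rewrite -cis_natmul -cis_pihalf; congr cis; rewrite -mulr_natr; field. Qed.

Lemma cis_3piquarter_sq : cis (3 * pi / 4) ^+ 2 = - 'i%C :> R[i].
Proof.
rewrite -cis_natmul; have -> : (3 * pi / 4 *+ 2 : R) = pi / 2 + pi by rewrite -mulr_natr; field.
rewrite cisD cis_pihalf /cis cospi sinpi.
by rewrite (_ : -1 +i* 0 = -1) ?mulrN1 //; apply/eqP; rewrite eq_complex /= oppr0 !eqxx.
Qed.

Lemma symbol_sq t : symbol t ^+ 2 = 'i%C * (cos t / 2)%:C.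
Proof.
rewrite -arc_sqB /symbol sqrrD !exprMn cis_piquarter_sq cis_3piquarter_sq.
rewrite mulrACA -(rmorphM (real_complex R)) /= arc_pos_neg mulr0 mul0rn addr0.
by rewrite rmorphB !rmorphXn /=; ring.
Qed.

Lemma norm_symbol_sq t : `|symbol t| ^+ 2 = (`|cos t / 2|)%:C.
Proof.
have -> : `|symbol t| ^+ 2 = `|symbol t ^+ 2| by rewrite normrX.
rewrite symbol_sq normrM; have -> : `|'i%C| = 1 :> R[i].
  by rewrite -cis_pihalf norm_cis.
by rewrite mul1r normc_def /= expr0n addr0 sqrtr_sqr.
Qed.

Lemma symbol_eq0 t : (symbol t == 0) = (cos t == 0).
Proof.
rewrite -normr_eq0 -sqrf_eq0 norm_symbol_sq -(rmorph0 (real_complex R)).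
by rewrite (inj_eq (@complexI R)) normr_eq0 mulf_eq0 invr_eq0 pnatr_eq0 orbF.
Qed.

Lemma symbolN t : symbol (- t) = symbol t.
Proof. by rewrite /symbol /arc_pos /arc_neg cosN. Qed.

(** At each [t] at least one of the two arcs vanishes, hence no mixed terms. At exponent 0 the right
    side would count both arcs. *)
Lemma symbol_pow t a b : (0 < a + b)%N ->
  symbol t ^+ a * (symbol t)^*%R ^+ b =
  cis (pi / 4) ^+ a * (cis (pi / 4))^*%R ^+ b * (arc_pos t ^+ (a + b))%:C +
  cis (3 * pi / 4) ^+ a * (cis (3 * pi / 4))^*%R ^+ b * (arc_neg t ^+ (a + b))%:C.
Proof.
move=> ab; rewrite !rmorphXn /= /symbol.
have : (arc_pos t == 0) || (arc_neg t == 0) by rewrite -mulf_eq0 arc_pos_neg.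
have conjR (x : R) : (x%:C)^*%R = x%:C by rewrite conj_conjc conjc_real.
case/orP => /eqP ->; rewrite (rmorph0 (real_complex R)) expr0n eqn0Ngt ab mulr0n !mulr0 ?addr0 ?add0r.
  by rewrite rmorphM /= conjR !exprMn mulrACA exprD.
by rewrite rmorphM /= conjR !exprMn mulrACA exprD.
Qed.

End Symbol.

(** * The gauge around the cycle *)

Section Gauge.
Variables (R : realType) (n : nat).
Implicit Type x : R.
Hypothesis n1 : (1 < n)%N.
Local Notation N := (n%:R : R).
Let n0 : (0 < n)%N. Proof. by lia. Qed.
Let N0 : N != 0. Proof. by rewrite pnatr_eq0 -lt0n. Qed.
Local Notation angle := (angle n).
Local Notation hop_up := (hop_up n).
Local Notation hop_down := (hop_down n).

Lemma hop_up_down (x : R) : hop_up x * hop_down x = 'i%C * (cos (angle x) / 2)%:C.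
Proof.
rewrite /hop_up /hop_down; set t := angle x.
have ii := sqr_i R; have cc : cis t * (cis t)^*%R = 1 by rewrite -cisN -cisD subrr cis0.
have -> : (cos t / 2)%:C = 4^-1 * (cis t + (cis t)^*%R).
  rewrite conj_conjc addcJ rmorphM /= fmorphV rmorph_nat mulrA mulrC; congr (_ * _).
  by rewrite -[2]/(2%:R); field.
have -> : 2^-1 * ('i%C * cis t - 1) * (2^-1 * (1 - 'i%C * (cis t)^*%R)) =
  4^-1 * ('i%C * (cis t + (cis t)^*%R) - ('i%C ^+ 2 * (cis t * (cis t)^*%R) + 1)) by field.
by rewrite ii cc mulN1r addNr subr0 mulrCA.
Qed.

Lemma hop_upDdown (x : R) : hop_up x + hop_down x = - (sin (angle x))%:C.
Proof.
rewrite /hop_up /hop_down; set t := angle x.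
have ii := sqr_i R.
have -> : 2^-1 * ('i%C * cis t - 1) + 2^-1 * (1 - 'i%C * (cis t)^*%R) =
  - 2^-1 * 'i%C * ((cis t)^*%R - cis t) by field.
have -> : (cis t)^*%R - cis t = - (2 * (sin t)%:C * 'i%C) by rewrite -opprB conj_conjc subcJ.
have -> : - 2^-1 * 'i%C * - (2 * (sin t)%:C * 'i%C) = 'i%C ^+ 2 * (sin t)%:C by field.
by rewrite ii mulN1r.
Qed.

Lemma angle_rev (j : 'I_n) : angle (rev_ord j)%:R = - angle j%:R :> R.
Proof.
by rewrite /angle /= natrB // -natr1; field.
Qed.

Lemma hop_up_rev (j : 'I_n) : hop_up (rev_ord j)%:R = - hop_down j%:R :> R[i].
Proof. by rewrite /hop_up /hop_down angle_rev cisN; ring. Qed.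

(* On an edge with vanishing symbol exactly one of the two hopping amplitudes
   is nonzero; it is scaled down to size [1/n]. *)
Definition ratio (x : R) : R[i] :=
  if symbol (angle x) == 0 then (if hop_up x == 0 then N^-1%:C else N%:C)
  else hop_up x / symbol (angle x).

Lemma hop_neq0 x : symbol (angle x) != 0 -> (hop_up x != 0) && (hop_down x != 0).
Proof. by rewrite -sqrf_eq0 symbol_sq -hop_up_down mulf_eq0 negb_or. Qed.

(** The product of the amplitudes is a multiple of the cosine and their sum is minus the sine, so
    they cannot vanish together. *)
Lemma hop_eq0 x : symbol (angle x) = 0 -> (hop_down x == 0) = (hop_up x != 0).
Proof.
move=> /eqP s0; have := s0; rewrite -sqrf_eq0 symbol_sq -hop_up_down mulf_eq0.
have [u0 _ /=|//] := eqVneq (hop_up x) 0.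
apply/negbTE; apply/negP => /eqP d0.
have := hop_upDdown x; rewrite u0 d0 addr0 => /eqP; rewrite eq_sym oppr_eq0.
rewrite -(rmorph0 (real_complex R)) (inj_eq (@complexI R)) => /eqP s.
move: s0; rewrite symbol_eq0 => /eqP c.
have := cos2Dsin2 (angle x); rewrite s c !expr0n addr0 => /eqP.
by rewrite eq_sym oner_eq0.
Qed.

Lemma ratio_neq0 x : ratio x != 0.
Proof.
have NC : N%:C != 0 by rewrite -(rmorph0 (real_complex R)) (inj_eq (@complexI R)).
rewrite /ratio; have [_|s0] := eqVneq (symbol _) 0.
  by case: ifP => _ //; rewrite fmorphV invr_eq0.
by case/andP: (hop_neq0 s0) => u0 _; rewrite mulf_neq0 ?invr_eq0.
Qed.

Lemma ratio_rev (j : 'I_n) : `|ratio j%:R| * `|ratio (rev_ord j)%:R| = 1 :> R[i].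
Proof.
have NC : N%:C != 0 by rewrite -(rmorph0 (real_complex R)) (inj_eq (@complexI R)).
rewrite -normrM /ratio angle_rev symbolN; set s := symbol _.
have [s0|s0] := eqVneq s 0.
  rewrite hop_up_rev oppr_eq0 hop_eq0 //.
  case: (hop_up _ == 0) => /=; rewrite -rmorphM ?mulVf ?mulfV //= ?rmorph1 ?normr1 //.
rewrite hop_up_rev mulrACA mulrN hop_up_down -symbol_sq -/s -invfM -expr2.
by rewrite mulNr mulfV ?sqrf_eq0 // normrN normr1.
Qed.

Definition gauge (k : nat) : R[i] := \prod_(i < k) ratio i%:R.

Lemma gauge_neq0 k : gauge k != 0.
Proof. by apply/prodf_neq0 => i _; exact: ratio_neq0. Qed.

(** [gauge n] is the holonomy, the obstruction to a gauge on the cycle. Reversing the order of the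
    edges negates the angle and exchanges [hop_up] and [hop_down] up to sign, so it pairs ratios of
    reciprocal moduli and only a phase is left. At zeros of the symbol this is why [ratio] takes the
    values [N] and [N^-1]. *)
Lemma norm_gauge_n : `|gauge n| = 1.
Proof.
have : `|gauge n| ^+ 2 = 1.
  rewrite /gauge normr_prod expr2 {2}(reindex_inj rev_ord_inj) -big_split big1 //= => i _.
  exact: ratio_rev.
by move=> /eqP; rewrite sqrp_eq1 // => /eqP.
Qed.

Definition gauge_up (j : 'I_n) := hop_up j%:R * gauge j / gauge (ordS j).
Definition gauge_down (j : 'I_n) := hop_down j%:R * gauge (ordS j) / gauge j.

Let up x := hop_up x / ratio x.
Let down x := hop_down x * ratio x.

(** Only the last edge wraps around: there [gauge 0 = 1] stands in for [gauge n]. *)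
Lemma gauge_case (j : 'I_n) :
  (gauge_up j = up j%:R /\ gauge_down j = down j%:R) \/
  [/\ j = n.-1 :> nat, gauge_up j = up j%:R * gauge n & gauge_down j = down j%:R / gauge n].
Proof.
rewrite /gauge_up /gauge_down /up /down /=.
have gS : gauge j.+1 = ratio j%:R * gauge j by rewrite /gauge big_ord_recr mulrC.
have g0 := gauge_neq0 j; have r0 := ratio_neq0 j%:R; have gn := gauge_neq0 n.
have := ltn_ord j; rewrite leq_eqVlt => /orP[/eqP e|h].
  have {}gS : gauge n = ratio j%:R * gauge j by rewrite -gS e.
  right; rewrite e modnn gS [gauge 0]big_ord0; split; first by lia.
    by field.
  by field; rewrite g0 r0.
left; rewrite modn_small // gS; split; by field; rewrite ?g0 ?r0.
Qed.

Lemma gauge_prod j : gauge_up j * gauge_down j = 'i%C * (cos (angle j%:R) / 2)%:C.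
Proof.
rewrite -hop_up_down /gauge_up /gauge_down.
have g0 := gauge_neq0 j; have g1 := gauge_neq0 (ordS j).
by field; rewrite g0 g1.
Qed.

Lemma normNV : `|N^-1%:C| = N^-1%:C :> R[i].
Proof. by rewrite ger0_norm // ler0c invr_ge0. Qed.

Lemma hop_up_le1 x : `|hop_up x| <= 1.
Proof.
rewrite /hop_up normrM; have -> : `|2^-1| = 2^-1 :> R[i] by rewrite ger0_norm // invr_ge0.
rewrite mulrC ler_pdivrMr // mul1r; apply: (le_trans (ler_normB _ _)).
by rewrite normrM -cis_pihalf !norm_cis normr1 mulr1; exact: lexx.
Qed.

Lemma hop_down_le1 x : `|hop_down x| <= 1.
Proof.
rewrite /hop_down normrM; have -> : `|2^-1| = 2^-1 :> R[i] by rewrite ger0_norm // invr_ge0.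
rewrite mulrC ler_pdivrMr // mul1r; apply: (le_trans (ler_normB _ _)).
by rewrite normrM -cisN -cis_pihalf !norm_cis normr1 mulr1; exact: lexx.
Qed.

(** Away from zeros of the symbol the gauge is exact. At a zero the amplitude either vanishes or,
    having modulus at most 1, is divided by [n]. *)
Lemma up_case x : up x = symbol (angle x) \/
  symbol (angle x) = 0 /\ `|up x| <= N^-1%:C.
Proof.
rewrite /up /ratio; have [s0|s0] := eqVneq (symbol _) 0; last first.
  left; case/andP: (hop_neq0 s0) => u0 d0.
  by field; rewrite s0.
right; split=> //; have [->|_] := eqVneq (hop_up x) 0.
  by rewrite mul0r normr0 ler0c invr_ge0.
by rewrite -fmorphV /= normrM normNV ler_piMl ?hop_up_le1 // ler0c invr_ge0.
Qed.

Lemma down_case x : down x = symbol (angle x) \/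
  symbol (angle x) = 0 /\ `|down x| <= N^-1%:C.
Proof.
rewrite /down /ratio; have [s0|s0] := eqVneq (symbol _) 0; last first.
  left; apply: (mulIf s0); rewrite mulrA divfK // mulrC -expr2 symbol_sq.
  by rewrite hop_up_down.
right; split=> //; have := hop_eq0 s0; have [_ _|_ /eqP ->] := eqVneq (hop_up x) 0.
  by rewrite normrM normNV ler_piMl ?hop_down_le1 // ler0c invr_ge0.
by rewrite mul0r normr0 ler0c invr_ge0.
Qed.

End Gauge.

Lemma char_poly_similar (F : fieldType) n (A B P : 'M[F]_n) :
  P \in unitmx -> A *m P = P *m B -> char_poly A = char_poly B.
Proof.
move=> uP AP; rewrite /char_poly /char_poly_mx.
have dP : \det (map_mx polyC P) != 0.
  by rewrite det_map_mx polyC_eq0 -unitfE -unitmxE.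
apply: (mulIf dP); rewrite [RHS]mulrC -!det_mulmx mulmxBl mulmxBr.
by rewrite -!map_mxM AP scalar_mxC.
Qed.

Lemma fro_spec_le (C : numClosedFieldType) n (M : 'M[C]_n) (k z : C) :
  (forall Y : 'M[C]_n, fro (Y *m M) <= k * fro Y) ->
  root (char_poly M) z -> `|z| ^+ 2 <= k.
Proof.
move=> hM; rewrite -eigenvalue_root_char => /eigenvalueP [v vM v0].
have [i vi] : exists i, v 0 i != 0.
  by apply/existsP; apply: contraNT v0 => /existsPn h; apply/eqP/rowP => i; rewrite mxE; apply/eqP/negbNE/h.
(* Every row of [Y] is the eigenvector [v], which brings it into the form the hypothesis [hM]
   requires. *)
pose Y : 'M[C]_n := const_mx 1 *m v.
have YM : Y *m M = z *: Y by rewrite /Y -mulmxA vM scalemxAr.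
have froZ : fro (z *: Y) = `|z| ^+ 2 * fro Y.
  rewrite /fro mulr_sumr; apply: eq_bigr => l _; rewrite mulr_sumr.
  by apply: eq_bigr => m _; rewrite mxE normrM exprMn.
have Y0 : 0 < fro Y.
  rewrite /fro (bigD1 i) //= (bigD1 i) //= -addrA ltr_pwDl //.
    rewrite exprn_gt0 // normr_gt0 mxE big_ord_recl big_ord0 addr0 !mxE mul1r.
    by rewrite (_ : ord0 = 0).
  rewrite addr_ge0 //; last by apply: sumr_ge0 => l _; apply: sumr_ge0 => m _; rewrite exprn_ge0.
  by apply: sumr_ge0 => l _; rewrite exprn_ge0.
by have := hM Y; rewrite YM froZ ler_pM2r.
Qed.

Lemma cos_lipschitz (R : realType) (x y : R) : `|cos x - cos y| <= `|x - y|.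
Proof.
wlog xy : x y / x < y => [h|].
  have [xy|xy|->] := ltgtP x y; [exact: h| |by rewrite !subrr normr0].
  by rewrite distrC (distrC x); exact: h.
have dcos z : z \in `]x, y[%R -> is_derive z 1 cos (- sin z) by move=> _; exact: is_derive_cos.
have ccos : {within `[x, y]%classic, continuous (@cos R)}.
  by apply: continuous_subspaceT; exact: continuous_cos.
have [c _] := MVT xy dcos ccos.
rewrite distrC => ->; rewrite normrM normrN (distrC x) ler_piMl //.
exact: sin_max.
Qed.

(** * Bounded variation of the symbol along the cycle *)

Section Variation.
Variable R : realType.

Lemma even_variation (u : R -> R) (t : nat -> R) (m : nat) (b : R) :
  (forall x y, 0 <= x -> x <= y -> y <= pi -> u y <= u x) ->
  (forall x, u (- x) = u x) -> (forall x, `|u x - u 0| <= b) ->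
  (forall k, (k < m)%N -> t k <= t k.+1) ->
  (forall k, (k <= m)%N -> - pi <= t k <= pi) ->
  \sum_(k < m) `|u (t k.+1) - u (t k)| <= 2 * b.
Proof.
move=> um ue ub tm tpi.
(* [F] is the signed variation of [u] counted from 0. It is nondecreasing on [[-pi, pi]], so the sum
   telescopes. *)
pose F x := if 0 <= x then u 0 - u x else u x - u 0.
have hF x y : x <= y -> - pi <= x -> y <= pi -> `|u y - u x| <= F y - F x.
  move=> xy px py; rewrite /F; case: ifPn => hy; case: ifPn => hx.
  - have := um x y hx xy py => h; rewrite ler0_norm; lra.
  - rewrite -ltNge in hx.
    have h1 : u y <= u 0 by apply: um.
    have h2 : u x <= u 0 by rewrite -ue; apply: um; lra.
    by rewrite ler_norml; lra.
  - lra.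
  - rewrite -!ltNge in hx hy.
    have h : u (- x) <= u (- y) by apply: um; lra.
    by rewrite !ue in h; rewrite ger0_norm; lra.
apply: (@le_trans _ _ (\sum_(k < m) (F (t k.+1) - F (t k)))).
  apply: ler_sum => k _; apply: hF.
  - exact: tm.
  - by have /andP[] := tpi k (ltnW (ltn_ord k)).
  - by have /andP[] := tpi k.+1 (ltn_ord k).
have -> : \sum_(k < m) (F (t k.+1) - F (t k)) = F (t m) - F (t 0%N).
  by rewrite -(big_mkord xpredT (fun k => F (t k.+1) - F (t k))) telescope_sumr.
have hb x : `|F x| <= b by rewrite /F; case: ifP => _ //; rewrite distrC.
have := hb (t m); have := hb (t 0%N); rewrite !ler_norml; lra.
Qed.

End Variation.

Section SymbolVariation.
Variable R : realType.
Implicit Types x y : R.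

Lemma arc_pos_bound x : 0 <= arc_pos x <= 1.
Proof.
rewrite /arc_pos sqrtr_ge0 -[leRHS]sqrtr1 ler_wsqrtr //.
by have := cos_le1 x; lra.
Qed.

Lemma arc_neg_bound x : 0 <= arc_neg x <= 1.
Proof.
rewrite /arc_neg sqrtr_ge0 -[leRHS]sqrtr1 ler_wsqrtr //.
by have := cos_geN1 x; lra.
Qed.

Lemma cos_decr x y : 0 <= x -> x <= y -> y <= pi -> cos y <= cos x.
Proof.
move=> x0 xy yp; move: (xy); rewrite le_eqVlt => /predU1P[->//|h].
by apply: ltW; rewrite ltr_cos // in_itv /=; lra.
Qed.

Lemma normc_real x : `|x%:C| = `|x|%:C :> R[i].
Proof. by rewrite normc_def /= expr0n /= addr0 sqrtr_sqr. Qed.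

Lemma norm_symbolB x y : `|symbol x - symbol y| <=
  (`|arc_pos x - arc_pos y| + `|arc_neg x - arc_neg y|)%:C.
Proof.
rewrite /symbol; set A := cis _; set B := cis _.
have -> : A * (arc_pos x)%:C + B * (arc_neg x)%:C - (A * (arc_pos y)%:C + B * (arc_neg y)%:C)
  = A * (arc_pos x - arc_pos y)%:C + B * (arc_neg x - arc_neg y)%:C.
  by rewrite !rmorphB; ring.
apply: (le_trans (ler_normD _ _)); rewrite !normrM !norm_cis !mul1r.
by rewrite !normc_real [leRHS]rmorphD.
Qed.

End SymbolVariation.

Section Spectrum.
Variables (R : realType) (n : nat).
Hypothesis n5 : (4 < n)%N.
Local Notation N := (n%:R : R).
Let n0 : (0 < n)%N. Proof. by lia. Qed.
Let n1 : (1 < n)%N. Proof. by lia. Qed.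
Let N0 : N != 0. Proof. by rewrite pnatr_eq0 -lt0n. Qed.
Let N_gt0 : 0 < N. Proof. by rewrite ltr0n. Qed.

Lemma symbol_variation :
  \sum_(i < n) `|symbol (angle n (ordS i)%:R) - symbol (angle n i%:R)| <= (4 : R)%:C.
Proof.
pose t (k : nat) : R := angle n k%:R.
have tm k : t k <= t k.+1.
  rewrite /t /angle -natr1 ler_pM2r ?invr_gt0 // ler_pM2l ?pi_gt0 //; lra.
have tpi k : (k <= n.-1)%N -> - pi <= t k <= pi.
  move=> kn; have kN : k%:R + 1 <= N by rewrite natr1 ler_nat; lia.
  have k0 := ler0n R k; rewrite /t /angle ler_pdivlMr // ler_pdivrMr //.
  have pi0 := pi_gt0 R; rewrite mulNr -mulrN; apply/andP; split; rewrite ler_pM2l //; lra.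
have vp : \sum_(k < n.-1) `|arc_pos (t k.+1) - arc_pos (t k)| <= 2 * 1.
  apply: even_variation => //.
  - move=> x y x0 xy yp; rewrite /arc_pos ler_wsqrtr // ler_pM2r ?invr_gt0 //.
    exact: cos_decr.
  - by move=> x; rewrite /arc_pos cosN.
  - by move=> x; have := arc_pos_bound x; have := arc_pos_bound (0 : R); rewrite ler_norml; lra.
have vn : \sum_(k < n.-1) `|arc_neg (t k.+1) - arc_neg (t k)| <= 2 * 1.
  have := @even_variation R (fun x => - arc_neg x) t n.-1 1.
  under eq_bigr do rewrite -opprD normrN.
  apply => //.
  - move=> x y x0 xy yp; rewrite lerN2 /arc_neg ler_wsqrtr // ler_pM2r ?invr_gt0 // lerN2.
    exact: cos_decr.
  - by move=> x; rewrite /arc_neg cosN.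
  - by move=> x; have := arc_neg_bound x; have := arc_neg_bound (0 : R); rewrite ler_norml; lra.
have [m nm] : exists m, n = m.+1 by exists n.-1; lia.
apply: (@le_trans _ _ (\sum_(k < n.-1) (`|arc_pos (t k.+1) - arc_pos (t k)| + `|arc_neg (t k.+1) - arc_neg (t k)|))%:C).
  pose F (k : nat) : R[i] := `|symbol (t (k.+1 %% n)%N) - symbol (t k)|.
  rewrite (_ : \sum_(i < n) _ = \sum_(k < n) F k) //.
  have -> : \sum_(k < n) F k = \sum_(k < n.-1) F k + F n.-1.
    by rewrite nm big_ord_recr.
  rewrite [F n.-1]/F prednK // modnn.
  (* The first and last angles are opposite and the symbol is even, so the closing edge costs
     nothing. *)
  have -> : t n.-1 = - t 0%N.
    by rewrite /t /angle -subn1 natrB //; field.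
  rewrite symbolN subrr normr0 addr0 rmorph_sum; apply: ler_sum => k _.
  rewrite /F modn_small; first exact: norm_symbolB.
  by have := ltn_ord k; lia.
by rewrite lecR big_split /=; lra.
Qed.

Local Notation up := (gauge_up R (n := n)).
Local Notation down := (gauge_down R (n := n)).

Lemma flag_char_poly :
  char_poly (- 2^-1 *: scottish_flag_mx R n) = char_poly (cyc up down).
Proof.
pose G : 'M[R[i]]_n := diag_mx (\row_i gauge R n i).
have uG : G \in unitmx.
  rewrite unitmxE det_diag unitfE; apply/prodf_neq0 => i _.
  by rewrite mxE gauge_neq0.
apply: (@char_poly_similar _ _ _ _ (fresnel_mx R n *m G)).
  by rewrite unitmx_mul fresnel_unit.
rewrite mulmxA flag_fresnel // -!mulmxA; congr (_ *m _).
apply/matrixP => i j; rewrite mul_mx_diag mul_diag_mx !mxE.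
rewrite mulrDl mulrDr !mulrnAl !mulrnAr; congr (_ + _).
  case: eqP => [->|_]; rewrite ?mulr0n ?mulr1n // /gauge_up.
  by rewrite mulrCA divff ?gauge_neq0 // mulr1.
case: eqP => [->|_]; rewrite ?mulr0n ?mulr1n // /gauge_down.
by rewrite mulrCA divff ?gauge_neq0 // mulr1.
Qed.

Let p (i : 'I_n) : R := cos (angle n i%:R) / 2.

Lemma cos_half_le (x : R) : `|cos x / 2| <= 2^-1.
Proof. by rewrite normrM [`|2^-1|]ger0_norm // ler_piMl // cos_max. Qed.

Lemma ordS_cos i : `|p (ordS i) - p i| <= pi / N.
Proof.
have -> : p (ordS i) = cos (angle n (i%:R + 1)) / 2.
  rewrite /p; congr (_ / _); have [->//|h] := ordS_case R i.
  by rewrite -h -(cosD2pi (angle n _)) -mulr_natr; congr cos; rewrite /angle; field.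
rewrite /p -mulrBl normrM [`|2^-1|]ger0_norm // ler_pdivrMr //.
apply: (le_trans (cos_lipschitz _ _)).
have -> : angle n (i%:R + 1) - angle n i%:R = pi / N * 2 :> R by rewrite /angle; field.
by rewrite ger0_norm // !mulr_ge0 ?invr_ge0 ?pi_ge0.
Qed.

(** The holonomy is a phase: on the last edge it leaves the moduli alone and displaces an amplitude
    by at most [2] beyond the usual [N^-1]. The term [N^-1 ^+ 2] comes from the zeros of the
    symbol. *)
Lemma gauge_bounds i :
  [/\ `|up i| ^+ 2 <= (`|p i| + N^-1 ^+ 2)%:C, `|down i| ^+ 2 <= (`|p i| + N^-1 ^+ 2)%:C,
     `|up i - symbol (angle n i%:R)| <= (N^-1 + 2 *+ (i == n.-1 :> nat))%:C &
     `|down i - symbol (angle n i%:R)| <= (N^-1 + 2 *+ (i == n.-1 :> nat))%:C].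
Proof.
set s := symbol (angle n i%:R).
have sq_bound (z : R[i]) : z = s \/ s = 0 /\ `|z| <= N^-1%:C ->
    `|z| ^+ 2 <= (`|p i| + N^-1 ^+ 2)%:C.
  move=> [->|[_ h]]; first by rewrite norm_symbol_sq lecR lerDl sqr_ge0.
  apply: (@le_trans _ _ (N^-1 ^+ 2)%:C); last by rewrite lecR lerDr.
  by rewrite rmorphXn lerXn2r // nnegrE // ler0c invr_ge0.
have le1 (z : R[i]) : z = s \/ s = 0 /\ `|z| <= N^-1%:C ->
    `|z - s| <= N^-1%:C.
  move=> [->|[-> h]]; last by rewrite subr0.
  by rewrite subrr normr0 ler0c invr_ge0.
have hu := up_case n (i%:R : R); have hd := down_case n (i%:R : R).
have g1 := norm_gauge_n R n1.
have [[-> ->]|[e -> ->]] := gauge_case R n1 i.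
  have mon : N^-1%:C <= (N^-1 + 2 *+ (i == n.-1 :> nat))%:C by rewrite lecR lerDl mulrn_wge0.
  split; [exact: sq_bound|exact: sq_bound| |].
    by apply: le_trans mon; apply: le1.
  by apply: le_trans mon; apply: le1.
have N1 : N^-1 <= 1 by rewrite invf_le1 // ler1n.
have s1 : `|s| <= 1.
  rewrite -(@ler_pXn2r _ 2) ?nnegrE // norm_symbol_sq expr1n lecR.
  by apply: (le_trans (cos_half_le _)); lra.
have far (z h : R[i]) : z = s \/ s = 0 /\ `|z| <= N^-1%:C ->
    `|h| = 1 -> `|z * h - s| <= (N^-1 + 2)%:C.
  move=> hz h1; apply: (le_trans (ler_normB _ _)); rewrite normrM h1 mulr1.
  have z1 : `|z| <= 1.
    by case: hz => [->//|[_ hz]]; apply: (le_trans hz); rewrite lecR.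
  apply: (le_trans (lerD z1 s1)); rewrite -[1 + 1 : R[i]](rmorph_nat (real_complex R) 2) lecR.
  by rewrite lerDr invr_ge0.
have gV : `|(gauge R n n)^-1| = 1 by rewrite normfV g1 invr1.
have -> : (i == n.-1 :> nat) = true by apply/eqP.
rewrite mulr1n [`|_ * gauge R n n|]normrM g1 [`|_ / gauge R n n|]normrM gV !mulr1.
split.
- exact: sq_bound.
- exact: sq_bound.
- exact: far.
- exact: far.
Qed.

End Spectrum.

Section SpectralMoments.
Variable R : realType.

Lemma hop_err_ge0 (C : numClosedFieldType) k : 0 <= hop_err C k.
Proof.
by elim: k => //= k IH; rewrite addr_ge0 // !mulr_ge0 ?exprn_ge0 ?addr_ge0 ?mulr_ge0.
Qed.

Lemma symbol_le1 (x : R) : `|symbol x| <= 1.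
Proof.
rewrite -(@ler_pXn2r _ 2) ?nnegrE // norm_symbol_sq expr1n lecR.
by apply: (le_trans (cos_half_le _)); lra.
Qed.

Section FixedSize.
Variable n : nat.
Hypothesis n5 : (4 < n)%N.
Local Notation N := (n%:R : R).
Let n0 : (0 < n)%N. Proof. by lia. Qed.
Let n1 : (1 < n)%N. Proof. by lia. Qed.
Let N0 : N != 0. Proof. by rewrite pnatr_eq0 -lt0n. Qed.
Let N_gt0 : 0 < N. Proof. by rewrite ltr0n. Qed.
Local Notation up := (gauge_up R (n := n)).
Local Notation down := (gauge_down R (n := n)).
Local Notation A := (- 2^-1 *: scottish_flag_mx R n).

Let sq_le1 (x : R) : (`|cos x / 2| + N^-1 ^+ 2)%:C <= 1.
Proof.
rewrite lecR; have h := cos_half_le x.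
have N2 : 2 <= N by rewrite ler_nat; lia.
have : N^-1 <= 2^-1 by rewrite lef_pV2 ?posrE //; lra.
have : 0 <= N^-1 by rewrite invr_ge0; lra.
nra.
Qed.

Let up_sq i : `|up i| ^+ 2 <= 1.
Proof. by have [h _ _ _] := gauge_bounds R n5 i; apply: (le_trans h). Qed.

Let down_sq i : `|down i| ^+ 2 <= 1.
Proof. by have [_ h _ _] := gauge_bounds R n5 i; apply: (le_trans h). Qed.

Let sq_norm (z : R[i]) : `|z| ^+ 2 <= 1 -> `|z| <= 1.
Proof. by move=> h; rewrite -(@ler_pXn2r _ 2) ?nnegrE // expr1n. Qed.

Let fro_gauge (Y : 'M[R[i]]_n) : fro (Y *m cyc up down) <= 4 * fro Y.
Proof. by have := fro_mul_cyc Y up_sq down_sq; rewrite mulr1. Qed.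

Lemma spec_flag_le (z : R[i]) : z \in spec A -> `|z| <= 2.
Proof.
move=> zA; have : root (char_poly A) z by rewrite char_poly_spec root_prod_XsubC.
rewrite flag_char_poly // => /(fro_spec_le fro_gauge) h.
by rewrite -(@ler_pXn2r _ 2) ?nnegrE //; apply: (le_trans h); rewrite -natrX.
Qed.

Lemma spec_flag_moment_le a b : (a + b < n)%N ->
  `|\sum_(z <- spec A) z ^+ a * (z^*)%R ^+ b -
    (hop_count (a + b))%:R * \sum_(i < n) symbol (angle n i%:R) ^+ a * (symbol (angle n i%:R))^*%R ^+ b|
  <= 4^-1 * (off_const 4 a + off_const 4 b) * (1 + (2 * pi ^+ 2 + 12 : R)%:C) + hop_err _ (a + b) * 4.
Proof.
move=> abn; pose s (i : 'I_n) : R[i] := symbol (angle n i%:R).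
(* The total is [n / N + 2 = 3]; it is relaxed to 4, the bound for the variation of the symbol, so
   that one constant serves for both. *)
have far : \sum_(i < n) (N^-1 + 2 *+ (i == n.-1 :> nat))%:C <= 4 :> R[i].
  have e1 : \sum_(i < n) N^-1 = 1 by rewrite sumr_const card_ord -[LHS]mulr_natr mulVf.
  rewrite -rmorph_sum big_split /= e1.
  have hn : (n.-1 < n)%N by lia.
  rewrite (bigD1 (Ordinal hn)) //= eqxx big1 => [|i]; last first.
    by rewrite -val_eqE /= => /negbTE ->.
  rewrite addr0 /= mulr1n; have -> : 4 = (4 : R)%:C by rewrite rmorph_nat.
  by rewrite -[leLHS]/((1 + 2 : R)%:C) lecR; lra.
apply: (le_trans (ler_distD (\tr (cyc up down ^+ a *m (cyc up down ^+ b)^t*)) _ _)).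
apply: lerD.
  (* The departure bound with [L = pi / N] and [e = N^-2]: its factor [n] and that of
     [near_normal_moments] cancel the two inverse powers of [N]. *)
  have -> : (2 * pi ^+ 2 + 12)%:C = n%:R * (N * (2 * (pi / N) ^+ 2 + 12 * N^-1 ^+ 2))%:C :> R[i].
    rewrite -(rmorph_nat (real_complex R)) -rmorphM /=; congr (_%:C).
    by field.
  apply: near_normal_moments => //.
  - apply: (@cyc_departure _ _ _ _ (fun i : 'I_n => cos (angle n i%:R) / 2)) => //.
    + by move=> i; rewrite gauge_prod.
    + by move=> i; have [] := gauge_bounds R n5 i.
    + by move=> i; have [] := gauge_bounds R n5 i.
    + by move=> i; exact: cos_half_le.
    + by rewrite sqr_ge0 /= exprn_ile1 ?invr_ge0 ?invf_le1 ?ler1n //; lra.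
    + by move=> i; exact: ordS_cos.
  - by rewrite -flag_char_poly // char_poly_spec.
apply: (@cyc_moment _ _ _ _ _ s) => //.
- by move=> i; exact/sq_norm.
- by move=> i; exact/sq_norm.
- by move=> i; exact: symbol_le1.
- by apply: le_trans far; apply: ler_sum => i _; have [] := gauge_bounds R n5 i.
- by apply: le_trans far; apply: ler_sum => i _; have [] := gauge_bounds R n5 i.
- by have := symbol_variation R n5; rewrite (rmorph_nat (real_complex R) 4).
Qed.

End FixedSize.

Lemma spec_flag_moment a b : exists K : R, forall n, (4 < n)%N -> (a + b < n)%N ->
  `|\sum_(z <- spec (- 2^-1 *: scottish_flag_mx R n)) z ^+ a * (z^*)%R ^+ b -
    (hop_count (a + b))%:R * \sum_(i < n) symbol (angle n i%:R) ^+ a * (symbol (angle n i%:R))^*%R ^+ b|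
  <= K%:C.
Proof.
set c : R[i] := 4^-1 * (off_const 4 a + off_const 4 b) * (1 + (2 * pi ^+ 2 + 12 : R)%:C) + hop_err _ (a + b) * 4.
have c0 : 0 <= c.
  rewrite addr_ge0 // mulr_ge0 ?hop_err_ge0 // ?mulr_ge0 ?invr_ge0 ?addr_ge0 ?off_const_ge0 //.
  by rewrite ler0c; have := sqr_ge0 (pi : R); lra.
exists (complex.Re c) => n n4 abn; rewrite RRe_real ?ger0_real //.
exact: spec_flag_moment_le.
Qed.

End SpectralMoments.

(** * Riemann sums *)

Section Riemann.
Variable R : realType.
Notation mu := (@lebesgue_measure R).

Lemma lipschitz_continuous (u : R -> R) (L : R) :
  (forall x y, `|u x - u y| <= L * `|x - y|) -> continuous u.
Proof.
move=> uL x; apply/cvgrPdist_lt => e e0.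
have L0 : 0 < `|L| + 1 by rewrite ltr_wpDl.
near=> y; apply: (le_lt_trans (uL _ _)).
apply: (@le_lt_trans _ _ ((`|L| + 1) * `|x - y|)).
  by rewrite ler_wpM2r // (le_trans (ler_norm _)) // lerDl.
rewrite mulrC -ltr_pdivlMr //; near: y.
exact: (nbhsx_ballx (x : R) _ (divr_gt0 e0 L0)).
Unshelve. all: by end_near. Qed.

Lemma continuous_integrable_itv (u : R -> R) (a b : R) : continuous u ->
  mu.-integrable `[a, b] (EFin \o u).
Proof.
move=> cu; apply: continuous_compact_integrable; first exact: segment_compact.
exact: continuous_subspaceT.
Qed.

Lemma midpoint_rule (u : R -> R) (L a h : R) : 0 <= h ->
  (forall x y, `|u x - u y| <= L * `|x - y|) -> 0 <= L ->
  `|\int[mu]_(x in `]a - h, a + h]) u x - 2 * h * u a| <= 2 * h * (L * h).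
Proof.
move=> h0 uL L0; have cu := lipschitz_continuous uL.
have sub : `]a - h, a + h] `<=` `[a - h, a + h]%classic.
  by apply: subset_itvScc; rewrite bnd_simp.
have mD : measurable (`]a - h, a + h]%classic : set R) by [].
have int_u (v : R -> R) : continuous v -> mu.-integrable `]a - h, a + h] (EFin \o v).
  by move=> cv; apply: integrableS (continuous_integrable_itv (a - h) (a + h) cv).
have int_cst (c : R) : \int[mu]_(x in `]a - h, a + h]) c = 2 * h * c.
  have := lebesgue_measure_itv `]a - h, a + h]; rewrite /= lte_fin => hm.
  rewrite Rintegral_cst //= hm.
  case: ifPn => [_|]; first by rewrite -EFinB /=; ring.
  rewrite -leNgt => hh; have -> : h = 0 by lra.
  by rewrite /= !(mulr0, mul0r).
rewrite -int_cst -RintegralB //; [|exact: int_u|by apply: int_u => x; exact: cst_continuous].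
have cd : continuous (fun x => u x - u a).
  by move=> x; apply: continuousB; [exact: cu|exact: cst_continuous].
apply: le_trans.
  by apply: le_normr_Rintegral => //; exact: int_u cd.
rewrite -int_cst; apply: le_Rintegral => //.
- apply: int_u => x; apply: (@continuous_comp _ _ _ (fun x => u x - u a) (fun y : R => `|y|)).
    exact: cd.
  exact: norm_continuous.
- by apply: int_u => x; exact: cst_continuous.
- move=> x; rewrite /= in_itv /= => /andP[x1 x2]; apply: (le_trans (uL _ _)).
  by rewrite ler_wpM2l // ler_norml; lra.
Qed.

(** The angles are the midpoints of [n] cells of half-width [h = pi / n] that partition [[-pi, pi]].
    The error [n (2 h) (L h)] of the integral, multiplied by [n / (2 pi)], is [L pi]. *)
Lemma riemann_sum (u : R -> R) (L : R) n : (0 < n)%N -> 0 <= L ->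
  (forall x y, `|u x - u y| <= L * `|x - y|) ->
  `|\sum_(j < n) u (angle n j%:R) - n%:R / (2 * pi) * \int[mu]_(x in `[- pi, pi]) u x| <= L * pi.
Proof.
move=> n0 L0 uL; have cu := lipschitz_continuous uL.
have p0 := pi_gt0 R; have N0 : 0 < n%:R :> R by rewrite ltr0n.
have pn : pi != 0 :> R by rewrite gt_eqF.
have Nn : n%:R != 0 :> R by rewrite gt_eqF.
pose e (k : nat) : R := pi * (2 * k%:R - n%:R) / n%:R.
pose h : R := pi / n%:R.
have h0 : 0 <= h by rewrite divr_ge0 ?pi_ge0.
have e0 : e 0%N = - pi by rewrite /e; field; rewrite gt_eqF.
have en : e n = pi by rewrite /e; field; rewrite gt_eqF.
have eS k : e k = angle n k%:R - h by rewrite /e /h /angle; field; rewrite gt_eqF.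
have eS' k : e k.+1 = angle n k%:R + h by rewrite /e /h /angle -natr1; field; rewrite gt_eqF.
have ele k l : (k <= l)%N -> e k <= e l.
  move=> kl; rewrite /e ler_pM2r ?invr_gt0 // ler_pM2l //.
  by have : k%:R <= l%:R :> R by [rewrite ler_nat]; lra.
have step k : (k <= n)%N ->
   `|\int[mu]_(x in `[- pi, e k]) u x - 2 * h * \sum_(j < k) u (angle n j%:R)| <= k%:R * (2 * h * (L * h)).
  elim: k => [|k IH] kn.
    by rewrite e0 big_ord0 mulr0 subr0 mul0r set_itv1 Rintegral_set1 normr0.
  have piS : - pi <= e k by rewrite -e0 ele.
  have := @Rintegral_itvB R u (BLeft (- pi)) (BRight (e k.+1)) (e k).
  move=> /(_ (continuous_integrable_itv _ _ cu)).
  rewrite !bnd_simp => /(_ piS (ele _ _ (leqnSn k))) hB.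
  have -> : \int[mu]_(x in `[- pi, e k.+1]) u x =
    \int[mu]_(x in `[- pi, e k]) u x + \int[mu]_(x in `]e k, e k.+1]) u x.
    by rewrite -hB addrC subrK.
  rewrite big_ord_recr /=.
  set A := (X in X + _ - _); set B := (X in _ + X - _); set S := \sum_(_ < _) _; set U := (X in _ * (_ + X)).
  have -> : A + B - 2 * h * (S + U) = (A - 2 * h * S) + (B - 2 * h * U) by ring.
  apply: (le_trans (ler_normD _ _)); set W := (X in _ <= _ * X); have -> : k.+1%:R * W = k%:R * W + W by rewrite -[k.+1%:R]natr1; ring.
  apply: lerD; first by apply: IH; exact: ltnW.
  by rewrite /B /U eS eS'; exact: midpoint_rule.
have := step n (leqnn n); rewrite en.
set S := \sum_(_ < _) _; set I := (X in `|X - _|) => hs.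
have -> : S - n%:R / (2 * pi) * I = - (n%:R / (2 * pi)) * (I - 2 * h * S).
  rewrite /h; move: (pi : R) pn => P P0; clear -P0 Nn.
  by field; rewrite P0 Nn.
rewrite normrM normrN [`|n%:R / _|]ger0_norm ?divr_ge0 ?mulr_ge0 ?pi_ge0 //.
have -> : L * pi = n%:R / (2 * pi) * (n%:R * (2 * h * (L * h))).
  rewrite /h; move: (pi : R) pn => P P0; clear -P0 Nn.
  by field; rewrite P0 Nn.
by rewrite ler_wpM2l // divr_ge0 ?mulr_ge0 ?pi_ge0.
Qed.

Lemma expr_lipschitz (x y : R) q : 0 <= x <= 1 -> 0 <= y <= 1 ->
  `|x ^+ q - y ^+ q| <= q%:R * `|x - y|.
Proof.
move=> hx hy; elim: q => [|q IH]; first by rewrite !expr0 subrr normr0 mul0r.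
have -> : x ^+ q.+1 - y ^+ q.+1 = x * (x ^+ q - y ^+ q) + (x - y) * y ^+ q.
  by rewrite !exprS; ring.
have /andP[x0 x1] := hx; have /andP[y0 y1] := hy.
apply: (le_trans (ler_normD _ _)); rewrite !normrM -natr1 mulrDl mul1r lerD //.
  by apply: le_trans IH; rewrite ger0_norm // ler_piMl.
by rewrite ler_piMr // ger0_norm ?exprn_ge0 // exprn_ile1.
Qed.

(** [arc_pos] itself has square-root singularities, but its square is the positive part of
    [cos / 2], which is Lipschitz; even powers are all that is needed, since odd closed walks do not
    exist. *)
Lemma arc_pos_lipschitz q (x y : R) :
  `|arc_pos x ^+ q.*2 - arc_pos y ^+ q.*2| <= q%:R * `|x - y|.
Proof.
have bd (z : R) : 0 <= arc_pos z ^+ 2 <= 1.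
  by have /andP[h1 h2] := arc_pos_bound z; rewrite sqr_ge0 exprn_ile1.
rewrite -mul2n !exprM; apply: (le_trans (expr_lipschitz q (bd x) (bd y))).
rewrite ler_wpM2l //; apply: (@le_trans _ _ `|cos x - cos y|); last exact: cos_lipschitz.
rewrite /arc_pos; have [hx|hx] := lerP 0 (cos x / 2); have [hy|hy] := lerP 0 (cos y / 2).
- by rewrite !sqr_sqrtr // -mulrBl normrM [`|2^-1|]ger0_norm // ler_piMr //; lra.
- rewrite (@ler0_sqrtr _ (cos y / 2)) ?(ltW hx) ?(ltW hy) // sqr_sqrtr // expr0n subr0.
  by rewrite !ger0_norm; lra.
- rewrite (@ler0_sqrtr _ (cos x / 2)) ?(ltW hx) ?(ltW hy) // sqr_sqrtr // expr0n sub0r normrN.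
  by rewrite distrC !ger0_norm; lra.
- by rewrite (ler0_sqrtr (ltW hx)) (ler0_sqrtr (ltW hy)) subrr normr0.
Qed.

Lemma arc_pos_integral q : (0 < q)%N ->
  \int[mu]_(x in `[- pi, pi]) (arc_pos x ^+ q.*2) = 2 * (cos_moment R q / 2 ^+ q).
Proof.
move=> q0; have p0 := pi_gt0 R.
have cu : continuous (fun x : R => arc_pos x ^+ q.*2).
  exact: lipschitz_continuous (arc_pos_lipschitz q).
have := @Rintegral_itvB R (fun x : R => arc_pos x ^+ q.*2) (BLeft (- pi)) (BRight pi) 0.
move=> /(_ (continuous_integrable_itv _ _ cu)).
rewrite !bnd_simp => /(_ ltac:(lra) (pi_ge0 R)) hB.
have neg : \int[mu]_(x in `[- pi, 0]) (arc_pos x ^+ q.*2) = \int[mu]_(x in `[0, pi]) (arc_pos x ^+ q.*2).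
  rewrite /Rintegral; congr fine.
  have := @integration_by_substitution_oppr R (fun x => arc_pos x ^+ q.*2) 0 pi (pi_ge0 R).
  rewrite oppr0 => -> //; last exact: continuous_subspaceT.
  by apply: eq_integral => x _ /=; rewrite /arc_pos cosN.
have pos : \int[mu]_(x in `[0, pi]) (arc_pos x ^+ q.*2) = cos_moment R q / 2 ^+ q.
  rewrite mulrC -RintegralZl //; last exact/continuous_integrable_itv/continuous_cosX.
  rewrite Rintegral_mkcond [RHS]Rintegral_mkcond; apply: eq_Rintegral => x _.
  rewrite !patchE; case: ifPn => h1; case: ifPn => h2 //.
  - move: h2; rewrite inE /= in_itv /= => /andP[x1 x2].
    have c0 : 0 <= cos x by apply: cos_ge0_pihalf; clear -x1 x2 p0; lra.
    by rewrite /arc_pos -mul2n exprM sqr_sqrtr ?divr_ge0 // expr_div_n mulrC.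
  - move: h1 h2; rewrite inE notin_setE /= !in_itv /= => /andP[x1 x2] /negP.
    rewrite x1 -ltNge => x3.
    have : cos x < cos (pi / 2) by rewrite ltr_cos // in_itv /=; clear -x1 x2 x3 p0; lra.
    rewrite cos_pihalf => c0; rewrite /arc_pos ler0_sqrtr; last by clear -c0; lra.
    (* Here [0 < q] is used: the arc vanishes, but [0 ^+ 0 = 1]. *)
    by rewrite expr0n double_eq0 gtn_eqF.
  - move: h2 h1; rewrite inE notin_setE /= !in_itv /= => /andP[x1 x2] /negP.
    by rewrite x1 -ltNge /=; clear -x1 x2 p0; lra.
have -> : \int[mu]_(x in `[- pi, pi]) (arc_pos x ^+ q.*2) =
    \int[mu]_(x in `[- pi, 0]) (arc_pos x ^+ q.*2) + \int[mu]_(x in `]0, pi]) (arc_pos x ^+ q.*2).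
  by rewrite -hB addrC subrK.
rewrite neg Rintegral_itv_obnd_cbnd; last first.
  apply: integrableS (continuous_integrable_itv 0 pi cu) => //.
  by apply: subset_itvScc; rewrite bnd_simp.
by rewrite pos; ring.
Qed.

Lemma arc_pos_sum q n : (0 < q)%N -> (0 < n)%N ->
  `|\sum_(j < n) arc_pos (angle n j%:R) ^+ q.*2 - n%:R * (cos_moment R q / 2 ^+ q / pi)| <= q%:R * pi.
Proof.
move=> q0 n0; have := riemann_sum n0 (ler0n R q) (arc_pos_lipschitz q).
have -> : n%:R * (cos_moment R q / 2 ^+ q / pi) = n%:R / (2 * pi) * (2 * (cos_moment R q / 2 ^+ q)).
  have : pi != 0 :> R by rewrite gt_eqF // pi_gt0.
  by move: (pi : R) => P P0; field; rewrite P0 expf_neq0.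
by rewrite arc_pos_integral.
Qed.

Lemma sum_iter_ordS n m (F : 'I_n -> R) :
  \sum_i F (iter m (@ordS n) i) = \sum_i F i.
Proof.
elim: m => //= m IH; rewrite -[RHS]IH.
rewrite [RHS](reindex (@ordS n)) //=; last first.
  by exists (@ord_pred n) => i _; rewrite ?ordSK ?ord_predK.
by apply: eq_bigr => i _; rewrite -iterSr.
Qed.

Lemma cos_angle_iter n m (i : 'I_n) :
  cos (angle n (iter m (@ordS n) i)%:R) = cos (angle n i%:R + 2 * pi * m%:R / n%:R) :> R.
Proof.
have n0 : n%:R != 0 :> R by rewrite pnatr_eq0 -lt0n (leq_trans _ (ltn_ord i)).
rewrite val_iter_ordS.
have e : i%:R + m%:R = ((i + m) %% n)%N%:R + n%:R * ((i + m) %/ n)%N%:R :> R.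
  by rewrite -natrM -!natrD {1}(divn_eq (i + m) n) mulnC addnC.
have := @cis_period R (angle n ((i + m) %% n)%:R) (angle n i%:R + 2 * pi * m%:R / n%:R) ((i + m) %/ n)%:Z.
have -> : angle n i%:R + 2 * pi * m%:R / n%:R =
   angle n ((i + m) %% n)%:R + 2 * pi * ((i + m) %/ n)%:Z%:~R :> R.
  have -> : i%:R = ((i + m) %% n)%N%:R + n%:R * ((i + m) %/ n)%N%:R - m%:R :> R by rewrite -e; ring.
  by rewrite /angle; field.
by move=> /(_ erefl) /(congr1 (@complex.Re R)).
Qed.

(** [arc_neg] is [arc_pos] translated by [pi]. Rotating the indices by [n./2] realizes this
    translation exactly for even [n]; for odd [n] it misses by [pi / n], which the Lipschitz bound
    absorbs at a total cost of [q pi]. *)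
Lemma arc_neg_sum q n : (0 < q)%N -> (0 < n)%N ->
  `|\sum_(j < n) arc_neg (angle n j%:R) ^+ q.*2 - n%:R * (cos_moment R q / 2 ^+ q / pi)| <= 2 * q%:R * pi.
Proof.
move=> q0 n0; have N0 : 0 < n%:R :> R by rewrite ltr0n.
apply: (le_trans (ler_distD (\sum_(j < n) arc_pos (angle n j%:R) ^+ q.*2) _ _)).
have -> : 2 * q%:R * pi = q%:R * pi + q%:R * pi :> R by ring.
apply: lerD; last exact: arc_pos_sum.
rewrite -(sum_iter_ordS n./2 (fun j => arc_pos (angle n j%:R) ^+ q.*2)).
have -> : \sum_(j < n) arc_neg (angle n j%:R) ^+ q.*2 =
    \sum_(j < n) arc_pos (angle n j%:R + pi) ^+ q.*2 :> R.
  by apply: eq_bigr => j _; rewrite /arc_neg /arc_pos cosDpi.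
rewrite -sumrB; apply: (le_trans (ler_norm_sum _ _ _)).
have -> : q%:R * pi = \sum_(j < n) (q%:R * (pi / n%:R)) :> R.
  by rewrite sumr_const card_ord -[RHS]mulr_natr; field; rewrite gt_eqF.
apply: ler_sum => j _; rewrite {2}/arc_pos cos_angle_iter -/(arc_pos _).
apply: (le_trans (arc_pos_lipschitz q _ _)); rewrite ler_wpM2l //.
have hn : n%:R = 2 * (n./2)%:R + (odd n)%:R :> R.
  by rewrite -natrM -natrD mul2n addnC odd_double_half.
have -> : angle n j%:R + pi - (angle n j%:R + 2 * pi * (n./2)%:R / n%:R) = pi / n%:R * (odd n)%:R :> R.
  have -> : (n./2)%:R = (n%:R - (odd n)%:R) / 2 :> R by rewrite hn; field.
  by field; rewrite gt_eqF.
rewrite ger0_norm ?mulr_ge0 ?invr_ge0 ?pi_ge0 // ler_piMr ?divr_ge0 ?pi_ge0 //.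
by case: odd.
Qed.

End Riemann.

(** * Spectral moments *)

Section BorelC.
Variable R : realType.

Lemma continuous_borelC (f : R[i]^o -> R) :
  continuous f -> measurable_fun setT (f : borelC R -> R).
Proof.
move=> cf; apply: (@measurability _ _ (borelC R) R _ _ (@RGenOInfty.G R)).
  exact: RGenOInfty.measurableE.
move=> _ [_ [a ->] <-]; rewrite setTI.
apply: sub_sigma_algebra.
by move/continuousP: cf; apply; exact: interval_open.
Qed.

Lemma continuous_lipschitzC (f : R[i] -> R) :
  (forall z w, (`|f z - f w|)%:C <= `|z - w|) ->
  continuous (f : R[i]^o -> R).
Proof.
move=> fK z.
apply: (proj2 (@cvgrPdist_lt R R^o R[i]^o (nbhs (z : R[i]^o)) _ f (f z))) => e e0.
have /(@cvgrPdist_lt _ R[i]^o)/(_ e%:C) : id @ (z : R[i]^o) --> (z : R[i]^o).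
  exact: cvg_id.
rewrite ltcR => /(_ e0).
by apply: (@filterS _ (nbhs (z : R[i]^o)) _) => w zw; rewrite -ltcR; apply: le_lt_trans (fK z w) _.
Qed.

Lemma norm_Re_le (z : R[i]) : (`|complex.Re z|)%:C <= `|z|.
Proof.
case: z => a b; rewrite normc_def lecR /= -sqrtr_sqr ler_wsqrtr //.
by rewrite lerDl sqr_ge0.
Qed.

Lemma norm_Im_le (z : R[i]) : (`|complex.Im z|)%:C <= `|z|.
Proof.
case: z => a b; rewrite normc_def lecR /= -sqrtr_sqr ler_wsqrtr //.
by rewrite lerDr sqr_ge0.
Qed.

Lemma continuous_Re : continuous (@complex.Re R : R[i]^o -> R).
Proof. by apply: continuous_lipschitzC => z w; rewrite -raddfB norm_Re_le. Qed.

Lemma continuous_Im : continuous (@complex.Im R : R[i]^o -> R).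
Proof. by apply: continuous_lipschitzC => z w; rewrite -raddfB norm_Im_le. Qed.

Definition Cmeasurable (f : R[i] -> R[i]) :=
  measurable_fun setT (fun z : borelC R => complex.Re (f z)) /\
  measurable_fun setT (fun z : borelC R => complex.Im (f z)).

Lemma Cmeasurable_cst c : Cmeasurable (fun=> c).
Proof. by split; exact: measurable_cst. Qed.

Lemma Cmeasurable_id : Cmeasurable id.
Proof.
by split; apply: continuous_borelC; [exact: continuous_Re|exact: continuous_Im].
Qed.

Lemma Cmeasurable_conj f : Cmeasurable f -> Cmeasurable (fun z => (f z)^*%R).
Proof.
move=> [mr mi]; split.
  by apply: eq_measurable_fun mr => z _ /=; case: (f z).
by apply: eq_measurable_fun (measurable_funN mi) => z _ /=; case: (f z).
Qed.

Lemma CmeasurableD f g : Cmeasurable f -> Cmeasurable g ->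
  Cmeasurable (fun z => f z + g z).
Proof.
move=> [mr mi] [nr ni]; split.
  by apply: eq_measurable_fun (measurable_funD mr nr) => z _ /=; case: (f z) (g z) => a b [].
by apply: eq_measurable_fun (measurable_funD mi ni) => z _ /=; case: (f z) (g z) => a b [].
Qed.

Lemma CmeasurableM f g : Cmeasurable f -> Cmeasurable g ->
  Cmeasurable (fun z => f z * g z).
Proof.
move=> [mr mi] [nr ni]; split.
  apply: eq_measurable_fun (measurable_funB (measurable_funM mr nr) (measurable_funM mi ni)).
  by move=> z _ /=; case: (f z) (g z) => a b [].
apply: eq_measurable_fun (measurable_funD (measurable_funM mr ni) (measurable_funM mi nr)).
by move=> z _ /=; case: (f z) (g z) => a b [c d] /=.
Qed.

Lemma Cmeasurable_horner (p : {poly R[i]}) f : Cmeasurable f ->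
  Cmeasurable (fun z => p.[f z]).
Proof.
move=> mf; elim/poly_ind: p => [|p c IHp].
  have -> : (fun z => (0 : {poly R[i]}).[f z]) = fun=> 0.
    by apply/funext => z; rewrite horner0.
  exact: Cmeasurable_cst.
have -> : (fun z => (p * 'X + c%:P).[f z]) = fun z => p.[f z] * f z + c.
  by apply/funext => z; rewrite !hornerE.
by apply: CmeasurableD (Cmeasurable_cst c); exact: CmeasurableM.
Qed.

Lemma Cmeasurable_eval_conj (P : {poly {poly R[i]}}) : Cmeasurable (eval_conj P).
Proof.
elim/poly_ind: P => [|P c IHP].
  have -> : eval_conj 0 = fun=> 0 :> R[i].
    by apply/funext => z; rewrite /eval_conj !horner0.
  exact: Cmeasurable_cst.
have -> : eval_conj (P * 'X + c%:P) = fun z => eval_conj P z * z + c.[z^*%R].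
  by apply/funext => z; rewrite /eval_conj !hornerE.
apply: CmeasurableD; last exact/Cmeasurable_horner/Cmeasurable_conj/Cmeasurable_id.
by apply: CmeasurableM => //; exact: Cmeasurable_id.
Qed.

End BorelC.

(** * Moments of the limit measure *)

Section MuPi2.
Variable R : realType.
Notation nu := (@SF_line_measure R).
Notation T := (measurableTypeR R).

Lemma rayE alpha t : ray alpha t = cis alpha * (t : R)%:C.
Proof. by []. Qed.

Lemma ray_integral alpha (F : borelC R -> R) (M : R) :
  measurable_fun setT F ->
  (forall t : R, `|t| < Num.sqrt 2 -> `|F (ray alpha t)| <= M) ->
  (ray_measure alpha).-integrable setT (EFin \o F) /\
  (\int[ray_measure alpha]_z (F z)%:E = (\int[nu]_t F (ray alpha t))%:E)%E.
Proof.
move=> mF FM.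
have mFr : measurable_fun setT (F \o ray alpha : T -> R).
  by apply: measurableT_comp => //; exact: measurable_ray.
have [iF _] := SF_bounded mFr FM.
have mE : measurable_fun setT (EFin \o F) by exact/measurable_EFinP.
split.
  apply: (@integrable_pushforward _ _ T (borelC R) R (ray alpha) (@measurable_ray R alpha) _ setT (EFin \o F)) => //.
rewrite (@integral_pushforward _ _ T (borelC R) R (ray alpha) (@measurable_ray R alpha) _ setT (EFin \o F)) //.
rewrite preimage_setT /Rintegral fineK //.
by apply: integrable_fin_num.
Qed.

Lemma mu_pi2_integral (F : borelC R -> R) (M : R) :
  measurable_fun setT F ->
  (forall alpha (t : R), `|t| < Num.sqrt 2 -> `|F (ray alpha t)| <= M) ->
  (\int[mu_pi2 R]_z (F z)%:E = (\int[nu]_t F (ray (pi / 4)%R t) +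
     \int[nu]_t F (ray (3 * pi / 4)%R t))%R%:E)%E.
Proof.
move=> mF FM.
have [i1 e1] := ray_integral mF (FM (pi / 4)).
have [i2 e2] := ray_integral mF (FM (3 * pi / 4)).
by rewrite integral_measure_add // e1 e2.
Qed.

Lemma mu_pi2_integral_le (F : borelC R -> R) (M : R) :
  measurable_fun setT F ->
  (forall alpha (t : R), `|t| < Num.sqrt 2 -> `|F (ray alpha t)| <= M) ->
  `|\int[mu_pi2 R]_z F z| <= M.
Proof.
move=> mF FM; rewrite /Rintegral (mu_pi2_integral mF FM) /=.
have mFr alpha : measurable_fun setT (F \o ray alpha : T -> R).
  by apply: measurableT_comp => //; exact: measurable_ray.
have [_ h1] := SF_bounded (mFr (pi / 4)) (FM (pi / 4)).
have [_ h2] := SF_bounded (mFr (3 * pi / 4)) (FM (3 * pi / 4)).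
apply: le_trans (ler_normD _ _) _.
by rewrite [leRHS](splitr M) lerD.
Qed.

Definition line_moment k : R := if odd k then 0 else SF_moment R k./2.

Lemma line_momentE k : \int[nu]_t (t ^+ k) = line_moment k.
Proof.
rewrite /line_moment -{1}(odd_double_half k); case: (odd k) => /=.
  by rewrite add1n SF_odd_Rintegral.
by rewrite add0n SF_even_Rintegral.
Qed.

Lemma line_pow_integrable k : nu.-integrable setT (EFin \o (fun t : T => (t : R) ^+ k)).
Proof.
have mk : measurable_fun setT (fun t : T => (t : R) ^+ k) by exact: measurable_funX.
have [] // := @SF_bounded R _ (Num.sqrt 2 ^+ k) mk.
by move=> t /ltW t2; rewrite normrX lerXn2r // nnegrE.
Qed.

Lemma line_poly_integral (I : Type) (r : seq I) (c : I -> R) (k : I -> nat) :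
  nu.-integrable setT (EFin \o (fun t : T => \sum_(i <- r) c i * (t : R) ^+ k i)) /\
  \int[nu]_t (\sum_(i <- r) c i * (t : R) ^+ k i) =
  \sum_(i <- r) c i * line_moment (k i).
Proof.
elim: r => [|i r [IHi IHr]].
  rewrite big_nil.
  have -> : (fun t : T => \sum_(i <- [::]) c i * (t : R) ^+ k i) = fun=> 0.
    by apply/funext => t; rewrite big_nil.
  split; first exact: integrable0.
  by rewrite /Rintegral integral0.
have -> : (fun t : T => \sum_(j <- i :: r) c j * (t : R) ^+ k j) =
    (fun t => c i * (t : R) ^+ k i + \sum_(j <- r) c j * (t : R) ^+ k j).
  by apply/funext => t; rewrite big_cons.
have i1 : nu.-integrable setT (EFin \o (fun t : T => c i * (t : R) ^+ k i)).
  rewrite (_ : _ \o _ = fun t : T => ((c i)%:E * (EFin \o (fun s : T => ((s : R) ^+ k i)%R)) t)%E) //.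
  by apply: integrableZl => //; exact: line_pow_integrable.
split.
  rewrite (_ : _ \o _ = (EFin \o (fun t : T => (c i * (t : R) ^+ k i)%R)) \+
    (EFin \o (fun t : T => (\sum_(j <- r) c j * (t : R) ^+ k j)%R)))%E //.
  exact: integrableD.
rewrite RintegralD // big_cons IHr RintegralZl //; last exact: line_pow_integrable.
by rewrite line_momentE.
Qed.

Lemma eval_conj_sum (P : {poly {poly R[i]}}) z :
  eval_conj P z = \sum_(p : 'I_(size P) * 'I_(sizeY P))
    P`_(p.1)`_(p.2) * (z ^+ p.1 * z^*%R ^+ p.2).
Proof.
rewrite -(pair_bigA _ (fun (i : 'I_(size P)) (j : 'I_(sizeY P)) =>
  P`_i`_j * (z ^+ i * z^*%R ^+ j))) /=.
rewrite /eval_conj (horner_coef P) horner_sum; apply: eq_bigr => i _.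
rewrite -polyC_exp hornerM hornerC (horner_coef_wide _ (max_size_coefXY P i)).
by rewrite mulr_suml; apply: eq_bigr => j _; rewrite mulrAC -mulrA.
Qed.

Definition mu_moment a b : R[i] :=
  (cis (pi / 4 : R) ^+ a * (cis (pi / 4 : R))^*%R ^+ b +
   cis (3 * pi / 4 : R) ^+ a * (cis (3 * pi / 4 : R))^*%R ^+ b) * (line_moment (a + b))%:C.

Lemma ray_monomial (alpha t : R) a b :
  (ray alpha t : R[i]) ^+ a * (ray alpha t : R[i])^*%R ^+ b =
  cis alpha ^+ a * (cis alpha)^*%R ^+ b * (t ^+ (a + b))%:C.
Proof.
rewrite rayE rmorphM /= !exprMn.
have -> : ((t : R)%:C)^*%R = t%:C by rewrite conj_conjc /= oppr0.
rewrite !rmorphXn /= exprD; ring.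
Qed.

Lemma Re_sum_real (I : Type) (r : seq I) (c : I -> R[i]) (x : I -> R) :
  complex.Re (\sum_(i <- r) c i * (x i)%:C) = \sum_(i <- r) complex.Re (c i) * x i.
Proof.
elim: r => [|i r IHr]; first by rewrite !big_nil.
rewrite !big_cons -IHr; case: (c i) (\sum_(_ <- _) _) => a b [a' b'] /=.
by rewrite mulr0 subr0.
Qed.

Lemma Im_sum_real (I : Type) (r : seq I) (c : I -> R[i]) (x : I -> R) :
  complex.Im (\sum_(i <- r) c i * (x i)%:C) = \sum_(i <- r) complex.Im (c i) * x i.
Proof.
elim: r => [|i r IHr]; first by rewrite !big_nil.
rewrite !big_cons -IHr; case: (c i) (\sum_(_ <- _) _) => a b [a' b'] /=.
by rewrite mulr0 add0r.
Qed.

Lemma eval_conj_ray_bounded (P : {poly {poly R[i]}}) : exists M : R,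
  forall alpha (t : R), `|t| < Num.sqrt 2 -> `|eval_conj P (ray alpha t)| <= M%:C.
Proof.
pose X : R[i] := \sum_(p : 'I_(size P) * 'I_(sizeY P))
    `|P`_(p.1)`_(p.2)| * (Num.sqrt 2 ^+ (p.1 + p.2))%:C.
exists (complex.Re X) => alpha t t2.
have X0 : 0 <= X.
  by apply: sumr_ge0 => p _; rewrite mulr_ge0 // ler0c exprn_ge0 // sqrtr_ge0.
have -> : (complex.Re X)%:C = X by case: X X0 => a b; rewrite lecE /= => /andP[/eqP -> _].
rewrite eval_conj_sum; apply: le_trans (ler_norm_sum _ _ _) _.
apply: ler_sum => p _; rewrite ray_monomial !normrM ler_wpM2l //.
rewrite !normrX norm_conjC norm_cis !expr1n !mul1r.
rewrite normc_def /= expr0n /= addr0 sqrtr_sqr lecR normrX lerXn2r ?nnegrE //.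
exact: ltW.
Qed.

Lemma mu_pi2_eval_conj (P : {poly {poly R[i]}}) :
  Cintegral (mu_pi2 R) (eval_conj P) =
  \sum_(p : 'I_(size P) * 'I_(sizeY P)) P`_(p.1)`_(p.2) * mu_moment p.1 p.2.
Proof.
have [M PM] := eval_conj_ray_bounded P.
have [mr mi] := Cmeasurable_eval_conj P.
pose c alpha (p : 'I_(size P) * 'I_(sizeY P)) :=
  P`_(p.1)`_(p.2) * (cis alpha ^+ p.1 * (cis alpha)^*%R ^+ p.2).
have rayP alpha t : eval_conj P (ray alpha t) =
    \sum_p c alpha p * (t ^+ (p.1 + p.2))%:C.
  by rewrite eval_conj_sum; apply: eq_bigr => p _; rewrite ray_monomial mulrA.
have ReP alpha : \int[nu]_t complex.Re (eval_conj P (ray alpha t)) =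
    complex.Re (\sum_p c alpha p * (line_moment (p.1 + p.2))%:C).
  rewrite Re_sum_real -(line_poly_integral _ _ _).2.
  by apply: eq_Rintegral => t _; rewrite rayP Re_sum_real.
have ImP alpha : \int[nu]_t complex.Im (eval_conj P (ray alpha t)) =
    complex.Im (\sum_p c alpha p * (line_moment (p.1 + p.2))%:C).
  rewrite Im_sum_real -(line_poly_integral _ _ _).2.
  by apply: eq_Rintegral => t _; rewrite rayP Im_sum_real.
rewrite /Cintegral /Rintegral (mu_pi2_integral mr (M := M)); last first.
  by move=> alpha t t2; rewrite -lecR; apply: le_trans (norm_Re_le _) (PM _ _ t2).
rewrite (mu_pi2_integral mi (M := M)); last first.
  by move=> alpha t t2; rewrite -lecR; apply: le_trans (norm_Im_le _) (PM _ _ t2).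
rewrite /= !ReP !ImP -!raddfD /= -big_split /=.
rewrite [RHS](_ : _ = \sum_p (c (pi / 4)%R p * (line_moment (p.1 + p.2))%:C +
  c (3 * pi / 4)%R p * (line_moment (p.1 + p.2))%:C)).
  by case: (\sum_p _).
by apply: eq_bigr => p _; rewrite /mu_moment mulrA [X in X * _]mulrDr mulrDl.
Qed.

End MuPi2.

Section SpectralMoments.
Variable R : realType.
Notation A n := (- 2^-1 *: scottish_flag_mx R n).

Lemma size_spec n (M : 'M[R[i]]_n) : size (spec M) = n.
Proof.
apply/succn_inj; rewrite -(size_prod_XsubC (spec M) id) -char_poly_spec.
by rewrite size_char_poly.
Qed.

(** The estimates start at a size depending on the exponents. The finitely many smaller sizes are
    absorbed by adding the sum of [i |u i|] to the constant. *)
Lemma eventually_inv_bound (u : nat -> R[i]) (K : R) (m : nat) :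
  (forall n, (m < n)%N -> `|u n| <= (K / n%:R)%:C) ->
  exists C : R, forall n, (0 < n)%N -> `|u n| <= (C / n%:R)%:C.
Proof.
move=> hu; pose S := \sum_(i < m.+1) i%:R * complex.Re `|u i|.
have nE (z : R[i]) : `|z| = (complex.Re `|z|)%:C by rewrite normc_def.
have Re0 (z : R[i]) : 0 <= complex.Re `|z| by rewrite -ler0c -nE.
have S0 : 0 <= S by apply: sumr_ge0 => i _; rewrite mulr_ge0.
exists (`|K| + S) => n n0.
have n0' : 0 < n%:R :> R by rewrite ltr0n.
have [nm|mn] := leqP n m; last first.
  apply: le_trans (hu _ mn) _; rewrite lecR ler_pM2r ?invr_gt0 //.
  by rewrite (le_trans (ler_norm K)) // lerDl.
rewrite nE lecR ler_pdivlMr // mulrC.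
apply: (@le_trans _ _ S); last by rewrite lerDr.
rewrite /S (bigD1 (Ordinal (nm : n < m.+1)%N)) // lerDl.
by apply: sumr_ge0 => i _; rewrite mulr_ge0.
Qed.

(** Both arcs have the same mean [L] up to [O(1/n)], and [h * L] is [SF_moment R q]: the number of
    closed walks is the central binomial coefficient that the Wallis integral produces in the
    moments of the density. *)
Lemma symbol_sum a b q : (0 < q)%N -> (a + b = q.*2)%N ->
  exists K : R, forall n, (0 < n)%N ->
  `|(hop_count (a + b))%:R * \sum_(i < n)
       (symbol (angle n (i%:R : R)) ^+ a * (symbol (angle n (i%:R : R)))^*%R ^+ b)
     - n%:R * mu_moment R a b| <= K%:C.
Proof.
move=> q0 abq.
pose h : R := 'C(q.*2, q)%:R.
exists (h * (q%:R * pi + 2 * q%:R * pi)) => n n0.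
pose c1 : R[i] := cis (pi / 4 : R) ^+ a * (cis (pi / 4 : R))^*%R ^+ b.
pose c2 : R[i] := cis (3 * pi / 4 : R) ^+ a * (cis (3 * pi / 4 : R))^*%R ^+ b.
pose Sp := \sum_(i < n) arc_pos (angle n (i%:R : R)) ^+ q.*2.
pose Sn := \sum_(i < n) arc_neg (angle n (i%:R : R)) ^+ q.*2.
have -> : \sum_(i < n) (symbol (angle n (i%:R : R)) ^+ a * (symbol (angle n (i%:R : R)))^*%R ^+ b)
    = c1 * Sp%:C + c2 * Sn%:C.
  rewrite /Sp /Sn !rmorph_sum /= !mulr_sumr -big_split /=.
  by apply: eq_bigr => i _; rewrite symbol_pow ?abq // double_gt0.
pose L := cos_moment R q / 2 ^+ q / pi.
have -> : mu_moment R a b = (c1 + c2) * (h * L)%:C.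
  rewrite /mu_moment /line_moment abq odd_double doubleK /SF_moment.
  by congr (_ * (_)%:C); rewrite /h /L; ring.
have -> : (hop_count (a + b))%:R = h%:C :> R[i].
  by rewrite abq /hop_count odd_double doubleK (rmorph_nat (real_complex R)).
have nC : n%:R = (n%:R : R)%:C :> R[i] by rewrite (rmorph_nat (real_complex R)).
have -> : h%:C * (c1 * Sp%:C + c2 * Sn%:C) - n%:R * ((c1 + c2) * (h * L)%:C) =
    h%:C * (c1 * (Sp - n%:R * L)%:C + c2 * (Sn - n%:R * L)%:C).
  rewrite nC !rmorphB !rmorphM /=; ring.
have nc1 : `|c1| = 1 by rewrite normrM !normrX norm_conjC norm_cis !expr1n mul1r.
have nc2 : `|c2| = 1 by rewrite normrM !normrX norm_conjC norm_cis !expr1n mul1r.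
move: c1 c2 nc1 nc2 => c1 c2 nc1 nc2.
rewrite normrM normc_real (ger0_norm (ler0n _ _)) rmorphM /=.
rewrite ler_wpM2l ?ler0c ?ler0n //.
apply: le_trans (ler_normD _ _) _.
rewrite !normrM nc1 nc2 !mul1r !normc_real -rmorphD lecR.
by rewrite lerD // ?arc_pos_sum ?arc_neg_sum.
Qed.

Lemma flag_moment a b : exists C : R, forall n, (3 <= n)%N ->
  `|n%:R^-1 * (\sum_(z <- spec (A n)) z ^+ a * z^*%R ^+ b) - mu_moment R a b|
    <= (C / n%:R)%:C.
Proof.
pose D n := n%:R^-1 * (\sum_(z <- spec (A n)) z ^+ a * z^*%R ^+ b) - mu_moment R a b.
suff [K hK] : exists K : R, forall n, (maxn 4 (a + b) < n)%N -> `|D n| <= (K / n%:R)%:C.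
  have [C hC] := eventually_inv_bound hK.
  by exists C => n n3; apply: hC; apply: leq_trans n3.
(* At [a = b = 0], which [symbol_pow] excludes, both sides are the total mass 1. *)
have [/eqP|ab0] := posnP (a + b).
  rewrite addn_eq0 => /andP[/eqP a0 /eqP b0]; subst a b.
  exists 0 => n; rewrite gtn_max => /andP[n4 _].
  have n0 : n%:R != 0 :> R[i] by rewrite pnatr_eq0 -lt0n (leq_trans _ n4).
  suff -> : D n = 0 by rewrite normr0 mul0r.
  rewrite /D; under eq_bigr do rewrite !expr0 mulr1.
  rewrite big_const_seq count_predT size_spec iter_addr_0 mulVf //.
  rewrite /mu_moment !expr0 !mulr1 /line_moment /= SF_moment0.
  by rewrite rmorphV ?unitfE ?pnatr_eq0 //= (rmorph_nat (real_complex R)) -[1 + 1]/(2) mulfV ?subrr ?pnatr_eq0.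
have [K hK] := spec_flag_moment R a b.
have [K' hK'] : exists K : R, forall n, (0 < n)%N ->
  `|(hop_count (a + b))%:R * \sum_(i < n)
       (symbol (angle n (i%:R : R)) ^+ a * (symbol (angle n (i%:R : R)))^*%R ^+ b)
     - n%:R * mu_moment R a b| <= K%:C.
  (* For odd degree both sides vanish: no closed walk of odd length, and a density that is even. *)
  have [ob|eb] := boolP (odd (a + b)).
    exists 0 => n n0; rewrite /hop_count ob mul0r /mu_moment /line_moment ob.
    by rewrite mulr0 mulr0 subrr normr0.
  have e : (a + b = (a + b)./2.*2)%N by rewrite -{1}(odd_double_half (a + b)) (negbTE eb).
  by apply: (@symbol_sum a b (a + b)./2) => //; rewrite -double_gt0 -e.
exists (K + K') => n; rewrite gtn_max => /andP[n4 nab].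
have n0 : (0 < n)%N by apply: leq_trans n4.
have nn : n%:R != 0 :> R[i] by rewrite pnatr_eq0 -lt0n.
have -> : D n = n%:R^-1 * (\sum_(z <- spec (A n)) z ^+ a * z^*%R ^+ b - n%:R * mu_moment R a b).
  by rewrite mulrBr mulrA mulVf // mul1r.
rewrite normrM normfV normr_nat mulrC rmorphM /= fmorphV /= (rmorph_nat (real_complex R)).
rewrite ler_wpM2r ?invr_ge0 ?ler0n //.
set S := (X in `|X - _|).
set Y := n%:R * mu_moment R a b.
set Z := (hop_count (a + b))%:R * \sum_(i < n)
       (symbol (angle n (i%:R : R)) ^+ a * (symbol (angle n (i%:R : R)))^*%R ^+ b).
rewrite -(subrKA Z S) rmorphD; apply: le_trans (ler_normD _ _) _.
by apply: lerD; [exact: hK|exact: hK'].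
Qed.

Lemma flag_eval_conj (P : {poly {poly R[i]}}) : exists C : R, forall n, (3 <= n)%N ->
  `|n%:R^-1 * (\sum_(z <- spec (A n)) eval_conj P z)
     - Cintegral (mu_pi2 R) (eval_conj P)| <= (C / n%:R)%:C.
Proof.
have /boolp.choice[C hC] : forall p : 'I_(size P) * 'I_(sizeY P), exists C : R, forall n, (3 <= n)%N ->
  `|n%:R^-1 * (\sum_(z <- spec (A n)) z ^+ p.1 * z^*%R ^+ p.2) - mu_moment R p.1 p.2|
    <= (C / n%:R)%:C by move=> p; exact: flag_moment.
exists (\sum_(p : 'I_(size P) * 'I_(sizeY P)) complex.Re `|P`_(p.1)`_(p.2)| * C p) => n n3.
rewrite mu_pi2_eval_conj.
have -> : \sum_(z <- spec (A n)) eval_conj P z =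
    \sum_(p : 'I_(size P) * 'I_(sizeY P)) P`_(p.1)`_(p.2) *
      \sum_(z <- spec (A n)) z ^+ p.1 * z^*%R ^+ p.2.
  under eq_bigr do rewrite eval_conj_sum.
  by rewrite exchange_big /=; apply: eq_bigr => p _; rewrite mulr_sumr.
rewrite mulr_sumr -sumrB; apply: le_trans (ler_norm_sum _ _ _) _.
rewrite mulr_suml rmorph_sum /=; apply: ler_sum => p _.
rewrite mulrCA -mulrBr normrM -mulrA rmorphM /=.
have -> : (complex.Re `|P`_p.1`_p.2|)%:C = `|P`_p.1`_p.2| by rewrite normc_def.
by rewrite ler_wpM2l // hC.
Qed.

End SpectralMoments.

(** * Weak convergence *)

(* [bern u g n] is the expectation of [g] under the binomial law of parameters
   [n] and [u]. *)
Fixpoint bern (A : pzRingType) (u : A) (g : nat -> A) (n : nat) : A :=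
  if n is n'.+1
  then u * bern u (fun k => g k.+1) n' + (1 - u) * bern u g n'
  else g 0.

Lemma bern_morph (A B : pzRingType) (phi : {rmorphism A -> B}) u g n :
  phi (bern u g n) = bern (phi u) (fun k => phi (g k)) n.
Proof.
elim: n g => //= n IHn g.
by rewrite rmorphD !rmorphM rmorphB rmorph1 !IHn.
Qed.

Lemma eq_bern (A : pzRingType) (u : A) g h n : g =1 h -> bern u g n = bern u h n.
Proof.
elim: n g h => //= n IHn g h gh.
by congr (_ * _ + _ * _); apply: IHn => // k; exact: gh.
Qed.

Lemma bern_cst (A : comPzRingType) (u c : A) n : bern u (fun=> c) n = c.
Proof. by elim: n => //= n ->; ring. Qed.

Lemma bernD (A : comPzRingType) (u : A) g h n :
  bern u (fun k => g k + h k) n = bern u g n + bern u h n.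
Proof.
elim: n g h => //= n IHn g h.
by rewrite (IHn (fun k => g k.+1) (fun k => h k.+1)) IHn; ring.
Qed.

Lemma bernZ (A : comPzRingType) (u c : A) g n :
  bern u (fun k => c * g k) n = c * bern u g n.
Proof.
elim: n g => //= n IHn g.
by rewrite (IHn (fun k => g k.+1)) IHn; ring.
Qed.

(** Variance plus squared bias. The centre [c] is arbitrary because the induction shifts it:
    [k.+1 - c = k - (c - 1)]. *)
Lemma bern_sqr (A : comPzRingType) (u c : A) n :
  bern u (fun k => (k%:R - c) ^+ 2) n = n%:R * u * (1 - u) + (n%:R * u - c) ^+ 2.
Proof.
elim: n c => /= [|n IHn] c; first by ring.
rewrite (@eq_bern _ _ (fun k => (k.+1%:R - c) ^+ 2) (fun k => (k%:R - (c - 1)) ^+ 2)).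
  by rewrite !IHn -[n.+1%:R]natr1; ring.
by move=> k; rewrite -[k.+1%:R]natr1; ring.
Qed.

Section Ordered.
Variables (R : realFieldType) (u : R).
Hypothesis u01 : 0 <= u <= 1.

Lemma ler_bern g h n : (forall k, (k <= n)%N -> g k <= h k) -> bern u g n <= bern u h n.
Proof.
have [u0 u1] := andP u01.
elim: n g h => /= [|n IHn] g h gh; first exact: gh.
apply: lerD; apply: ler_wpM2l => //; rewrite ?subr_ge0 //; apply: IHn => k kn.
  exact: gh.
by apply: gh; rewrite (leq_trans kn).
Qed.

Lemma bern_dist (g : nat -> R) (h : nat -> R) (c : R) n :
  (forall k, (k <= n)%N -> `|g k - c| <= h k) -> `|bern u g n - c| <= bern u h n.
Proof.
move=> gh; rewrite ler_distl -[in c - _](bern_cst u c n) -[in c + _](bern_cst u c n).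
rewrite -[- bern u h n]mulN1r -bernZ -!bernD.
by apply/andP; split; apply: ler_bern => k /gh; rewrite ler_distl ?mulN1r => /andP[]; lra.
Qed.

Lemma bern_var n : (0 < n)%N ->
  bern u (fun k => (k%:R / n%:R - u) ^+ 2) n <= (4 * n%:R)^-1.
Proof.
move=> n0; have n0' : 0 < n%:R :> R by rewrite ltr0n.
rewrite (@eq_bern _ _ _ (fun k => (n%:R ^+ 2)^-1 * (k%:R - n%:R * u) ^+ 2)).
  rewrite bernZ bern_sqr subrr expr0n addr0 /=.
  have -> : (n%:R ^+ 2)^-1 * (n%:R * u * (1 - u)) = n%:R^-1 * (u * (1 - u)).
    by field; rewrite gt_eqF.
  rewrite invfM mulrC ler_pM2r ?invr_gt0 // -subr_ge0.
  by have -> : 4^-1 - u * (1 - u) = (u - 2^-1) ^+ 2; [field|exact: sqr_ge0].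
by move=> k; field; rewrite gt_eqF.
Qed.

End Ordered.

Section Weierstrass.
Variable R : realType.

Lemma norm_le_ReIm (z : R[i]) : `|z| <= (`|complex.Re z| + `|complex.Im z|)%:C.
Proof.
case: z => a b; rewrite normc_def lecR /= -ler_sqr ?nnegrE ?sqrtr_ge0 ?addr_ge0 //.
rewrite sqr_sqrtr ?addr_ge0 ?sqr_ge0 // sqrrD !real_normK ?num_real // -addrA lerD2l.
by rewrite lerDr mulrn_wge0 // mulr_ge0.
Qed.

Lemma continuous_at_ReIm (f : R[i]^o -> R) (z : R[i]) (e : R) : continuous f -> 0 < e ->
  exists2 d : R, 0 < d & forall w : R[i], `|complex.Re z - complex.Re w| < d ->
    `|complex.Im z - complex.Im w| < d -> `|f z - f w| < e.
Proof.
move=> cf e0; have := proj1 (@cvgrPdist_lt R R^o R[i]^o (nbhs (z : R[i]^o)) _ f (f z)) (cf z) e e0.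
move=> [r /= r0 rf].
have rE : r = (complex.Re r)%:C.
  by case: r r0 {rf} => a b; rewrite ltcE /= => /andP[/eqP -> _].
have re0 : 0 < complex.Re r by rewrite -ltcR -rE.
exists (complex.Re r / 2) => [|w h1 h2]; first by rewrite divr_gt0.
apply: rf; rewrite /ball_ /= rE; apply: le_lt_trans (norm_le_ReIm _) _.
by rewrite ltcR [ltRHS]splitr !raddfB ltrD.
Qed.

(** Only [z] is confined to the compact square; [w] is arbitrary. A covering argument gives a radius
    valid near every point of the square, including for [w] outside it. *)
Lemma uniform_on_square (f : R[i]^o -> R) (e : R) : continuous f -> 0 < e ->
  exists2 d : R, 0 < d & forall z w : R[i],
    `|complex.Re z| <= 2 -> `|complex.Im z| <= 2 ->
    `|complex.Re z - complex.Re w| < d -> `|complex.Im z - complex.Im w| < d ->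
    `|f z - f w| <= e.
Proof.
move=> cf e0.
pose K : set (R * R) := `[-2, 2]%classic `*` `[-2, 2]%classic.
have cK : compact K by apply: compact_setX; exact: segment_compact.
pose P (d : R) (p : R * R) := forall w : R[i],
  `|p.1 - complex.Re w| < d -> `|p.2 - complex.Im w| < d -> `|f (p.1 +i* p.2) - f w| <= e.
have : \forall d \near 0^'+, K `<=` P d.
  apply: (compact_near_coveringP K).1 => // -[x y] _.
  have e2 : 0 < e / 2 by rewrite divr_gt0.
  have [r r0 rf] := continuous_at_ReIm (x +i* y) cf e2.
  have r2 : 0 < r / 2 by rewrite divr_gt0.
  exists (ball ((x, y) : R * R) (r / 2), [set d | d < r / 2]).
    split; first exact: nbhsx_ballx.
    by apply: nbhs_right_lt.
  move=> [[x' y'] d] /= [[h1 h2] dr] w w1 w2.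
  rewrite /ball /= in h1 h2.
  have tri (p q t : R) : `|p - q| < r / 2 -> `|q - t| < d -> `|p - t| < r.
    move=> pq qt; apply: le_lt_trans (ler_distD q p t) _.
    by rewrite (splitr r) ltrD // (lt_trans qt).
  have half_lt (p q : R) : `|p - q| < r / 2 -> `|p - q| < r.
    by move=> /lt_trans; apply; rewrite ltr_pdivrMr // ltr_pMr // ltr1n.
  have a1 := rf (x' +i* y') (half_lt _ _ h1) (half_lt _ _ h2).
  have a2 := rf w (tri _ _ _ h1 w1) (tri _ _ _ h2 w2).
  apply: ltW; apply: le_lt_trans (ler_distD (f (x +i* y)) _ _) _.
  by rewrite (splitr e) ltrD // distrC.
move=> near_d; near (0 : R)^'+ => d.
have KP : K `<=` P d by near: d.
exists d => // -[x y] w x2 y2 xd yd.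
by apply: (KP (x, y)) => //; split; rewrite /= in_itv /= -ler_norml.
Unshelve. all: by end_near.
Qed.

(* As [f] is bounded, pairs of points far apart are absorbed by the quadratic
   term. *)
Lemma quadratic_modulus (f : R[i]^o -> R) (M e : R) : continuous f ->
  (forall z, `|f z| <= M) -> 0 < e ->
  exists2 K : R, 0 <= K & forall z w : R[i],
    `|complex.Re z| <= 2 -> `|complex.Im z| <= 2 ->
    `|f z - f w| <= e + K * ((complex.Re z - complex.Re w) ^+ 2 +
                             (complex.Im z - complex.Im w) ^+ 2).
Proof.
move=> cf fM e0; have [d d0 df] := uniform_on_square cf e0.
have M0 : 0 <= M by apply: le_trans (fM 0).
have K0 : 0 <= 2 * M / d ^+ 2 by apply: divr_ge0; [exact: mulr_ge0|exact: sqr_ge0].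
exists (2 * M / d ^+ 2) => // z w z1 z2.
set p := complex.Re z - _; set q := complex.Im z - _.
have [/andP[pd qd]|] := boolP ((`|p| < d) && (`|q| < d)).
  by apply: le_trans (df _ _ z1 z2 pd qd) _; rewrite lerDl mulr_ge0 // addr_ge0 ?sqr_ge0.
rewrite negb_and -!leNgt => pqd.
have far : d ^+ 2 <= p ^+ 2 + q ^+ 2.
  case/orP: pqd => h.
    by rewrite (@le_trans _ _ (p ^+ 2)) ?lerDl ?sqr_ge0 // -[p ^+ 2]real_normK ?num_real // lerXn2r // nnegrE // ltW.
  by rewrite (@le_trans _ _ (q ^+ 2)) ?lerDr ?sqr_ge0 // -[q ^+ 2]real_normK ?num_real // lerXn2r // nnegrE // ltW.
apply: (@le_trans _ _ (2 * M)).
  apply: le_trans (ler_normB _ _) _.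
  have -> : 2 * M = M + M by ring.
  by rewrite lerD.
apply: (@le_trans _ _ (2 * M / d ^+ 2 * d ^+ 2)).
  by rewrite divfK // expf_neq0 // gt_eqF.
by apply: le_trans (ler_wpM2l K0 far) _; rewrite lerDr ltW.
Qed.

(** The Bernstein polynomial of [f] on the square [[-2, 2]^2] containing the disc, with the real and
    imaginary parts written through [z] and its conjugate. By [quadratic_modulus] the error is
    governed by the binomial variances. *)
Lemma eval_conj_approx (f : R[i]^o -> R) (M e : R) : continuous f ->
  (forall z, `|f z| <= M) -> 0 < e ->
  exists P : {poly {poly R[i]}}, forall z : R[i], `|z| <= 2 ->
    `|f z - complex.Re (eval_conj P z)| <= e.
Proof.
move=> cf fM e0; have e2 : 0 < e / 2 by rewrite divr_gt0.
have [K K0 fK] := quadratic_modulus cf fM e2.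
(* Squaring the scale 4 of the nodes gives [16 K]; multiplied by the two variances, each at most
   [1 / (4 m)], it gives [8 K / m]. *)
have [m mpos Km] : exists2 m, (0 < m)%N & 8 * K / m%:R <= e / 2.
  exists (Num.trunc (16 * K / e)).+1 => //.
  rewrite ler_pdivrMr ?ltr0n // mulrAC ler_pdivlMr //.
  have := truncnS_gt (16 * K / e).
  by rewrite ltr_pdivrMr // => h; lra.
have m0 : 0 < m%:R :> R by rewrite ltr0n.
pose node (k : nat) : R := 4 * (k%:R / m%:R) - 2.
pose F k l := f (node k +i* node l).
pose Z : {poly {poly R[i]}} := 'X.
pose W : {poly {poly R[i]}} := 'X%:P.
pose cst (c : R[i]) : {poly {poly R[i]}} := c%:P%:P.
pose U := cst 4^-1 * (cst 2^-1 * (Z + W) + cst 2).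
pose V := cst 4^-1 * (cst (- (2^-1 * 'i%C)) * (Z - W) + cst 2).
exists (bern U (fun k => bern V (fun l => cst (F k l)%:C) m) m) => z z2.
(* Evaluation is a ring morphism and [bern] uses only ring operations, so the polynomial [bern]
   evaluates to the real one. *)
pose ev : {rmorphism {poly {poly R[i]}} -> R[i]} := horner_eval z^*%R \o horner_eval z%:P.
have evE P : eval_conj P z = ev P by [].
pose x := complex.Re z; pose y := complex.Im z.
pose u := (x + 2) / 4; pose v := (y + 2) / 4.
have evc c : ev (cst c) = c by rewrite /ev /= /horner_eval !hornerC.
have evZ : ev Z = z by rewrite /ev /= /horner_eval hornerX hornerC.
have evW : ev W = z^*%R by rewrite /ev /= /horner_eval hornerC hornerX.
have natC k : k%:R = (k%:R : R)%:C by rewrite (rmorph_nat (real_complex R)).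
have inv2 : 2^-1 = (2^-1 : R)%:C by rewrite fmorphV /= -natC.
have inv4 : 4^-1 = (4^-1 : R)%:C by rewrite fmorphV /= -natC.
have evU : ev U = u%:C.
  rewrite /U rmorphM rmorphD rmorphM rmorphD !evc evZ evW inv4 inv2 natC.
  rewrite /u /x conj_conjc; case: (z) => a b /=.
  by apply/eqP; rewrite eq_complex /=; apply/andP; split; apply/eqP; field.
have evV : ev V = v%:C.
  rewrite /V rmorphM rmorphD rmorphM rmorphB !evc evZ evW inv4 inv2 natC.
  rewrite /v /y conj_conjc; case: (z) => a b /=.
  by apply/eqP; rewrite eq_complex /=; apply/andP; split; apply/eqP; field.
have -> : eval_conj (bern U (fun k => bern V (fun l => cst (F k l)%:C) m) m) z =
    (bern u (fun k => bern v (F k) m) m)%:C.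
  rewrite evE bern_morph evU (bern_morph (real_complex R)).
  apply: eq_bern => k; rewrite !bern_morph evV; apply: eq_bern => l.
  by rewrite evc.
have x2 : `|x| <= 2 by rewrite -lecR (rmorph_nat (real_complex R) 2); apply: le_trans (norm_Re_le z) z2.
have y2 : `|y| <= 2 by rewrite -lecR (rmorph_nat (real_complex R) 2); apply: le_trans (norm_Im_le z) z2.
have u01 : 0 <= u <= 1 by move: x2; rewrite ler_norml /u => /andP[? ?]; apply/andP; split; lra.
have v01 : 0 <= v <= 1 by move: y2; rewrite ler_norml /v => /andP[? ?]; apply/andP; split; lra.
pose s (t : R) k : R := (k%:R / m%:R - t) ^+ 2.
have Fdist k l : `|F k l - f z| <= e / 2 + 16 * K * (s u k + s v l).
  have := fK z (node k +i* node l) x2 y2; rewrite distrC => h.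
  apply: le_trans h _; rewrite lerD2l /= -/x -/y /node /s /u /v.
  by rewrite le_eqVlt; apply/orP; left; apply/eqP; field; rewrite gt_eqF.
rewrite distrC /=.
have inner k : `|bern v (F k) m - f z| <= e / 2 + 16 * K * (s u k + (4 * m%:R)^-1).
  apply: le_trans (bern_dist v01 (h := fun l => e / 2 + 16 * K * (s u k + s v l)) _) _ => //.
  rewrite bernD bern_cst bernZ bernD bern_cst lerD2l ler_wpM2l ?mulr_ge0 // lerD2l.
  exact: bern_var.
apply: le_trans (bern_dist u01 (h := fun k => e / 2 + 16 * K * (s u k + (4 * m%:R)^-1)) _) _ => //.
rewrite bernD bern_cst bernZ bernD bern_cst [leRHS](splitr e) lerD2l.
apply: le_trans Km.
have -> : 8 * K / m%:R = 16 * K * ((4 * m%:R)^-1 + (4 * m%:R)^-1) by field; rewrite gt_eqF.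
by rewrite ler_wpM2l ?mulr_ge0 // lerD2r bern_var.
Qed.

End Weierstrass.

Section Weak.
Variable R : realType.
Notation nu := (@SF_line_measure R).
Notation A n := (- 2^-1 *: scottish_flag_mx R n).

Lemma ge0_integral_mean_dirac n (s : seq R[i]) (f : borelC R -> R) :
  measurable_fun setT f -> (forall z, 0 <= f z) ->
  (\int[mean_dirac n s]_z (f z)%:E = (n%:R^-1 * \sum_(z <- s) f z)%R%:E)%E.
Proof.
move=> mf f0; have mE : measurable_fun setT (EFin \o f) by exact/measurable_EFinP.
rewrite /mean_dirac ge0_integral_mscale //; last by move=> z _; rewrite lee_fin.
rewrite ge0_integral_measure_sum //; last by move=> z _; rewrite lee_fin.
rewrite EFinM; congr (_ * _)%E.
rewrite (big_nth 0) big_mkord -sumEFin; apply: eq_bigr => k _.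
by rewrite integral_dirac // diracT mul1e.
Qed.

Lemma integral_mean_dirac n (s : seq R[i]) (f : borelC R -> R) :
  measurable_fun setT f ->
  (\int[mean_dirac n s]_z (f z)%:E = (n%:R^-1 * \sum_(z <- s) f z)%R%:E)%E.
Proof.
move=> mf; rewrite integralE.
have -> : (\int[mean_dirac n s]_z (fun z => (f z)%:E)^\+ z =
    \int[mean_dirac n s]_z (Num.max (f z) 0)%:E)%E.
  by apply: eq_integral => z _; rewrite funeposE EFin_max.
have -> : (\int[mean_dirac n s]_z (fun z => (f z)%:E)^\- z =
    \int[mean_dirac n s]_z (Num.max (- f z) 0)%:E)%E.
  by apply: eq_integral => z _; rewrite funenegE EFin_max.
rewrite !ge0_integral_mean_dirac.
- rewrite -EFinB -mulrBr -sumrB; congr (_ * _)%:E; apply: eq_bigr => z _.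
  have [fz|/ltW fz] := leP 0 (f z).
    by rewrite max_r ?oppr_le0 // subr0.
  by rewrite max_l ?oppr_ge0 // sub0r opprK.
- apply: measurable_maxr => //; exact: measurable_funN.
- by move=> z; rewrite le_max lexx orbT.
- exact: measurable_maxr.
- by move=> z; rewrite le_max lexx orbT.
Qed.

Lemma norm_ray (alpha t : R) : `|ray alpha t : R[i]| = `|t|%:C.
Proof. by rewrite rayE normrM norm_cis mul1r normc_real. Qed.

(** The polynomial approximates [f] only on the disc of radius 2. This is enough: for [4 < n] the
    spectrum lies in it, and the line density is supported in [|t| <= Num.sqrt 2]. Replacing [f] on
    both sides and comparing the polynomial averages costs [e / 4] each. *)
Lemma mu_SF_weak : weak_cvg (@mu_SF R) (mu_pi2 R).
Proof.
move=> f cf [M fM]; have mf := continuous_borelC cf.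
have fray alpha (t : R) : `|t| < Num.sqrt 2 -> `|f (ray alpha t)| <= M by [].
rewrite (mu_pi2_integral mf fray).
set l := (X in X%:E).
have lE : \int[mu_pi2 R]_z f z = l by rewrite /Rintegral (mu_pi2_integral mf fray).
under eq_fun do rewrite integral_mean_dirac //.
apply: cvg_EFin; first by near=> n.
apply/cvgrPdist_le => e e0; have e4 : 0 < e / 4 by rewrite divr_gt0.
have [P hP] := eval_conj_approx cf fM e4.
have [C hC] := flag_eval_conj P.
pose g z := complex.Re (eval_conj P z).
have mg : measurable_fun setT (g : borelC R -> R) by exact: (Cmeasurable_eval_conj P).1.
have sq2 (t : R) : `|t| < Num.sqrt 2 -> `|t| <= 2.
  move=> /ltW /le_trans; apply.
  by rewrite -[leRHS]ger0_norm // -sqrtr_sqr ler_wsqrtr // -natrX ler_nat.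
have rayP alpha (t : R) : `|t| < Num.sqrt 2 -> `|f (ray alpha t) - g (ray alpha t)| <= e / 4.
  move=> /sq2 t2; apply: hP.
  by rewrite norm_ray -[2](rmorph_nat (real_complex R)) lecR.
have lP : `|l - \int[mu_pi2 R]_z g z| <= e / 4.
  have [Mg hMg] := eval_conj_ray_bounded P.
  have gray alpha (t : R) : `|t| < Num.sqrt 2 -> `|g (ray alpha t)| <= Mg.
    by move=> t2; rewrite -lecR; apply: le_trans (norm_Re_le _) (hMg _ _ t2).
  have split_ray alpha : \int[nu]_t (f (ray alpha t) - g (ray alpha t)) =
      \int[nu]_t f (ray alpha t) - \int[nu]_t g (ray alpha t).
    by rewrite RintegralB //; apply: (SF_bounded (measurableT_comp _ (measurable_ray alpha)) _).1; eauto.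
  have := mu_pi2_integral_le (measurable_funB mf mg) rayP.
  rewrite /Rintegral (mu_pi2_integral (measurable_funB mf mg) rayP) (mu_pi2_integral mg gray) /=.
  by rewrite !split_ray /l addrACA opprD.
near=> n.
have n4 : (4 < n)%N by near: n; exact: nbhs_infty_gt.
have n0 : 0 < n%:R :> R by rewrite ltr0n (leq_trans _ n4).
have emp : `|n%:R^-1 * (\sum_(z <- spec (A n)) f z) - n%:R^-1 * (\sum_(z <- spec (A n)) g z)| <= e / 4.
  rewrite -mulrBr -sumrB normrM ger0_norm ?invr_ge0 ?ler0n // ler_pdivrMl //.
  apply: le_trans (ler_norm_sum _ _ _) _.
  apply: (@le_trans _ _ (\sum_(z <- spec (A n)) e / 4)).
    rewrite big_seq [leRHS]big_seq; apply: ler_sum => z zA.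
    by apply: hP; exact: spec_flag_le zA.
  by rewrite big_const_seq count_predT size_spec iter_addr_0 mulr_natl.
have mid : `|n%:R^-1 * (\sum_(z <- spec (A n)) g z) - \int[mu_pi2 R]_z g z| <= e / 4.
  have n3 : (3 <= n)%N by rewrite (leq_trans _ n4).
  have C4 : C / n%:R <= e / 4.
    rewrite ler_pdivrMr // mulrC -ler_pdivrMr //; near: n; exact: nbhs_infty_ger.
  apply: le_trans C4; rewrite -lecR.
  apply: le_trans _ (hC n n3); apply: le_trans _ (norm_Re_le _).
  rewrite lecR le_eqVlt; apply/orP; left; apply/eqP; congr `|_|.
  have -> : n%:R^-1 = (n%:R^-1 : R)%:C by rewrite fmorphV (rmorph_nat (real_complex R)).
  have Re_mulC (x : R) (w : R[i]) : complex.Re (x%:C * w) = x * complex.Re w.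
    by case: w => a b /=; rewrite mul0r subr0.
  have ReB (u v : R[i]) : complex.Re (u - v) = complex.Re u - complex.Re v by case: u v => [? ?] [].
  have Re_sum : complex.Re (\sum_(z <- spec (A n)) eval_conj P z) =
      \sum_(z <- spec (A n)) g z by rewrite raddf_sum.
  by rewrite ReB Re_mulC Re_sum.
rewrite distrC /=.
move: lP emp mid.
rewrite !ler_distl => /andP[? ?] /andP[? ?] /andP[? ?].
by apply/andP; split; lra.
Unshelve. all: by end_near.
Qed.

End Weak.

Theorem corollary4p8 (R : realType) :
  weak_cvg (@mu_SF R) (mu_pi2 R) /\
  (forall P : {poly {poly R[i]}}, exists C : R, forall N : nat, (3 <= N)%N ->
    `| N%:R^-1 *
         (\sum_(z <- spec (- 2^-1 *: scottish_flag_mx R N)) eval_conj P z)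
       - Cintegral (mu_pi2 R) (eval_conj P) | <= (C / N%:R)%:C).
Proof. by split; [exact: mu_SF_weak|exact: flag_eval_conj]. Qed.
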